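(* (a) The critical curve $\mathscr C$ is concave and increasing (in the non-strict sense) as a function of the parameter $\frac1p\in[0,1]$. In addition, $\mathscr C(\infty)=\frac{2}{d_W}$ and $\mathscr C(2)=1$. (b) For $1\le p\le2$, $\ 1\le\mathscr C(p)\le 1+\big(\frac2p-1\big)(d_S-1)$. (c) For $2\le p\le\infty$, $\ 1+\big(\frac2p-1\big)(d_S-1)\le\mathscr C(p)\le\min\big\{1,\ \frac{2}{d_W}+\frac{d_S}{p}\big\}$.
   Context: Setting. Let $F_1,\dots,F_N$ be injective contractions of a complete metric space and $K=\bigcup_{i=1}^N F_iK$ the associated (nonempty compact) self-similar set. Put $W_0=\{\emptyset\}$, $W_m=\{1,\dots,N\}^m$, $W_*=\bigcup_{m\ge0}W_m$, $F_w=F_{w_1}\circ\cdots\circ F_{w_m}$ for $w\in W_m$, $F_\emptyset=\mathrm{id}$. Let $\Sigma=\{1,\dots,N\}^{\mathbb N}$ with left shift $s$, and $\pi:\Sigma\to K$, $\{\pi(\omega)\}=\bigcap_{m\ge1}F_{\omega_1\cdots\omega_m}K$. Let $C_K=\bigcup_{i\ne j}(F_iK\cap F_jK)$ and $\mathcal P=\bigcup_{n\ge1}s^n(\pi^{-1}(C_K))$. $K$ is assumed connected and post-critically finite (p.c.f.), i.e. $\#\mathcal P<\infty$. Put $V_0=\pi(\mathcal P)$, $V_m=\bigcup_{w\in W_m}F_wV_0$. Energy. Let $H=(H_{xy})_{x,y\in V_0}$ be a symmetric real matrix that is non-positive definite, with $Hu=0$ iff $u$ is constant on $V_0$, and $H_{xy}\ge0$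 for $x\ne y$; let $r_1,\dots,r_N\in(0,1)$. Put $\mathcal E_0(f,g)=-\sum_{x,y\in V_0}H_{xy}f(x)g(y)$ and $\mathcal E_m(f,g)=\sum_{i=1}^N r_i^{-1}\mathcal E_{m-1}(f\circ F_i,g\circ F_i)$ for functions on $V_m$, $m\ge1$; for any of these bilinear forms write $\mathcal E_m(f)=\mathcal E_m(f,\bar f)$. Assume $(H,(r_i))$ is a regular harmonic structure, i.e. (with $0<r_i<1$) $\mathcal E_0(f)=\min\{\mathcal E_1(g):g|_{V_0}=f\}$ for all $f$ on $V_0$. Put $\mathcal E(f,g)=\lim_m\mathcal E_m(f,g)$, $\mathrm{dom}\,\mathcal E=\{f\in C(K):\lim_m\mathcal E_m(f)<\infty\}$. Metric and measure. $R$ is the effective resistance metric on $K$: $R(x,y)^{-1}=\min\{\mathcal E(f):f\in\mathrm{dom}\,\mathcal E,\ f(x)=0,\ f(y)=1\}$ for $x\neq y$, normalized so that $\mathrm{diam}\,K=1$. $B_t(x)=\{y\in K:R(x,y)<t\}$. $d_H$ is defined by $\sum_i r_i^{d_H}=1$, and $\mu$ is the self-similar probability measure with $\mu=\sum_i r_i^{d_H}\mu\circ F_i^{-1}$. Put $d_W=1+d_H$ and $d_S=\frac{2d_H}{d_W}$. $L^p(K)=L^p(K,\mu)$. Harmonic functions. For $f\in\mathrm{dom}\,\mathcal E$: $\Delta f=u$ if $\mathcal E(f,\varphi)=-\int_K u\varphi\,d\mu$ for all $\varphi\in\mathrm{dom}\,\mathcal E$ with $\varphi|_{V_0}=0$.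 $\mathcal H_0=\{h\in\mathrm{dom}\,\mathcal E:\Delta h=0\}$. Lipschitz-Besov spaces. For $1\le p<\infty$, $t>0$, $I_p(f,t)=\big(\int_K t^{-d_H}\int_{B_t(x)}|f(x)-f(y)|^p\,d\mu(y)\,d\mu(x)\big)^{1/p}$, and $I_\infty(f,t)=\sup\{|f(x)-f(y)|:R(x,y)<t\}$. For $\sigma>0$, $1\le p,q\le\infty$, $\Lambda^{p,q}_\sigma(K)$ is the space of $f\in L^p(K)$ with finite norm $\|f\|_{\Lambda^{p,q}_\sigma(K)}=\|f\|_{L^p(K)}+\big(\int_0^1(t^{-\sigma d_W/2}I_p(f,t))^q\,\frac{dt}{t}\big)^{1/q}$; for $q=\infty$ the second term is $\sup_{0<t\le1}t^{-\sigma d_W/2}I_p(f,t)$. Critical curve. $\mathscr C(p)=\sup\{\sigma>0:\mathcal H_0\subset\Lambda^{p,\infty}_\sigma(K)\}$ for $1\le p\le\infty$ (with $\frac1\infty=0$). *)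

(* Defs.v *)
From HB Require Import structures.
From mathcomp Require Import all_boot all_order all_algebra.
From mathcomp Require Import complex.
From mathcomp Require Import all_classical all_reals all_analysis.

Set Implicit Arguments.
Unset Strict Implicit.
Unset Printing Implicit Defensive.

Import Order.TTheory GRing.Theory Num.Theory.
Import numFieldTopology.Exports numFieldNormedType.Exports.

Local Open Scope classical_set_scope.
Local Open Scope ring_scope.

(* The library's completeness and sigma-algebra structures come with a base
   point; the spaces considered here contain a nonempty K anyway. *)
#[short(type="completeMetricType")]
HB.structure Definition CompleteMetric (R : numDomainType) :=
  {T of Complete T & Metric R T}.

Notation borel T := (g_sigma_algebraType (@open T)).

Section SelfSimilarSets.
Context {R : realType} {M : completeMetricType R} {N : nat}.
Variables (F : 'I_N -> M -> M) (K : set M).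

Definition contractive (f : M -> M) : Prop :=
  exists2 q : R, 0 <= q < 1 & forall x y, mdist (f x) (f y) <= q * mdist x y.

Definition self_similar_set : Prop :=
  [/\ K !=set0, compact K & K = \bigcup_(i in [set: 'I_N]) (F i @` K)].

Definition word_map (w : seq 'I_N) : M -> M :=
  foldr (fun i g => F i \o g) id w.

(* Determines pi on infinite words w, as {pi w} is the intersection of the
   cells of the prefixes mkseq w m = [:: w 0; ...; w m.-1], m >= 1. *)
Definition coding_map (pi : (nat -> 'I_N) -> M) : Prop :=
  forall w : nat -> 'I_N,
    \bigcap_(m in [set m | (1 <= m)%N]) (word_map (mkseq w m) @` K)
    = [set pi w].

Definition word_shift (w : nat -> 'I_N) : nat -> 'I_N := fun n => w n.+1.

Definition overlap_set : set M :=
  \bigcup_(ij in [set ij : 'I_N * 'I_N | ij.1 != ij.2])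
    (F ij.1 @` K `&` F ij.2 @` K).

Definition post_critical_set (pi : (nat -> 'I_N) -> M) : set (nat -> 'I_N) :=
  \bigcup_(n in [set n | (1 <= n)%N])
    (iter n word_shift @` (pi @^-1` overlap_set)).

Definition boundary_set (pi : (nat -> 'I_N) -> M) : set M :=
  pi @` post_critical_set pi.

End SelfSimilarSets.

(* Functions on V_0, V_m or K are represented by functions on the ambient space
   M of which only the values on that subset are used, and a matrix indexed by
   V_0 by a function of two points. Functions are complex-valued. *)
Section Energy.
Context {R : realType} {M : completeMetricType R} {N : nat}.
Variables (F : 'I_N -> M -> M) (K V0 : set M) (H : M -> M -> R)
  (r : 'I_N -> R).

(* The sums over V_0 are finitely supported sums, meant for finite V_0. *)
Definition laplacian_matrix : Prop :=
  [/\ forall x y, V0 x -> V0 y -> H x y = H y x,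
      forall u : M -> R,
        \sum_(x \in V0) \sum_(y \in V0) H x y * u x * u y <= 0,
      forall u : M -> R,
        (forall x, V0 x -> \sum_(y \in V0) H x y * u y = 0) <->
        (exists c, forall x, V0 x -> u x = c) &
      forall x y, V0 x -> V0 y -> x != y -> 0 <= H x y].

Fixpoint level_form (m : nat) (f g : M -> R[i]) : R[i] :=
  match m with
  | 0%N => - \sum_(x \in V0) \sum_(y \in V0) (H x y)%:C%C * f x * g y
  | m'.+1 => \sum_(i < N) ((r i)^-1)%:C%C * level_form m' (f \o F i) (g \o F i)
  end.

(* level_form m f (conj f) has zero imaginary part, H being symmetric. *)
Definition level_energy (m : nat) (f : M -> R[i]) : R :=
  complex.Re (level_form m f (conjc \o f)).

Definition regular_harmonic_structure : Prop :=
  (forall i, 0 < r i < 1) /\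
  forall f : M -> R[i],
    (exists2 g, {in V0, g =1 f} & level_energy 1 g = level_energy 0 f) /\
    (forall g, {in V0, g =1 f} -> level_energy 0 f <= level_energy 1 g).

Definition energy_form (f g : M -> R[i]) : R[i] :=
  limn (fun m => level_form m f g : R[i]^o).

Definition energy (f : M -> R[i]) : R :=
  complex.Re (energy_form f (conjc \o f)).

Definition energy_dom : set (M -> R[i]) :=
  [set f | {within K, continuous (f : M -> R[i]^o)} /\
           (limn (fun m => (level_energy m f)%:E) < +oo)%E].

Definition resistance (x y : M) : R :=
  if x == y then 0 else
  (inf [set energy f | f in [set f | [/\ energy_dom f, f x = 0 & f y = 1]]])^-1.

Definition resistance_diam : R :=
  sup [set resistance xy.1 xy.2 | xy in K `*` K].

Definition resistance_ball (x : M) (t : R) : set M :=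
  [set y | K y /\ resistance x y < t].

Definition complex_integral (mu : {measure set (borel M) -> \bar R})
    (f : M -> R[i]) : R[i] :=
  ((\int[mu]_(x in K) complex.Re (f x))%R +i*
   (\int[mu]_(x in K) complex.Im (f x))%R)%C.

Definition has_laplacian (mu : {measure set (borel M) -> \bar R})
    (f u : M -> R[i]) : Prop :=
  forall phi, energy_dom phi -> (forall x, V0 x -> phi x = 0) ->
    energy_form f phi = - complex_integral mu (fun x => u x * phi x).

Definition harmonic_functions (mu : {measure set (borel M) -> \bar R}) :
    set (M -> R[i]) :=
  [set h | energy_dom h /\ has_laplacian mu h (fun=> 0)].

End Energy.

Section SelfSimilarMeasure.
Context {R : realType} {M : completeMetricType R} {N : nat}.
Variables (F : 'I_N -> M -> M) (K : set M) (r : 'I_N -> R) (dH : R).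

(* A Borel measure on K is a Borel measure on M that is carried by K. *)
Definition self_similar_measure (mu : probability (borel M) R) : Prop :=
  (mu K = 1)%E /\
  forall A : set (borel M), measurable A ->
    (mu A = \sum_(i < N) (r i `^ dH)%:E * mu (F i @^-1` A))%E.

End SelfSimilarMeasure.

Definition walk_dim {R : realType} (dH : R) : R := 1 + dH.

Definition spectral_dim {R : realType} (dH : R) : R := 2 * dH / walk_dim dH.

Section LipschitzBesov.
Context {R : realType} {M : completeMetricType R}.
Variables (K : set M) (ball : M -> R -> set M)
  (mu : probability (borel M) R) (dH : R).

Local Notation normc := (@ComplexField.Normc.normc R).

Definition measurable_on (f : M -> R[i]) : Prop :=
  measurable_fun (K : set (borel M)) (fun x : borel M => complex.Re (f x)) /\
  measurable_fun (K : set (borel M)) (fun x : borel M => complex.Im (f x)).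

Definition Lp_norm (p : \bar R) (f : M -> R[i]) : \bar R :=
  Lnorm mu p ((fun x : borel M => (normc (f x))%:E) \_ K).

Local Open Scope ereal_scope.

Definition besov_osc (p : \bar R) (f : M -> R[i]) (t : R) : \bar R :=
  match p with
  | q%:E =>
      (\int[mu]_(x in K) ((t `^ (- dH))%:E *
         \int[mu]_(y in ball x t) (normc (f x - f y) `^ q)%:E)) `^ q^-1
  | +oo => ereal_sup [set (normc (f xy.1 - f xy.2))%:E | xy in
             [set xy | [/\ K xy.1, K xy.2 & ball xy.1 t xy.2]]]
  | -oo => 0
  end.

Definition besov_seminorm (p q : \bar R) (sigma : R) (f : M -> R[i]) : \bar R :=
  match q with
  | s%:E =>
      (\int[lebesgue_measure]_(t in `]0%R, 1%R[)
         (((t `^ (- (sigma * walk_dim dH / 2)))%:E * besov_osc p f t) `^ s *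
          (t^-1)%:E)) `^ s^-1
  | +oo => ereal_sup [set (t `^ (- (sigma * walk_dim dH / 2)))%:E *
             besov_osc p f t | t in `]0%R, 1%R]]
  | -oo => 0
  end.

Definition besov_norm (p q : \bar R) (sigma : R) (f : M -> R[i]) : \bar R :=
  Lp_norm p f + besov_seminorm p q sigma f.

Definition besov_space (p q : \bar R) (sigma : R) : set (M -> R[i]) :=
  [set f | measurable_on f /\ besov_norm p q sigma f < +oo].

End LipschitzBesov.

Section CriticalCurve.
Context {R : realType} {M : completeMetricType R} {N : nat}.
Variables (F : 'I_N -> M -> M) (K V0 : set M) (H : M -> M -> R)
  (r : 'I_N -> R) (mu : probability (borel M) R) (dH : R).

(* The real-valued sup is 0 on an empty or unbounded set, so a positive lower
   bound on critical_curve p also says that this is a genuine supremum. *)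
Definition critical_curve (p : \bar R) : R :=
  sup [set sigma : R | 0 < sigma /\
    harmonic_functions F K V0 H r mu `<=`
      besov_space K (resistance_ball F K V0 H r) mu dH p +oo sigma].

End CriticalCurve.

(* Main.v *)
Require Import Defs.
From HB Require Import structures.
From mathcomp Require Import all_boot all_order all_algebra.
From mathcomp Require Import complex ring lra.
From mathcomp Require Import all_classical all_reals all_analysis.
From mathcomp Require Import measurable_realfun ess_sup_inf.

Set Implicit Arguments.
Unset Strict Implicit.
Unset Printing Implicit Defensive.

Import Order.TTheory GRing.Theory Num.Theory.
Import numFieldTopology.Exports numFieldNormedType.Exports.

Local Open Scope classical_set_scope.
Local Open Scope ring_scope.

(* Writing [e_w] for the square root of the energy of [h] on the cell [F_w K],
   rescaled to [K], one has for a harmonic [h]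
     [I_p(h, t)^p ~ t^dH * \sum_w e_w^p],
   where [w] runs over the words with [r_w ~ t]. Indeed the oscillation of [h]
   on the cell is comparable to [e_w], points at resistance distance [< c t] lie
   in cells that touch, each cell touches boundedly many others, and cells have
   mass comparable to [t^dH]. Thus [h] is in the space of order [sigma] iff
   [\sum_w e_w^p = O(t^(p b - dH))] with [b = sigma dW / 2], and for [p = oo] iff
   [e_w = O(t^b)].
   Interpolating these sums gives concavity, and comparison of exponents gives
   monotonicity. As the [r_w^-1 e_w^2] add up to the energy of [h], [C 2 = 1].
   Truncation gives [e_w = O(r_w)], so [C oo >= 2 / dW], while the net flux of [h]
   at a vertex forces [e_w >= c r_w] for some cell at each scale, so that
   [b <= 1 + dH / p]. The remaining bounds follow from concavity. *)


(** * Auxiliary estimates *)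

(** The space $\mathcal H_0$ is defined by a weak equation, while the cell estimates need minimality
    of the energy on every cell ([harm]). Piecewise harmonic functions make the link: against them
    the energy form is constant from some level on, so they serve as test functions, and also as
    cut-offs that bound the resistance from below. They are glued along images of $V_0$ from
    solutions of the boundary value problem. Cells may overlap, which is absorbed into constants:
    finiteness of the post-critical set bounds the number of cells of a cut through a point, hence
    also the number of cells that touch a given one, and every integral is compared with sums over
    products of cells with this multiplicity. The bounds $1 + (2/p - 1)(d_S - 1)$ in (b) and (c)
    describe one line: in the variable $1/p$ it passes through $(0, 2/d_W)$ and $(1/2, 1)$, so a
    concave curve through these two points lies above it between them and below it beyond. *)

Lemma continuous_mdist (R : realType) (M : metricType R) (x : M) :
  continuous (mdist x : M -> R^o).
Proof.
move=> y; apply/cvgrPdist_lt => e e0.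
have /metricType_numDomainType.cvgrPdist_lt/(_ e e0) :
  z @[z --> y] --> y by exact: cvg_id.
apply: filterS => z; apply: le_lt_trans.
have := metric_triangle x y z; have := metric_triangle x z y.
rewrite [mdist z y]metric_sym => h1 h2.
by rewrite ler_norml; apply/andP; split; lra.
Qed.

Lemma compact_mdist_bounded (R : realType) (M : metricType R) (K : set M) :
  compact K -> exists2 D : R, 0 < D &
    forall x y, K x -> K y -> mdist x y <= D.
Proof.
move=> cK; have [[x0 Kx0]|/forallNP K0] := pselect (exists x, K x); last first.
  by exists 1 => // x y /K0.
have cD : {within K, continuous (mdist x0 : M -> R^o)}.
  by apply: continuous_subspaceT; exact: continuous_mdist.
have /compact_bounded[B [_ HB]] := continuous_compact cD cK.
have {}HB x : K x -> mdist x0 x <= `|B| + 1.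
  move=> Kx; rewrite (le_trans (ler_norm _)) //.
  by apply: (HB (`|B| + 1)) => //; rewrite (le_lt_trans (ler_norm _)) ?ltrDl.
exists ((`|B| + 1) *+ 2); first by rewrite pmulrn_rgt0 // ltr_wpDl.
move=> x y Kx Ky; rewrite (le_trans (metric_triangle x x0 y)) // mulr2n.
by rewrite lerD ?HB // metric_sym HB.
Qed.

Lemma quadratic_ge0_linear (R : realFieldType) (b c : R) :
  (forall s, 0 <= s * b + s ^+ 2 * c) -> b = 0.
Proof.
move=> h; apply/eqP/negPn/negP => b0.
(* The sign of [s] makes the linear term negative, and its size makes that term dominate the
   quadratic one. *)
pose s := - (b / (2 * (`|c| + 1))).
have d0 : 0 < 2 * (`|c| + 1) by rewrite mulr_gt0 // ltr_wpDl.
have := h s; rewrite leNgt => /negP; apply.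
have -> : s * b + s ^+ 2 * c = b ^+ 2 / (2 * (`|c| + 1)) ^+ 2 * (c - 2 * (`|c| + 1)).
  by rewrite /s; field; lra.
rewrite pmulr_rlt0; first by have := ler_norm c; have := normr_ge0 c; lra.
by apply: divr_gt0; [rewrite exprn_even_gt0|rewrite exprn_gt0].
Qed.

(** Evaluation at the minimiser [- b / c]; for [c = 0] an affine function bounded below forces
    [b = 0]. Applied to a form that is only semidefinite. *)
Lemma discriminant_le (R : realFieldType) (a b c : R) : 0 <= c ->
  (forall s, 0 <= a + s * (2 * b) + s ^+ 2 * c) -> b ^+ 2 <= a * c.
Proof.
move=> c0 h; have a0 : 0 <= a by have := h 0; rewrite expr0n /= !mul0r !addr0.
have [c0'|cn0] := eqVneq c 0.
  have b0 : b = 0.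
    apply/eqP/negPn/negP => b0; have := h (- (a + 1) / (2 * b)).
    by rewrite c0' mulr0 addr0 -mulrA mulVf ?mulf_neq0 ?pnatr_eq0 //; lra.
  by rewrite b0 c0' expr0n /= mulr0.
have cp : 0 < c by rewrite lt0r cn0.
have := h (- b / c).
have -> : a + - b / c * (2 * b) + (- b / c) ^+ 2 * c = (a * c - b ^+ 2) / c by field.
by rewrite pmulr_lge0 ?invr_gt0 // subr_ge0.
Qed.

(** Turns separate constants for finitely many vertices into a common one. *)
Lemma uniform_constant (R : realFieldType) (T : eqType) (s : seq T)
    (P : T -> R -> Prop) :
  (forall x C C', C <= C' -> P x C -> P x C') ->
  (forall x, x \in s -> exists C, P x C) ->
  exists2 C, 0 < C & forall x, x \in s -> P x C.
Proof.
move=> mono; elim: s => [_|x s IH h]; first by exists 1.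
have [|C C0 HC] := IH; first by move=> y ys; apply: h; rewrite inE ys orbT.
have [C' HC'] := h x (mem_head _ _).
exists (Num.max C C'); first by rewrite lt_max C0.
move=> y; rewrite inE => /orP[/eqP->|ys].
  by apply: mono HC'; rewrite le_max lexx orbT.
by apply: mono (HC _ ys); rewrite le_max lexx.
Qed.

Lemma ler_sum_seq_mem (R : numDomainType) (T : eqType) (s : seq T) (f : T -> R)
    (x : T) : (forall y, y \in s -> 0 <= f y) -> x \in s -> f x <= \sum_(y <- s) f y.
Proof.
elim: s => // y s IH h; rewrite inE big_cons => /orP[/eqP->|xs].
  rewrite lerDl big_seq sumr_ge0 // => z zs.
  by apply: h; rewrite inE zs orbT.
rewrite (le_trans (IH _ xs)) ?lerDr ?h ?mem_head // => z zs.
by apply: h; rewrite inE zs orbT.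
Qed.

Lemma sqr_dist_triangle (R : realFieldType) (a b c C C' e : R) :
  (a - b) ^+ 2 <= C * e -> (b - c) ^+ 2 <= C' * e ->
  (a - c) ^+ 2 <= (2 * (C + C')) * e.
Proof.
move=> h1 h2; have : 0 <= ((a - b) - (b - c)) ^+ 2 by rewrite sqr_ge0.
nra.
Qed.

Lemma within_continuousP (R : realType) (M : metricType R) (K : set M) (u : M -> R) :
  {within K, continuous (u : M -> R^o)} <->
  (forall x e, K x -> 0 < e -> exists2 d, 0 < d &
     forall y, K y -> mdist x y < d -> `|u x - u y| < e).
Proof.
split=> [/subspace_continuousP cu x e Kx e0|h].
  have /cvgrPdist_lt/(_ e e0) := cu x Kx.
  move=> /metricType_numDomainType.nbhs_mdistP[d /= d0 hd].
  by exists d => // y Ky xy; apply: hd.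
apply/subspace_continuousP => x Kx; apply/cvgrPdist_lt => e e0.
have [d d0 hd] := h x e Kx e0.
by apply/metricType_numDomainType.nbhs_mdistP; exists d => //= y xy Ky; apply: hd.
Qed.

Lemma geometric_steps (R : realFieldType) (a : nat -> R) (c q : R) :
  0 <= q < 1 -> 0 <= c -> (forall m, `|a m - a m.+1| <= c * q ^+ m) ->
  forall n m, `|a n - a (n + m)%N| <= c * q ^+ n / (1 - q).
Proof.
move=> /andP[q0 q1] c0 h n m; have q1' : 0 < 1 - q by rewrite subr_gt0.
(* The exact partial geometric sum is what passes through the induction on [m]. *)
suff : `|a n - a (n + m)%N| <= c * q ^+ n / (1 - q) * (1 - q ^+ m).
  move=> /le_trans; apply; rewrite ler_piMr //.
    by rewrite divr_ge0 ?mulr_ge0 ?exprn_ge0 // ltW.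
  by rewrite lerBlDr lerDl exprn_ge0.
elim: m => [|m IH]; first by rewrite addn0 subrr normr0 expr0 subrr mulr0.
rewrite addnS (_ : a n - _ = (a n - a (n + m)%N) + (a (n + m)%N - a (n + m).+1)); last by ring.
rewrite (le_trans (ler_normD _ _)) // (le_trans (lerD IH (h _))) //.
rewrite le_eqVlt; apply/orP; left; apply/eqP.
by rewrite exprD [q ^+ m.+1]exprS; field; rewrite lt0r_neq0.
Qed.

(** Archimedean form of a passage to the limit; by contraposition it also finds an [n] with
    [c * q ^+ n] below a given positive bound. *)
Lemma le0_geometric (R : archiRealFieldType) (x c q : R) : 0 <= q < 1 -> 0 <= c ->
  (forall n, x <= c * q ^+ n) -> x <= 0.
Proof.
move=> /andP[q0 q1] c0 h; rewrite leNgt; apply/negP => x0.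
have : (fun n => q ^+ n) @ \oo --> (0 : R^o) by apply: cvg_expr; rewrite ger0_norm.
have d0 : 0 < x / (c + 1) by rewrite divr_gt0 // ltr_wpDl.
move=> /cvgrPdist_lt/(_ _ d0)[n _ /(_ n (leqnn n))].
rewrite sub0r normrN ger0_norm ?exprn_ge0 // ltr_pdivlMr ?ltr_wpDl // => hn.
have := h n; have : 0 <= q ^+ n by rewrite exprn_ge0.
lra.
Qed.

Lemma geometric_cvg (R : realType) (a : nat -> R) (c q : R) :
  0 <= q < 1 -> 0 <= c -> (forall m, `|a m - a m.+1| <= c * q ^+ m) ->
  cvgn (a : nat -> R^o) /\ `|limn (a : nat -> R^o) - a 0%N| <= c / (1 - q).
Proof.
move=> q01 c0 h; have ge := geometric_steps q01 c0 h.
have ca : cvgn (a : nat -> R^o).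
  apply/cauchy_cvgP/cauchy_exP => e e0.
  have [n hn] : exists n, c * q ^+ n / (1 - q) < e.
    apply/not_existsP => hn; have q1 : 0 < 1 - q by rewrite subr_gt0; case/andP: q01.
    suff : e <= 0 by rewrite leNgt e0.
    apply: (@le0_geometric _ _ (c / (1 - q)) q) => // [|n].
      by rewrite divr_ge0 // ltW.
    by have /negP := hn n; rewrite -leNgt mulrAC.
  exists (a n); exists n => // m /= nm; apply: le_lt_trans hn.
  by rewrite -(subnKC nm).
split=> //; rewrite -normrN opprB.
have : (fun m => `|a 0%N - a m|) @ \oo --> (`|a 0%N - limn (a : nat -> R^o)| : R^o).
  by apply: cvg_norm; apply: cvgB => //; exact: cvg_cst.
move=> cn; rewrite -(cvg_lim _ cn) //; apply: limr_le; first exact: cvgP cn.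
exists 0%N => // m _ /=.
by have := ge 0%N m; rewrite expr0 mulr1.
Qed.

(** * Modulus of complex numbers *)

Section ComplexModulus.
Context {R : rcfType}.
Local Notation normc := (@ComplexField.Normc.normc R).

Lemma normcE (z : R[i]) :
  normc z = Num.sqrt (complex.Re z ^+ 2 + complex.Im z ^+ 2).
Proof. by case: z. Qed.

Lemma normc_ge0 (z : R[i]) : 0 <= normc z.
Proof. by rewrite normcE sqrtr_ge0. Qed.

Lemma normc_le (z : R[i]) (b : R) : `|complex.Re z| <= b -> `|complex.Im z| <= b ->
  normc z <= 2 * b.
Proof.
move=> hr hi; have b0 : 0 <= b by rewrite (le_trans _ hr).
rewrite normcE -[leRHS]ger0_norm ?mulr_ge0 // -sqrtr_sqr ler_wsqrtr //.
have : complex.Re z ^+ 2 <= b ^+ 2 by rewrite -real_normK ?num_real // lerXn2r ?nnegrE.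
have : complex.Im z ^+ 2 <= b ^+ 2 by rewrite -real_normK ?num_real // lerXn2r ?nnegrE.
by have := sqr_ge0 b; rewrite exprMn; lra.
Qed.

Lemma Re_le_normc (z : R[i]) : `|complex.Re z| <= normc z.
Proof. by rewrite normcE -sqrtr_sqr ler_wsqrtr // lerDl sqr_ge0. Qed.

Lemma Im_le_normc (z : R[i]) : `|complex.Im z| <= normc z.
Proof. by rewrite normcE -sqrtr_sqr ler_wsqrtr // lerDr sqr_ge0. Qed.

Lemma normcB_trans (b a c : R[i]) : normc (a - c) <= normc (a - b) + normc (b - c).
Proof.
have := le_normcD (a - b : Rcomplex R) (b - c).
by rewrite (_ : (a - b : Rcomplex R) + (b - c) = a - c) // addrA subrK.
Qed.

Lemma normc_subC (a b : R[i]) : normc (a - b) = normc (b - a).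
Proof. by rewrite -opprB (normcN (b - a : Rcomplex R)). Qed.

End ComplexModulus.

(** * Inequalities for real powers *)

Lemma powRD_le (R : realType) (a b p : R) : 0 <= a -> 0 <= b -> 0 <= p ->
  (a + b) `^ p <= 2 `^ p * (a `^ p + b `^ p).
Proof.
move=> a0 b0 p0; wlog ab : a b a0 b0 / a <= b.
  move=> h; have [/h|/ltW/h] := leP a b; first exact.
  by rewrite addrC [X in _ * X]addrC; exact.
rewrite (@le_trans _ _ ((2 * b) `^ p)) //.
  by rewrite ge0_ler_powR ?nnegrE ?addr_ge0 ?mulr_ge0 // mulr_natl mulr2n lerD.
by rewrite powRM // ler_wpM2l ?powR_ge0 // lerDr powR_ge0.
Qed.

Lemma powR_exponent_le (R : realType) (c C a b : R) : 0 < c ->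
  (forall s, 0 < s <= 1 -> c * s `^ a <= C * s `^ b) -> b <= a.
Proof.
move=> c0 h; rewrite leNgt; apply/negP => ab.
have d0 : 0 < b - a by rewrite subr_gt0.
have C0 : 0 < C.
  have := h 1; rewrite ltr01 lexx !powR1 !mulr1 => /(_ isT).
  exact: lt_le_trans.
have h' s : 0 < s <= 1 -> c / C <= s `^ (b - a).
  move=> s01; have [s0 _] := andP s01.
  have e : s `^ b = s `^ (b - a) * s `^ a.
    by rewrite -powRD ?subrK //; apply/implyP => _; rewrite gt_eqF.
  have := h s s01; rewrite e mulrA ler_pM2r ?powR_gt0 // => h2.
  by rewrite ler_pdivrMr // [leRHS]mulrC.
(* The scale [s] below is such that its power [b - a] equals [e], which is smaller than [c / C]. *)
pose e := Num.min 1 (c / C / 2); have e0 : 0 < e by rewrite lt_min ltr01 !divr_gt0.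
pose s := e `^ (b - a)^-1.
have s0 : 0 < s by rewrite powR_gt0.
have s1 : s <= 1.
  have : e `^ (b - a)^-1 <= 1 `^ (b - a)^-1.
    rewrite ge0_ler_powR ?nnegrE ?invr_ge0 ?(ltW d0) ?(ltW e0) //.
    by rewrite ge_min lexx.
  by rewrite powR1.
have := h' s; rewrite s0 s1 => /(_ isT).
rewrite /s -powRrM mulVf ?gt_eqF // powRr1 ?(ltW e0) // /e le_min => /andP[_].
have : 0 < c / C by rewrite divr_gt0.
lra.
Qed.

(** Weak form of Young's inequality: [x] and [y] are both replaced by [x + y]. It stands in for
    Hölder's inequality when sums are interpolated. *)
Lemma powR_interpolation (R : realType) (x y a b : R) : 0 <= x -> 0 <= y ->
  0 <= a -> 0 <= b -> a + b = 1 -> x `^ a * y `^ b <= x + y.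
Proof.
move=> x0 y0 a0 b0 ab; have xy0 : 0 <= x + y by rewrite addr_ge0.
rewrite -[leRHS](powRr1 xy0) -ab powRD ?ab ?oner_eq0 //.
by rewrite ler_pM ?powR_ge0 // ge0_ler_powR ?nnegrE ?lerDl ?lerDr.
Qed.

(** For [X = e / t] this is $X^p \le 1 + X^q$, checked separately below and above [X = 1]. *)
Lemma powR_le_exponent_mix (R : realType) (e t p q : R) : 0 <= e -> 0 < t ->
  0 < p <= q -> e `^ p <= t `^ p + t `^ p / t `^ q * e `^ q.
Proof.
move=> e0 t0 /andP[p0 pq]; have [X X0 ->] : exists2 X, 0 <= X & e = X * t.
  by exists (e / t); rewrite ?divr_ge0 ?(ltW t0) // mulfVK // gt_eqF.
rewrite !powRM ?(ltW t0) //.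
rewrite (_ : _ / _ * _ = t `^ p * X `^ q); last first.
  by field; rewrite gt_eqF // powR_gt0.
rewrite mulrC -[X in _ <= X + _]mulr1 -mulrDr ler_wpM2l ?powR_ge0 //.
have [X1|/ltW X1] := leP X 1.
  rewrite ler_wpDr ?powR_ge0 //; have : X `^ p <= 1 `^ p.
    by rewrite ge0_ler_powR ?nnegrE ?(ltW p0).
  by rewrite powR1.
by rewrite ler_wpDl // ler_powR.
Qed.

(* Bounds for iterated integrals of kernels that are compared with finite sums
   of indicators of rectangles. As a nonnegative integral is a supremum over
   the simple functions below the integrand, this works for sections over
   resistance balls without discussing their measurability. *)
Section RectangleKernels.
Context d (T : measurableType d) (R : realType) (mu : probability T R).

Lemma le_ge0_integral (D : set T) (f g : T -> \bar R) :
  (forall x, D x -> 0 <= f x)%E -> (forall x, D x -> f x <= g x)%E ->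
  (\int[mu]_(x in D) f x <= \int[mu]_(x in D) g x)%E.
Proof.
move=> f0 fg; have g0 x : (D x -> 0 <= g x)%E.
  by move=> Dx; rewrite (le_trans (f0 x Dx)) ?fg.
rewrite !ge0_integralE //; apply: le_ereal_sup => _ [h hf <-]; exists h => // x.
apply: le_trans (hf x) _; rewrite !patchE; case: ifPn => // /set_mem.
exact: fg.
Qed.

Lemma integral_indic_sum (I : Type) (s : seq I) (B : I -> set T) (c : I -> R) :
  (forall j, measurable (B j)) -> (forall j, 0 <= c j) ->
  (\int[mu]_x (\sum_(j <- s) c j * \1_(B j) x)%:E =
   (\sum_(j <- s) c j * fine (mu (B j)))%:E)%E.
Proof.
move=> mB c0; under eq_integral do rewrite -sumEFin.
rewrite ge0_integral_sum //=.
- rewrite -sumEFin; apply: eq_bigr => j _.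
  under eq_integral do rewrite EFinM.
  rewrite ge0_integralZl_EFin //=.
  + rewrite integral_indic // setIT EFinM fineK //.
    exact: fin_num_measure.
  + by apply/measurable_EFinP; exact: measurable_indic.
- move=> j; apply/measurable_EFinP; apply: measurable_funM => //; exact: measurable_indic.
- by move=> j x _; rewrite lee_fin mulr_ge0.
Qed.

Variables (I : eqType) (s : seq I) (A B : I -> set T) (c : I -> R) (a : R).
Variables (D : set T) (D' : T -> set T) (k : T -> T -> R).
Hypotheses (mA : forall j, measurable (A j)) (mB : forall j, measurable (B j)).
Hypotheses (c0 : forall j, 0 <= c j) (a0 : 0 <= a).
Hypothesis k0 : forall x y, 0 <= k x y.

Let rect x y : R := \sum_(j <- s) c j * \1_(A j) x * \1_(B j) y.

Let iter_rect : (\int[mu]_x (a%:E * \int[mu]_y (rect x y)%:E) =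
  (a * \sum_(j <- s) c j * fine (mu (A j)) * fine (mu (B j)))%:E)%E.
Proof.
under eq_integral.
  move=> x _; rewrite /rect integral_indic_sum //; last first.
    by move=> j; rewrite mulr_ge0.
  rewrite -EFinM mulr_sumr.
  under eq_bigr do rewrite mulrAC mulrA.
  over.
rewrite integral_indic_sum //; last first.
  by move=> j; rewrite !mulr_ge0 // fine_ge0.
congr (_%:E); rewrite mulr_sumr; apply: eq_bigr => j _; ring.
Qed.

Lemma iterated_integral_le :
  (forall x y, D x -> D' x y -> k x y <= rect x y) ->
  (\int[mu]_(x in D) (a%:E * \int[mu]_(y in D' x) (k x y)%:E) <=
   (a * \sum_(j <- s) c j * fine (mu (A j)) * fine (mu (B j)))%:E)%E.
Proof.
move=> kr; rewrite -iter_rect integral_mkcond.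
have r0 x y : 0 <= rect x y by rewrite sumr_ge0 // => j _; rewrite !mulr_ge0.
apply: le_ge0_integral => x _; rewrite !patchE.
  case: ifPn => _; last exact: lexx.
  by rewrite mule_ge0 ?lee_fin // integral_ge0 // => y _; rewrite lee_fin.
case: ifPn => [/set_mem Dx|_]; last first.
  (* Outside [D] the patched integrand takes the default [point], which is 0 in the extended
     reals. *)
  by rewrite -[point]/(0%E) mule_ge0 ?lee_fin // integral_ge0 // => y _; rewrite lee_fin.
rewrite lee_wpmul2l ?lee_fin // integral_mkcond.
apply: le_ge0_integral => y _; rewrite !patchE.
  by case: ifPn => _; [rewrite lee_fin|exact: lexx].
by case: ifPn => [/set_mem D'y|_]; rewrite -?[point]/(0%E) lee_fin ?kr.
Qed.

Lemma iterated_integral_ge :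
  (forall j x y, j \in s -> A j x -> B j y -> D x /\ D' x y) ->
  (forall x y, D x -> D' x y -> rect x y <= k x y) ->
  ((a * \sum_(j <- s) c j * fine (mu (A j)) * fine (mu (B j)))%:E <=
   \int[mu]_(x in D) (a%:E * \int[mu]_(y in D' x) (k x y)%:E))%E.
Proof.
move=> AB kr; rewrite -iter_rect [leRHS]integral_mkcond.
have r0 x y : 0 <= rect x y by rewrite sumr_ge0 // => j _; rewrite !mulr_ge0.
have rect0 x y : ~ (D x /\ D' x y) -> rect x y = 0.
  move=> nD; apply: big1_seq => j /andP[_ js]; rewrite !indicE.
  have [/set_mem Ax|] := boolP (x \in A j); last by rewrite mulr0 mul0r.
  have [/set_mem By|] := boolP (y \in B j); last by rewrite mulr0.
  by case: nD; exact: AB js Ax By.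
apply: le_ge0_integral => x _.
  by rewrite mule_ge0 ?lee_fin // integral_ge0 // => y _; rewrite lee_fin.
rewrite patchE; case: ifPn => [/set_mem Dx|nDx]; last first.
  rewrite integral0_eq ?mule0 // => y _; rewrite rect0 // => -[Dx _].
  by move/negP: nDx; apply; exact: mem_set.
rewrite lee_wpmul2l ?lee_fin // [leRHS]integral_mkcond.
apply: le_ge0_integral => y _; first by rewrite lee_fin.
rewrite patchE; case: ifPn => [/set_mem D'y|nD']; first by rewrite lee_fin kr.
rewrite lee_fin rect0 // => -[_ D'y].
by move/negP: nD'; apply; exact: mem_set.
Qed.

End RectangleKernels.

Section HarmonicStructure.
Variables (R : realType) (M : completeMetricType R) (N : nat)
  (F : 'I_N -> M -> M) (K : set M) (pi : (nat -> 'I_N) -> M)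
  (H : M -> M -> R) (r : 'I_N -> R) (dH : R) (mu : probability (borel M) R)
  (V0 : set M).
Hypotheses (F_inj : forall i, injective (F i))
  (F_contr : forall i, contractive (F i))
  (K_self_similar : self_similar_set F K)
  (K_connected : connected K)
  (pi_coding : coding_map F K pi)
  (pcf : finite_set (post_critical_set F K pi))
  (V0_def : V0 = boundary_set F K pi)
  (H_laplacian : laplacian_matrix V0 H)
  (Hr_regular : regular_harmonic_structure F V0 H r)
  (diam1 : resistance_diam F K V0 H r = 1)
  (dH_eq : \sum_(i < N) r i `^ dH = 1)
  (mu_self_similar : self_similar_measure F K r dH mu).


(** * Cuts of the tree of words *)

Local Notation word := (seq 'I_N).

Lemma r_gt0 i : 0 < r i.
Proof. by have [/(_ i)/andP[]] := Hr_regular. Qed.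

Lemma r_lt1 i : r i < 1.
Proof. by have [/(_ i)/andP[]] := Hr_regular. Qed.

Lemma r_ge0 i : 0 <= r i. Proof. exact/ltW/r_gt0. Qed.

(** The default [2^-1] lies strictly between 0 and 1, so [rmax] and [rmin] do as well, whatever [N]
    is. *)
Definition rmax : R := \big[Num.max/2^-1]_(i < N) r i.
Definition rmin : R := \big[Num.min/2^-1]_(i < N) r i.

Lemma r_le_rmax i : r i <= rmax. Proof. exact: le_bigmax. Qed.

Lemma rmin_le_r i : rmin <= r i. Proof. exact: bigmin_le. Qed.

Lemma rmax_gt0 : 0 < rmax.
Proof. by rewrite (@lt_le_trans _ _ 2^-1) ?invr_gt0 //; exact: bigmax_ge_id. Qed.

Lemma rmax_lt1 : rmax < 1.
Proof.
apply: bigmax_lt => [|i _]; last exact: r_lt1.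
by rewrite invf_lt1 ?ltr1n.
Qed.

Lemma rmin_gt0 : 0 < rmin.
Proof. by apply: lt_bigmin => [|i _]; rewrite ?invr_gt0 ?r_gt0. Qed.

Lemma rmin_lt1 : rmin < 1.
Proof. by rewrite (@le_lt_trans _ _ 2^-1) ?bigmin_le_id // invf_lt1 ?ltr1n. Qed.

Definition ratio (w : word) : R := \prod_(i <- w) r i.

Lemma ratio_nil : ratio [::] = 1. Proof. by rewrite /ratio big_nil. Qed.

Lemma ratio_cons i w : ratio (i :: w) = r i * ratio w.
Proof. by rewrite /ratio big_cons. Qed.

Lemma ratio_cat v w : ratio (v ++ w) = ratio v * ratio w.
Proof. by rewrite /ratio big_cat. Qed.

Lemma ratio_gt0 w : 0 < ratio w.
Proof. by rewrite prodr_gt0 // => i _; exact: r_gt0. Qed.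

Lemma ratio_ge0 w : 0 <= ratio w. Proof. exact/ltW/ratio_gt0. Qed.

Lemma ratio_le w : ratio w <= rmax ^+ size w.
Proof.
elim: w => [|i w IH]; first by rewrite ratio_nil expr0.
by rewrite ratio_cons exprS ler_pM ?r_ge0 ?ratio_ge0 // r_le_rmax.
Qed.

Lemma ratio_ge w : rmin ^+ size w <= ratio w.
Proof.
elim: w => [|i w IH]; first by rewrite ratio_nil expr0.
by rewrite ratio_cons exprS ler_pM ?exprn_ge0 ?(ltW rmin_gt0) // rmin_le_r.
Qed.

Lemma ratio_le1 w : ratio w <= 1.
Proof.
by rewrite (le_trans (ratio_le w)) // exprn_ile1 ?(ltW rmax_lt1) ?(ltW rmax_gt0).
Qed.

Definition node (G : 'I_N -> seq word) : seq word :=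
  [seq i :: w | i <- enum 'I_N, w <- G i].

(* The finite sets of words such that every infinite word has exactly one
   prefix among them; they are the leaf sets of finite N-ary trees. *)
Inductive cut : seq word -> Prop :=
| cut_nil : cut [:: [::]]
| cut_node G : (forall i, cut (G i)) -> cut (node G).

Lemma big_node (T : Type) (idx : T) (op : Monoid.com_law idx)
    (G : 'I_N -> seq word) (f : word -> T) :
  \big[op/idx]_(w <- node G) f w =
  \big[op/idx]_(i < N) \big[op/idx]_(w <- G i) f (i :: w).
Proof. by rewrite big_allpairs_dep big_enum. Qed.

Lemma mem_node (G : 'I_N -> seq word) i w : (i :: w \in node G) = (w \in G i).
Proof.
apply/allpairsPdep/idP => [[j [v [_ vG [-> ->]]]]//|wG].
by exists i, w; rewrite mem_enum.
Qed.

Lemma mem_node_cons (G : 'I_N -> seq word) w :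
  w \in node G -> exists i v, w = i :: v /\ v \in G i.
Proof. by move=> /allpairsPdep[i [v [_ vG ->]]]; exists i, v. Qed.

Lemma cut_uniq G : cut G -> uniq G.
Proof.
elim=> // {}G _ IH; apply: allpairs_uniq_dep; rewrite ?enum_uniq //.
by move=> [i v] [j w] _ _ /= [-> ->].
Qed.

(** Reduces the intersection of two cells of a cut to one of two first-level cells, as the common
    prefix cancels by injectivity. *)
Lemma cut_incomparable G : cut G -> forall v w, v \in G -> w \in G -> v != w ->
  exists u i j a b, [/\ i != j, v = u ++ i :: a & w = u ++ j :: b].
Proof.
elim=> [v w|{}G _ IH v w]; first by rewrite !inE => /eqP-> /eqP->; rewrite eqxx.
move=> /mem_node_cons[i [a [-> aG]]] /mem_node_cons[j [b [-> bG]]] neq.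
have [eij|nij] := eqVneq i j; last by exists [::], i, j, a, b.
subst j; have nab : a != b by apply: contra neq => /eqP->.
have [u [k [l [c [d [kl -> ->]]]]]] := IH i a b aG bG nab.
by exists (i :: u), k, l, c, d.
Qed.

Lemma cut_prefix G : cut G -> forall om : nat -> 'I_N,
  exists2 m, mkseq om m \in G & true.
Proof.
elim=> [om|{}G _ IH om]; first by exists 0%N; rewrite ?inE.
have [m mG _] := IH (om 0%N) (fun n => om n.+1).
exists m.+1 => //; rewrite /mkseq /= (iotaDl 1 0) -map_comp mem_node.
by rewrite (_ : map _ _ = mkseq (fun n => om n.+1) m).
Qed.

Fixpoint level (m : nat) : seq word :=
  if m is m'.+1 then node (fun=> level m') else [:: [::]].

Lemma cut_level m : cut (level m).
Proof. by elim: m => [|m IH]; constructor. Qed.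

Lemma mem_level m w : (w \in level m) = (size w == m).
Proof.
elim: m w => [|m IH] [|i w] //=; last by rewrite mem_node IH.
by apply/negbTE/negP => /mem_node_cons[? [? []]].
Qed.

(* The ratios [r i] may differ, so that cells of size about [s] are indexed by
   a cut rather than by the words of some fixed length. *)
Definition scale_cut (s : R) (G : seq word) : Prop :=
  cut G /\ forall w, w \in G -> rmin * s <= ratio w <= s.

Lemma scale_cut_exists s : 0 < s <= 1 -> exists G, scale_cut s G.
Proof.
(* For large [s] the tree stops at its root, whose ratio 1 may be below [rmin * s]; hence the
   exception for the empty word. It is harmless once a letter is prefixed at a scale below 1,
   because [rmin <= r i]. *)
suff aux : forall n (s : R), 0 < s -> rmax ^+ n <= s -> exists2 G, cut G &
    forall w, w \in G -> ((w == [::]) || (rmin * s <= ratio w)) && (ratio w <= s).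
  move=> /andP[s0 s1]; have : (fun n => rmax ^+ n) @ \oo --> (0 : R^o).
    by apply: cvg_expr; rewrite ger0_norm ?(ltW rmax_gt0) ?rmax_lt1.
  move=> /cvgrPdist_lt/(_ s s0)[n _ /(_ n (leqnn n))]; rewrite sub0r normrN.
  rewrite ger0_norm ?exprn_ge0 ?(ltW rmax_gt0) // => /ltW ns.
  have [G cG HG] := aux n s s0 ns; exists G; split=> // w /HG/andP[/orP[/eqP-> -> |-> ->]] //.
  by rewrite ratio_nil mulr_ile1 ?(ltW rmin_gt0) ?(ltW s0) ?(ltW rmin_lt1).
elim=> [|n IH] {}s s0.
  rewrite expr0 => s1; exists [:: [::]]; first by constructor.
  by move=> w; rewrite inE => /eqP->; rewrite ratio_nil s1.
move=> ns; have [s1|s1] := leP 1 s.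
  exists [:: [::]]; first by constructor.
  by move=> w; rewrite inE => /eqP->; rewrite ratio_nil s1.
have /choice[G HG] : forall i, exists G, cut G /\ forall w, w \in G ->
    ((w == [::]) || (rmin * (s / r i) <= ratio w)) && (ratio w <= s / r i).
  move=> i; case: (IH (s / r i)); first by rewrite divr_gt0 ?r_gt0.
    rewrite ler_pdivlMr ?r_gt0 // (le_trans _ ns) // exprSr.
    by rewrite ler_wpM2l ?r_le_rmax ?exprn_ge0 ?(ltW rmax_gt0).
  by move=> G cG HG; exists G.
exists (node G); first by constructor=> i; have [] := HG i.
move=> w /mem_node_cons[i [v [-> vG]]]; have [_ /(_ v vG)] := HG i.
rewrite ler_pdivlMr ?r_gt0 // [ratio v * _]mulrC -ratio_cons.
move=> /andP[/orP[/eqP->|lo] ->]; rewrite andbT /= ratio_cons.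
  rewrite ratio_nil mulr1 (le_trans _ (rmin_le_r i)) //.
  by rewrite ler_piMr ?(ltW rmin_gt0) ?(ltW s1).
by rewrite [r i * _]mulrC -ler_pdivrMr ?r_gt0 // -mulrA lo.
Qed.

(** Splitting a word into its [N] children preserves the sum, by the equation that defines [dH]. *)
Lemma sum_cut_ratio_dH G : cut G -> \sum_(w <- G) ratio w `^ dH = 1.
Proof.
elim=> [|{}G _ IH]; first by rewrite big_seq1 ratio_nil powR1.
rewrite big_node -[RHS]dH_eq; apply: eq_bigr => i _.
rewrite -[RHS]mulr1 -(IH i) mulr_sumr; apply: eq_bigr => w _.
by rewrite ratio_cons powRM ?r_ge0 ?ratio_ge0.
Qed.

(** * Cells and codes *)

Lemma K_compact : compact K. Proof. by have [] := K_self_similar. Qed.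

Lemma K_closed : closed K.
Proof. by apply: compact_closed; [exact: metric_hausdorff|exact: K_compact]. Qed.

Lemma F_K i x : K x -> K (F i x).
Proof.
by move=> Kx; have [_ _ ->] := K_self_similar; exists i => //; exists x.
Qed.

Lemma word_K w x : K x -> K (word_map F w x).
Proof. by move=> Kx; elim: w => //= i w IH; exact: F_K. Qed.

Lemma word_map_cat v w x :
  word_map F (v ++ w) x = word_map F v (word_map F w x).
Proof. by elim: v => //= i v ->. Qed.

Lemma word_map_inj w : injective (word_map F w).
Proof. by elim: w => [x y//|i w IH x y /F_inj/IH]. Qed.

Lemma F_lipschitz : exists q : R, 0 <= q < 1 /\
  forall i x y, mdist (F i x) (F i y) <= q * mdist x y.
Proof.
have /choice[q Hq] : forall i, exists q : R, 0 <= q < 1 /\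
    forall x y, mdist (F i x) (F i y) <= q * mdist x y.
  by move=> i; have [q q01 Hq] := F_contr i; exists q.
exists (\big[Num.max/0]_i q i); split.
  rewrite bigmax_ge_id /=; apply: bigmax_lt => // i _.
  by have [/andP[]] := Hq i.
move=> i x y; have [_ /(_ x y) h] := Hq i; rewrite (le_trans h) //.
by rewrite ler_wpM2r ?mdist_ge0 // le_bigmax.
Qed.

Lemma F_continuous i : continuous (F i).
Proof.
have [q [/andP[q0 q1] Hq]] := F_lipschitz => x.
apply/metricType_numDomainType.cvgrPdist_lt => e e0.
have /metricType_numDomainType.cvgrPdist_lt/(_ e e0) :
  z @[z --> x] --> x by exact: cvg_id.
apply: filterS => z; apply: le_lt_trans; rewrite (le_trans (Hq _ _ _)) //.
by rewrite ler_piMl ?mdist_ge0 // ltW.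
Qed.

Lemma word_continuous w : continuous (word_map F w).
Proof.
elim: w => [x|i w IH x]; first exact: cvg_id.
apply: (@continuous_comp _ _ _ (word_map F w) (F i)); first exact: IH.
exact: F_continuous.
Qed.

Lemma cell_compact w : compact (word_map F w @` K).
Proof.
apply: continuous_compact K_compact.
by apply: continuous_subspaceT; exact: word_continuous.
Qed.

Lemma cell_closed w : closed (word_map F w @` K).
Proof. by apply: compact_closed; [exact: metric_hausdorff|exact: cell_compact]. Qed.

Lemma cell_diam_small (e : R) : 0 < e -> exists m, forall w x y,
  (m <= size w)%N -> K x -> K y ->
  mdist (word_map F w x) (word_map F w y) < e.
Proof.
move=> e0; have [q [/andP[q0 q1] Hq]] := F_lipschitz.
have [D D0 HD] := compact_mdist_bounded K_compact.
have Hw w x y : mdist (word_map F w x) (word_map F w y) <= q ^+ size w * mdist x y.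
  elim: w => [|i w IH] /=; first by rewrite mul1r.
  by rewrite (le_trans (Hq _ _ _)) // exprS -mulrA ler_wpM2l.
have : (fun n => q ^+ n) @ \oo --> (0 : R^o).
  by apply: cvg_expr; rewrite ger0_norm.
move=> /cvgrPdist_lt/(_ (e / D)); rewrite divr_gt0 // => /(_ isT)[m _ Hm].
exists m => w x y mw Kx Ky; rewrite (le_lt_trans (Hw _ _ _)) //.
rewrite (@le_lt_trans _ _ (q ^+ size w * D)) ?ler_wpM2l ?exprn_ge0 ?HD //.
rewrite -ltr_pdivlMr //; have := Hm _ mw.
by rewrite sub0r normrN ger0_norm ?exprn_ge0.
Qed.

Definition scons (i : 'I_N) (om : nat -> 'I_N) : nat -> 'I_N :=
  fun n => if n is n'.+1 then om n' else i.

Lemma mkseq_scons i om m : mkseq (scons i om) m.+1 = i :: mkseq om m.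
Proof.
by rewrite /mkseq /= (iotaDl 1 0) -map_comp.
Qed.

Lemma scons_shift om : scons (om 0%N) (word_shift om) = om.
Proof. by apply/funext => -[]. Qed.

Lemma pi_cell om m : (word_map F (mkseq om m) @` K) (pi om).
Proof.
have h n : (1 <= n)%N -> (word_map F (mkseq om n) @` K) (pi om).
  move=> n1; have : [set pi om] (pi om) by [].
  by rewrite -pi_coding; apply.
case: m => [|m]; last exact: h.
have [x Kx <-] := h 1%N isT; exists (word_map F (mkseq om 1) x) => //.
exact: word_K.
Qed.

Lemma pi_K om : K (pi om).
Proof. by have [x Kx] := pi_cell om 0; rewrite /= => <-. Qed.

Lemma pi_scons i om : pi (scons i om) = F i (pi om).
Proof.
suff : [set pi (scons i om)] (F i (pi om)) by move=> ->.
rewrite -pi_coding => -[//|m _]; rewrite mkseq_scons.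
by have [x Kx <-] := pi_cell om m; exists x.
Qed.

Lemma pi_shift om : pi om = F (om 0%N) (pi (word_shift om)).
Proof. by rewrite -pi_scons scons_shift. Qed.

Definition wcat (w : word) (om : nat -> 'I_N) : nat -> 'I_N := foldr scons om w.

Lemma pi_wcat w om : pi (wcat w om) = word_map F w (pi om).
Proof. by elim: w => //= i w IH; rewrite pi_scons IH. Qed.

Lemma mkseq_wcat w om : mkseq (wcat w om) (size w) = w.
Proof. by elim: w => //= i w IH; rewrite mkseq_scons IH. Qed.

Lemma iter_shift_wcat w om : iter (size w) (@word_shift N) (wcat w om) = om.
Proof. by elim: w => //= i w IH; rewrite -iterS iterSr. Qed.

(** A chosen preimage map on [K] is iterated from [x], and the letters met along the way form a
    code. *)
Lemma coded x : K x -> exists om, pi om = x.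
Proof.
move=> Kx; have step : forall y : {y | K y}, exists iz : 'I_N * {z | K z},
    F iz.1 (sval iz.2) = sval y.
  move=> [y Ky] /=; move: (Ky); have [_ _ eK] := K_self_similar.
  rewrite {1}eK => -[i _ [z Kz <-]].
  by exists (i, exist _ z Kz).
have [nx Hnx] := choice step.
pose y n := iter n (fun y => (nx y).2) (exist _ x Kx).
pose om n := (nx (y n)).1; exists om.
suff : [set pi om] x by [].
rewrite -pi_coding => m _; exists (sval (y m)); first exact: svalP.
elim: m => [//|m IH]; rewrite -IH mkseqS -cats1 word_map_cat /=.
by rewrite -[in RHS](Hnx (y m)).
Qed.

Local Notation cell w := (word_map F w @` K).
Local Notation codes_critical := (post_critical_set F K pi).

(** The word [i :: a] followed by [om] codes a point of $F_iK \cap F_jK$; removing the prefix takes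
    at least one shift, as the post-critical set demands. *)
Lemma critical_of_overlap i j a om : i != j ->
  (F j @` K) (pi (wcat (i :: a) om)) -> codes_critical om.
Proof.
move=> ij Fj; exists (size (i :: a)) => //; exists (wcat (i :: a) om).
  exists (i, j) => //=; split=> //; rewrite pi_scons.
  by exists (pi (wcat a om)) => //; exact: pi_K.
exact: iter_shift_wcat.
Qed.

Lemma V0_pi om : codes_critical om -> V0 (pi om).
Proof. by move=> Pom; rewrite V0_def; exists om. Qed.

Lemma critical_shift om : codes_critical om -> codes_critical (word_shift om).
Proof.
by move=> [n n1 [om' h <-]]; exists n.+1 => //; exists om' => //; rewrite iterS.
Qed.

Lemma V0_K x : V0 x -> K x.
Proof. by rewrite V0_def => -[om _ <-]; exact: pi_K. Qed.

(** The post-critical set is stable under the shift; this yields $V_0 \subset V_1$. *)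
Lemma V0_succ x : V0 x -> exists i y, V0 y /\ x = F i y.
Proof.
rewrite V0_def => -[om Pom <-]; exists (om 0%N), (pi (word_shift om)).
split; last exact: pi_shift.
by exists (word_shift om) => //; exact: critical_shift.
Qed.

(** Codes that begin differently place the point in two first-level cells, so what follows the first
    letter is critical. *)
Lemma critical_branch om om' : pi om = pi om' -> om 0%N != om' 0%N ->
  codes_critical (word_shift om).
Proof.
move=> e neq; apply: (@critical_of_overlap (om 0%N) (om' 0%N) [::]) => //=.
rewrite scons_shift e pi_shift.
by exists (pi (word_shift om')) => //; exact: pi_K.
Qed.

Lemma overlap_V0 i j x y : i != j -> K x -> K y -> F i x = F j y -> V0 x.
Proof.
move=> ij Kx Ky e; have [om ex] := coded Kx; rewrite -ex; apply: V0_pi.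
apply: (@critical_of_overlap i j [::] om ij).
by rewrite pi_scons /= ex e; exists y.
Qed.

(** After cancellation of the common prefix the point is seen in two different first-level cells, so
    a code of [x] is a tail of an overlap code. *)
Lemma cut_overlap_V0 G v w x y : cut G -> v \in G -> w \in G -> v != w ->
  K x -> K y -> word_map F v x = word_map F w y -> V0 x.
Proof.
move=> cG vG wG vw Kx Ky.
have [u [i [j [a [b [ij -> ->]]]]]] := cut_incomparable cG vG wG vw.
rewrite !word_map_cat => /word_map_inj /= e.
have [om ex] := coded Kx; rewrite -ex; apply: V0_pi.
apply: (critical_of_overlap (a := a) ij).
by rewrite pi_scons pi_wcat ex e; exists (word_map F b y) => //; exact: word_K.
Qed.

Lemma V0_finite : finite_set V0.
Proof. by rewrite V0_def; apply: finite_image; exact: pcf. Qed.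

(** Such a code is one of [N] letters followed by one of finitely many critical codes. *)
Lemma overlap_codes_finite : finite_set (pi @^-1` overlap_set F K).
Proof.
apply: (@sub_finite_set _ _
  (\bigcup_(i in [set: 'I_N]) (scons i @` codes_critical))); last first.
  by apply: bigcup_finite => // i _; apply: finite_image; exact: pcf.
move=> om Com; exists (om 0%N) => //; exists (word_shift om).
  by exists 1%N => //; exists om.
exact: scons_shift.
Qed.

Lemma cut_prefix_inj G om v w : cut G -> v \in G -> w \in G ->
  mkseq om (size v) = v -> mkseq om (size w) = w -> v = w.
Proof.
move=> cG vG wG ev ew; apply/eqP/negPn/negP => vw.
have [u [i [j [a [b [ij e1 e2]]]]]] := cut_incomparable cG vG wG vw.
have h c t : mkseq om (size (u ++ c :: t)) = u ++ c :: t -> om (size u) = c.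
  move/(congr1 (fun s => nth c s (size u))); rewrite nth_mkseq.
    by rewrite nth_cat ltnn subnn.
  by rewrite size_cat /= addnS ltnS leq_addr.
move: ij; rewrite -(h i a) -?e1 //.
by rewrite -(h j b) -?e2 ?eqxx.
Qed.

(** If [x] lies in two first-level cells, the words whose cells contain [x] extend to distinct codes
    of [x], all in the finite set of overlap codes. Otherwise at most one subtree is concerned, and
    induction applies to it. *)
Lemma cell_multiplicity : exists L : nat, forall G x, cut G ->
  (\sum_(w <- G | `[< cell w x >]) 1 <= L)%N.
Proof.
have /finite_seqP[Q HQ] := overlap_codes_finite; exists (maxn 1 (size Q)).
move=> G x cG; elim: cG x => [x|{}G cG IH x].
  by rewrite big_mkcond big_seq1 leq_max; case: ifP.
have [[i [j [ij xi xj]]]|/forallNP nij] :=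
    pselect (exists i j, [/\ i != j, (F i @` K) x & (F j @` K) x]).
  rewrite leq_max; apply/orP; right; rewrite sum1_count -size_filter.
  set s := [seq w <- _ | _]; have code w : exists om, w \in s -> pi om = x /\
      mkseq om (size w) = w.
    have [/[!mem_filter]/andP[/asboolP[y Ky <-] _]|ws] := boolP (w \in s).
      have [om eom] := coded Ky; exists (wcat w om) => _.
      by rewrite pi_wcat eom mkseq_wcat.
    by exists (fun=> i).
  have [c Hc] := choice code; rewrite -(size_map c).
  have cGn : cut (node G) by constructor.
  apply: uniq_leq_size.
    rewrite map_inj_in_uniq ?filter_uniq ?cut_uniq // => v w vs ws e.
    have [_ ev] := Hc _ vs; have [_ ew] := Hc _ ws.
    have vG : v \in node G by move: vs; rewrite mem_filter => /andP[].
    have wG : w \in node G by move: ws; rewrite mem_filter => /andP[].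
    by apply: (cut_prefix_inj cGn vG wG ev); rewrite e.
  move=> om /mapP[w ws ->]; suff : [set` Q] (c w) by [].
  by rewrite -HQ /=; have [-> _] := Hc _ ws; exists (i, j).
have [[i [z Kz xz]]|/forallNP ni] := pselect (exists i, (F i @` K) x); last first.
  rewrite big1_seq // => w /andP[/asboolP[y Ky xy]] /mem_node_cons[i [v [wv _]]].
  by case: (ni i); rewrite -xy wv; exists (word_map F v y) => //; exact: word_K.
rewrite big_mkcond big_node (bigD1 i) //= [X in (_ + X)%N]big1 ?addn0.
  rewrite -big_mkcond /= (leq_trans _ (IH i z)) //.
  apply/eq_leq/eq_bigl => w; apply: asbool_equiv_eq.
  rewrite -xz; split=> -[y Ky]; first by move/F_inj => <-; exists y.
  by move=> <-; exists y.
move=> j ji; rewrite big1 // => w _; case: ifPn => // /asboolP[y Ky xy].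
case: (nij i); exists j; split; first by rewrite eq_sym.
  by exists z.
by exists (word_map F w y) => //; exact: word_K.
Qed.

Definition V0seq : seq M := finmap.enum_fset (fset_set V0).

Lemma mem_V0seq x : (x \in V0seq) = `[< V0 x >].
Proof.
exact: etrans (in_fset_set V0_finite x) _.
Qed.

Lemma V0seqP x : reflect (V0 x) (x \in V0seq).
Proof. by rewrite mem_V0seq; exact: asboolP. Qed.

Lemma V0seq_uniq : uniq V0seq. Proof. exact: finmap.fset_uniq. Qed.

Definition touch (v w : word) : Prop := exists x, cell v x /\ cell w x.

Lemma touch_sym v w : touch v w -> touch w v.
Proof. by move=> [x [? ?]]; exists x. Qed.

(** Any other cell that touches the cell of [v] contains one of its vertices, and each vertex lies
    in at most [L] cells. *)
Lemma touch_number : exists T : nat, forall G v, cut G -> v \in G ->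
  (\sum_(w <- G | `[< touch v w >]) 1 <= T)%N.
Proof.
have [L HL] := cell_multiplicity; exists (1 + \sum_(p <- V0seq) L)%N.
move=> G v cG vG; apply: (@leq_trans (\sum_(w <- G) ((w == v) +
    \sum_(p <- V0seq | `[< cell w (word_map F v p) >]) 1))).
  rewrite big_mkcond /= big_seq [leqRHS]big_seq leq_sum // => w wG.
  case: ifPn => // /asboolP[x [[y Ky yx] [z Kz zx]]].
  have [//|wv] := eqVneq w v; rewrite add0n.
  have V0y : V0 y.
    by apply: (cut_overlap_V0 cG vG wG _ Ky Kz); rewrite ?yx // eq_sym.
  rewrite -big_filter sum1_size lt0n size_eq0; apply/negP => /eqP e.
  have : y \in [seq p <- V0seq | `[< cell w (word_map F v p) >]].
    rewrite mem_filter; apply/andP; split; last exact/V0seqP.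
    by apply/asboolP; exists z; rewrite // yx.
  by rewrite e.
rewrite big_split /= leq_add //.
  rewrite (eq_bigr (fun i => if i == v then 1 else 0)%N); last first.
    by move=> i _; case: eqP.
  by rewrite -big_mkcond sum1_count count_uniq_mem ?cut_uniq // leq_b1.
under eq_bigr do rewrite big_mkcond /=.
rewrite exchange_big /=; apply: leq_sum => p _.
by rewrite -big_mkcond HL.
Qed.

(** * Energy forms *)

Definition E0 (u v : M -> R) : R :=
  - \sum_(x <- V0seq) \sum_(y <- V0seq) H x y * u x * v y.

Lemma E0_ext u u' v v' : {in V0, u =1 u'} -> {in V0, v =1 v'} ->
  E0 u v = E0 u' v'.
Proof.
move=> hu hv; congr (- _); apply: eq_big_seq => x /V0seqP Vx.
by apply: eq_big_seq => y /V0seqP Vy; rewrite hu ?hv ?inE.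
Qed.

Lemma fsbig_V0 (T : nmodType) (f : M -> T) :
  \sum_(x \in V0) f x = \sum_(x <- V0seq) f x.
Proof. by rewrite fsbig_finite //; exact: V0_finite. Qed.

Lemma H_sym x y : V0 x -> V0 y -> H x y = H y x.
Proof. by have [+ _ _ _] := H_laplacian; apply. Qed.

Lemma E0C u v : E0 u v = E0 v u.
Proof.
congr (- _); rewrite exchange_big /=; apply: eq_big_seq => x /V0seqP Vx.
apply: eq_big_seq => y /V0seqP Vy; rewrite (H_sym Vx Vy); ring.
Qed.

Lemma E0_linr u v w s : E0 u (fun x => v x + s * w x) = E0 u v + s * E0 u w.
Proof.
rewrite /E0 mulrN -opprD; congr (- _); rewrite mulr_sumr -big_split /=.
apply: eq_bigr => x _; rewrite mulr_sumr -big_split /=; apply: eq_bigr => y _.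
ring.
Qed.

Lemma E0_linl u v w s : E0 (fun x => v x + s * w x) u = E0 v u + s * E0 w u.
Proof. by rewrite E0C E0_linr !(E0C u). Qed.

Lemma E0_ge0 u : 0 <= E0 u u.
Proof.
have [_ /(_ u) h _ _] := H_laplacian; rewrite oppr_ge0.
by move: h; rewrite fsbig_V0; under eq_bigr do rewrite fsbig_V0.
Qed.

Lemma H_row x : V0 x -> \sum_(y <- V0seq) H x y = 0.
Proof.
move=> Vx; have [_ _ /(_ (fun=> 1))[_ h] _] := H_laplacian.
rewrite -[RHS](h _ _ Vx) ?fsbig_V0; last by exists 1.
by apply: eq_bigr => y _; rewrite mulr1.
Qed.

Lemma E0_cst u c v : {in V0, forall x, u x = c} -> E0 v u = 0.
Proof.
move=> uc; rewrite (E0_ext (u' := v) (v' := fun=> c)) // /E0 big_seq big1 ?oppr0 //.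
by move=> x /V0seqP Vx; rewrite -!mulr_suml H_row // !mul0r.
Qed.

(** The rows of [H] sum to 0. In this form the sign condition on off-diagonal entries becomes
    usable: pairs of functions that vary in the same direction have nonnegative energy. *)
Lemma E0_diff u v : E0 u v =
  2^-1 * \sum_(x <- V0seq) \sum_(y <- V0seq) H x y * (u x - u y) * (v x - v y).
Proof.
apply: (@mulfI _ 2) => //; rewrite mulrA divff // mul1r.
rewrite [RHS](_ : _ = \sum_(x <- V0seq) \sum_(y <- V0seq) H x y * u x * v x +
  \sum_(x <- V0seq) \sum_(y <- V0seq) H x y * u y * v y
  - \sum_(x <- V0seq) \sum_(y <- V0seq) H x y * u x * v y
  - \sum_(x <- V0seq) \sum_(y <- V0seq) H x y * u y * v x); last first.
  rewrite -big_split -2!sumrB /=; apply: eq_bigr => x _.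
  rewrite -big_split -2!sumrB /=; apply: eq_bigr => y _; ring.
have z : \sum_(x <- V0seq) \sum_(y <- V0seq) H x y * u x * v x = 0.
  rewrite big_seq big1 // => x /V0seqP Vx.
  by rewrite -2!mulr_suml H_row // !mul0r.
rewrite [X in _ + X - _ - _]exchange_big /= z.
rewrite [X in _ + X - _ - _](_ : _ = 0); last first.
  rewrite -[RHS]z; apply: eq_big_seq => x /V0seqP Vx.
  by apply: eq_big_seq => y /V0seqP Vy; rewrite (H_sym Vy Vx).
rewrite [X in _ - X](_ : _ = - E0 v u).
  by rewrite -/(E0 u v) addr0 add0r opprK [E0 v u]E0C mulr2n mulrDl !mul1r.
rewrite opprK; apply: eq_bigr => x _; apply: eq_bigr => y _; ring.
Qed.

Lemma H_ge0 x y : V0 x -> V0 y -> x != y -> 0 <= H x y.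
Proof. by have [_ _ _] := H_laplacian; apply. Qed.

Lemma E0_CS u v : E0 u v ^+ 2 <= E0 u u * E0 v v.
Proof.
apply: discriminant_le => [|s]; first exact: E0_ge0.
have := E0_ge0 (fun x => u x + s * v x).
by rewrite E0_linl !E0_linr (E0C v u); congr (0 <= _); ring.
Qed.

(* The points [q] that satisfy such a bound relative to a fixed [p] form a class
   whose indicator function is in the kernel of [H], hence constant. *)
Lemma E0_bound : exists2 C : R, 0 < C &
  forall u p q, V0 p -> V0 q -> (u p - u q) ^+ 2 <= C * E0 u u.
Proof.
pose B p q (C : R) := forall u : M -> R, (u p - u q) ^+ 2 <= C * E0 u u.
have mono p q C C' : C <= C' -> B p q C -> B p q C'.
  by move=> CC' h u; rewrite (le_trans (h u)) // ler_wpM2r ?E0_ge0.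
suff Bpq p q : V0 p -> V0 q -> exists C, B p q C.
  have [|[p q] /allpairsP[[p' q'] /= [/V0seqP Vp /V0seqP Vq [-> ->]]]|C C0 HC] :=
    @uniform_constant R _ [seq (p, q) | p <- V0seq, q <- V0seq]
      (fun pq => B pq.1 pq.2).
  - by move=> [p q] /=; exact: mono.
  - exact: Bpq.
  exists C => // u p q Vp Vq; apply: (HC (p, q)).
  by apply/allpairsP; exists (p, q); split=> //; apply/V0seqP.
move=> Vp Vq.
have Bsym x y C : B x y C -> B y x C.
  by move=> h u; rewrite -sqrrN opprB.
have Btrans x y z : (exists C, B x y C) -> (exists C, B y z C) -> exists C, B x z C.
  move=> [C h] [C' h']; exists (2 * (C + C')) => u.
  exact: sqr_dist_triangle (h u) (h' u).
have BH x y : V0 x -> V0 y -> x != y -> H x y != 0 -> exists C, B x y C.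
  move=> Vx Vy xy Hxy; exists (2 / H x y) => u.
  have Hp : 0 < H x y by rewrite lt0r Hxy H_ge0.
  rewrite mulrAC ler_pdivlMr // [leLHS]mulrC E0_diff mulVKf ?pnatr_eq0 //.
  have pos a b : a \in V0seq -> b \in V0seq ->
      0 <= H a b * (u a - u b) * (u a - u b).
    move=> /V0seqP Va /V0seqP Vb; have [->|ab] := eqVneq a b.
      by rewrite subrr mulr0.
    by rewrite -mulrA mulr_ge0 ?H_ge0 // -expr2 sqr_ge0.
  apply: le_trans (ler_sum_seq_mem (x := x) _ _); last exact/V0seqP.
    apply: le_trans (ler_sum_seq_mem (x := y) _ _); last exact/V0seqP.
      by rewrite expr2 mulrA.
    by move=> b bV; apply: pos => //; apply/V0seqP.
  by move=> a aV; rewrite big_seq sumr_ge0 // => b bV; exact: pos.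
pose u x : R := (`[< exists C, B p x C >])%:R.
have [_ _ /(_ u)[+ _] _] := H_laplacian; case.
  move=> x Vx; have [px|px] := pselect (exists C, B p x C).
    rewrite -[RHS](H_row Vx) fsbig_V0; apply: eq_big_seq => y /V0seqP Vy.
    have [->|Hxy] := eqVneq (H x y) 0; first by rewrite mul0r.
    rewrite /u asboolT ?mulr1 //; have [<-//|xy] := eqVneq x y.
    exact: Btrans px (BH x y Vx Vy xy Hxy).
  rewrite fsbig_V0 big_seq big1 // => y /V0seqP Vy.
  have [->|Hxy] := eqVneq (H x y) 0; first by rewrite mul0r.
  rewrite /u asboolF ?mulr0 // => py; apply: px; have [->//|xy] := eqVneq x y.
  apply: Btrans py _; have [C HC] := BH x y Vx Vy xy Hxy.
  by exists C; exact: Bsym.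
move=> c uc; apply/asboolP; have := uc q Vq; rewrite -(uc p Vp) /u.
rewrite (@asboolT (exists C, B p p C)); last first.
  by exists 0 => v; rewrite subrr expr0n mul0r.
by case: asboolP => // _ /eqP; rewrite eq_sym oner_eq0.
Qed.

Lemma E0_osc : exists2 A : R, 0 < A & forall (u : M -> R) (D : R),
  (forall p q, V0 p -> V0 q -> `|u p - u q| <= D) -> E0 u u <= A * D ^+ 2.
Proof.
pose A : R := \sum_(x <- V0seq) \sum_(y <- V0seq) `|H x y|.
exists (2^-1 * A + 1).
  rewrite ltr_wpDl // mulr_ge0 ?invr_ge0 // sumr_ge0 // => x _.
  by rewrite sumr_ge0.
move=> u D h; rewrite (@le_trans _ _ (2^-1 * A * D ^+ 2)) //; last first.
  by rewrite ler_wpM2r ?sqr_ge0 // lerDl.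
rewrite E0_diff -mulrA ler_wpM2l ?invr_ge0 // mulr_suml.
rewrite big_seq [leRHS]big_seq ler_sum // => x /V0seqP Vx.
rewrite mulr_suml big_seq [leRHS]big_seq ler_sum // => y /V0seqP Vy.
rewrite -mulrA -expr2 -[in leLHS]real_normK ?num_real //.
rewrite (@le_trans _ _ (`|H x y| * `|u x - u y| ^+ 2)) //.
  by rewrite ler_wpM2r ?exprn_ge0 ?ler_norm.
by rewrite ler_wpM2l // lerXn2r ?nnegrE ?h // (le_trans _ (h x y Vx Vy)).
Qed.

(** * Energies over cuts *)

Definition E1 (u v : M -> R) : R :=
  \sum_(i < N) (r i)^-1 * E0 (u \o F i) (v \o F i).

(** On [level m] this is the form $\mathcal E_m$ for real functions; general cuts are allowed
    because cells of comparable size have words of varying length. *)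
Definition EG (G : seq word) (u v : M -> R) : R :=
  \sum_(w <- G) (ratio w)^-1 * E0 (u \o word_map F w) (v \o word_map F w).

Lemma EG_nil u v : EG [:: [::]] u v = E0 u v.
Proof. by rewrite /EG big_seq1 ratio_nil invr1 mul1r. Qed.

Lemma EG_node (G : 'I_N -> seq word) u v :
  EG (node G) u v = \sum_(i < N) (r i)^-1 * EG (G i) (u \o F i) (v \o F i).
Proof.
rewrite /EG big_node; apply: eq_bigr => i _; rewrite mulr_sumr.
by apply: eq_bigr => w _; rewrite ratio_cons invfM mulrA.
Qed.

Lemma E1_ge0 u : 0 <= E1 u u.
Proof. by rewrite sumr_ge0 // => i _; rewrite mulr_ge0 ?E0_ge0 // invr_ge0 r_ge0. Qed.

Lemma EG_ge0 G u : 0 <= EG G u u.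
Proof.
rewrite sumr_ge0 // => w _; rewrite mulr_ge0 ?E0_ge0 //.
by rewrite invr_ge0 ratio_ge0.
Qed.

Lemma E0_cell_le i u : E0 (u \o F i) (u \o F i) <= r i * E1 u u.
Proof.
rewrite -ler_pdivrMl ?r_gt0 // /E1 (bigD1 i) //= lerDl sumr_ge0 // => j _.
by rewrite mulr_ge0 ?E0_ge0 // invr_ge0 r_ge0.
Qed.

Lemma cell1_closed i : closed (F i @` K).
Proof. exact: (@cell_closed [:: i]). Qed.

(* Distinct cells only meet at images of points of [V0], so the union of the cells
   whose vertices are comparable with a given one is clopen in [K]. *)
Lemma E1_bound : exists2 C : R, 0 < C & forall u i j p q, V0 p -> V0 q ->
  (u (F i p) - u (F j q)) ^+ 2 <= C * E1 u u.
Proof.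
have [C0 C0p HC0] := E0_bound.
pose B x y (C : R) := forall u : M -> R, (u x - u y) ^+ 2 <= C * E1 u u.
have mono x y C C' : C <= C' -> B x y C -> B x y C'.
  by move=> CC' h u; rewrite (le_trans (h u)) // ler_wpM2r ?E1_ge0.
have Btrans x y z : (exists C, B x y C) -> (exists C, B y z C) -> exists C, B x z C.
  move=> [C h] [C' h']; exists (2 * (C + C')) => u.
  exact: sqr_dist_triangle (h u) (h' u).
have Bcell i p q : V0 p -> V0 q -> exists C, B (F i p) (F i q) C.
  move=> Vp Vq; exists (C0 * r i) => u; rewrite (le_trans (HC0 (u \o F i) p q Vp Vq)) //.
  by rewrite -mulrA ler_wpM2l ?(ltW C0p) // E0_cell_le.
suff Bij i j p q : V0 p -> V0 q -> exists C, B (F i p) (F j q) C.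
  have [||C Cp HC] := @uniform_constant R _
     [seq (ij, pq) | ij <- [seq (i, j) | i <- enum 'I_N, j <- enum 'I_N],
                     pq <- [seq (p, q) | p <- V0seq, q <- V0seq]]
      (fun t => B (F t.1.1 t.2.1) (F t.1.2 t.2.2)).
  - by move=> t; exact: mono.
  - move=> _ /allpairsP[[ij _] /= [_ /allpairsP[[p q] /= [/V0seqP Vp /V0seqP Vq ->]] ->]].
    exact: Bij.
  exists C => // u i j p q Vp Vq; apply: (HC ((i, j), (p, q))).
  apply/allpairsP; exists ((i, j), (p, q)); split=> //=.
    by apply/allpairsP; exists (i, j); rewrite !mem_enum.
  by apply/allpairsP; exists (p, q); split=> //=; exact/V0seqP.
move=> Vp Vq.
pose I := [set k | exists C, B (F i p) (F k p) C].
have Istep k l y z : I k -> K y -> K z -> F k y = F l z -> I l.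
  move=> Ik Ky Kz kl; have [<-//|nkl] := eqVneq k l.
  have V0y : V0 y := overlap_V0 nkl Ky Kz kl.
  have V0z : V0 z by apply: (overlap_V0 _ Kz Ky (esym kl)); rewrite eq_sym.
  apply: (Btrans _ _ _ Ik); apply: (Btrans _ _ _ (Bcell k p y Vp V0y)).
  by rewrite kl; exact: Bcell.
have clos (J : set 'I_N) : closed (\bigcup_(k in J) (F k @` K)).
  apply: closed_bigcup => [|k _]; first exact: finite_finset.
  exact: cell1_closed.
have IK : K `&` \bigcup_(k in I) (F k @` K) = K.
  apply: K_connected.
  - exists (F i p); split; first exact/F_K/V0_K.
    exists i; last by exists p => //; exact: V0_K.
    by exists 0 => u; rewrite subrr expr0n mul0r.
  - exists (~` \bigcup_(k in ~` I) (F k @` K)); first exact/closed_openC/clos.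
    apply/seteqP; split=> x [Kx].
      move=> [k Ik [y Ky ykx]]; split=> // -[l nIl [z Kz zlx]].
      by apply: nIl; apply: (Istep k l y z) => //; rewrite ykx zlx.
    move=> nx; split=> //; move: (Kx); have [_ _ {1}->] := K_self_similar.
    move=> [k _ yk]; exists k => //; apply/not_notP => nIk.
    by apply: nx; exists k.
  - by exists (\bigcup_(k in I) (F k @` K)).
have : K (F j p) by exact/F_K/V0_K.
rewrite -IK => -[_ [k Ik [y Ky ykj]]].
have Ij : I j by apply: (Istep k j y p) => //; exact: V0_K.
exact: Btrans Ij (Bcell j p q Vp Vq).
Qed.

Local Notation Re := (@complex.Re R).
Local Notation Im := (@complex.Im R).

Lemma EG_linr G u v w s :
  EG G u (fun x => v x + s * w x) = EG G u v + s * EG G u w.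
Proof.
rewrite /EG mulr_sumr -big_split /=; apply: eq_bigr => t _.
by rewrite -[_ \o word_map F t in X in E0 _ X]/(fun x => _ + _ * _) E0_linr; ring.
Qed.

Lemma EGC G u v : EG G u v = EG G v u.
Proof. by apply: eq_bigr => w _; rewrite E0C. Qed.

Lemma EG_quad G v w s :
  EG G (fun x => v x + s * w x) (fun x => v x + s * w x) =
  EG G v v + 2 * s * EG G v w + s ^+ 2 * EG G w w.
Proof.
by rewrite EG_linr (EGC G _ v) (EGC G _ w) !EG_linr (EGC G w v); ring.
Qed.

Lemma EG_oppr G u v : EG G u (fun x => - v x) = - EG G u v.
Proof.
rewrite /EG -sumrN; apply: eq_bigr => w _; rewrite -mulrN; congr (_ * _).
rewrite /E0 opprK -sumrN; apply: eq_bigr => x _; rewrite -sumrN.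
by apply: eq_bigr => y _ /=; rewrite mulrN opprK.
Qed.

Lemma EG_level1 u v : EG (level 1) u v = E1 u v.
Proof. by rewrite EG_node; apply: eq_bigr => i _; rewrite EG_nil. Qed.

(** The form is bilinear, so complex functions reduce to their real and imaginary parts, and all
    estimates are made for real functions. *)
Lemma level_formE m f g : level_form F V0 H r m f g =
  ((EG (level m) (Re \o f) (Re \o g) - EG (level m) (Im \o f) (Im \o g)) +i*
   (EG (level m) (Re \o f) (Im \o g) + EG (level m) (Im \o f) (Re \o g)))%C.
Proof.
have ReS (T : Type) (s : seq T) (P : T -> R[i]) :
    \sum_(x <- s) P x = ((\sum_(x <- s) Re (P x)) +i* (\sum_(x <- s) Im (P x)))%C.
  elim: s => [|x s IH]; first by rewrite !big_nil.
  by rewrite !big_cons IH; case: (P x).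
elim: m f g => [|m IH] f g.
  rewrite /= !EG_nil /E0 fsbig_V0 ReS.
  apply/eqP; rewrite eq_complex /= -!opprD; apply/andP; split; apply/eqP; congr (- _).
    rewrite -sumrB; apply: eq_bigr => x _.
    rewrite fsbig_V0 ReS /= -sumrB; apply: eq_bigr => y _.
    by case: (f x) => a b; case: (g y) => c d /=; ring.
  rewrite -big_split; apply: eq_bigr => x _.
  rewrite fsbig_V0 ReS /= -big_split; apply: eq_bigr => y _.
  by case: (f x) => a b; case: (g y) => c d /=; ring.
rewrite [LHS]/= ReS; apply/eqP; rewrite eq_complex /=.
rewrite !EG_node -sumrB -big_split; apply/andP; split; apply/eqP;
  apply: eq_bigr => i _; rewrite IH /= !mul0r ?subr0 ?addr0.
  by rewrite mulrBr.
by rewrite mulrDr.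
Qed.

Lemma level_energyE m f : level_energy F V0 H r m f =
  EG (level m) (Re \o f) (Re \o f) + EG (level m) (Im \o f) (Im \o f).
Proof.
rewrite /level_energy level_formE /=; congr (_ + _).
  congr EG; apply/funext => x /=; by case: (f x).
rewrite -EG_oppr; congr EG; apply/funext => x /=; case: (f x) => a b //=.
by rewrite opprK.
Qed.

Lemma level_energy_real m (u : M -> R) :
  level_energy F V0 H r m (fun x => (u x)%:C%C) = EG (level m) u u.
Proof.
rewrite level_energyE (_ : Re \o _ = u) // (_ : Im \o _ = fun=> 0) //.
rewrite [X in _ + X]big1 ?addr0 // => w _.
by rewrite (@E0_cst _ 0) ?mulr0.
Qed.

Lemma E0_le_E1 u : E0 u u <= E1 u u.
Proof.
have [_ /(_ (fun x => (u x)%:C%C))[_ /(_ (fun x => (u x)%:C%C))]] := Hr_regular.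
by rewrite !level_energy_real EG_nil EG_level1; apply.
Qed.

(** The minimiser may be complex; dropping its imaginary part does not increase the energy, and
    [E0_le_E1] excludes a decrease. *)
Lemma harmonic_step u : exists v, {in V0, v =1 u} /\ E1 v v = E0 u u.
Proof.
have [_ /(_ (fun x => (u x)%:C%C))[[g gu e] _]] := Hr_regular.
have vu : {in V0, Re \o g =1 u} by move=> x Vx /=; rewrite gu.
exists (Re \o g); split=> //; apply/eqP; rewrite eq_le; apply/andP; split.
  move: e; rewrite level_energy_real EG_nil level_energyE !EG_level1 => <-.
  by rewrite lerDl E1_ge0.
by rewrite -(E0_ext vu vu) E0_le_E1.
Qed.

(* [h] is a null vector of the nonnegative form [E1 - E0]. *)
Lemma E1_orth h g : E1 h h = E0 h h -> E1 h g = E0 h g.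
Proof.
move=> e; apply/eqP; rewrite -subr_eq0; apply/eqP.
suff : 2 * (E1 h g - E0 h g) = 0.
  by move/eqP; rewrite mulf_eq0 pnatr_eq0 /= => /eqP.
apply: (@quadratic_ge0_linear _ _ (E1 g g - E0 g g)) => s.
have := E0_le_E1 (fun x => h x + s * g x).
rewrite -!EG_nil -!EG_level1 !EG_quad EG_level1 e !EG_nil -subr_ge0.
by congr (0 <= _); ring.
Qed.

(** Harmonicity as minimality: on every cell the values at the vertices of the subcells minimise the
    energy for the given vertex values. [real_harmonic_function] and [harmonic_function_harm] relate
    it to the weak Laplacian. *)
Definition harm (h : M -> R) : Prop := forall w,
  E1 (h \o word_map F w) (h \o word_map F w) =
  E0 (h \o word_map F w) (h \o word_map F w).

Lemma harm_F h i : harm h -> harm (h \o F i).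
Proof. by move=> hh w; exact: (hh (i :: w)). Qed.

Lemma harm_word h w : harm h -> harm (h \o word_map F w).
Proof.
by elim: w h => [|i w IH] h hh; [exact: hh|exact: (IH _ (harm_F i hh))].
Qed.

(** Subdividing a cell replaces [E0] by [E1], and [E1_orth] makes them agree against any [g],
    harmonic or not. *)
Lemma EG_harm G h g : cut G -> harm h -> EG G h g = E0 h g.
Proof.
move=> cG; elim: cG h g => [|{}G _ IH] h g hh; first exact: EG_nil.
rewrite EG_node -(E1_orth g (hh [::])); apply: eq_bigr => i _.
by rewrite IH //; exact: harm_F.
Qed.

Lemma E0_le_EG G u : cut G -> E0 u u <= EG G u u.
Proof.
move=> cG; elim: cG u => [|{}G _ IH] u; first by rewrite EG_nil.
rewrite EG_node (le_trans (E0_le_E1 u)) // ler_sum // => i _.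
by rewrite ler_wpM2l ?IH // invr_ge0 r_ge0.
Qed.

Lemma level_mono m u : EG (level m) u u <= EG (level m.+1) u u.
Proof.
elim: m u => [|m IH] u; first by rewrite [leLHS]EG_nil E0_le_EG //; exact: (cut_level 1).
rewrite EG_node [leRHS]EG_node ler_sum // => i _.
by rewrite ler_wpM2l ?IH // invr_ge0 r_ge0.
Qed.

Lemma level_cell_le m w u :
  EG (level m) (u \o word_map F w) (u \o word_map F w) <=
  ratio w * EG (level (size w + m)) u u.
Proof.
elim: w u => [|i w IH] u; first by rewrite ratio_nil mul1r.
rewrite ratio_cons (le_trans (IH (u \o F i))) // [r i * _]mulrC -mulrA.
rewrite ler_wpM2l ?ratio_ge0 // [EG (level (size (i :: w) + m)) u u]EG_node.
rewrite -ler_pdivrMl ?r_gt0 // (bigD1 i) //= lerDl sumr_ge0 // => j _.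
by rewrite mulr_ge0 ?EG_ge0 // invr_ge0 r_ge0.
Qed.

Lemma cut_cover G x : cut G -> K x -> exists2 w, w \in G & cell w x.
Proof.
move=> cG Kx; have [om <-] := coded Kx.
by have [m mG _] := cut_prefix cG om; exists (mkseq om m) => //; exact: pi_cell.
Qed.

(** Continuity is tested on the cells of a cut, so that functions on the [N] first-level cells are
    glued by grafting their cuts. *)
Definition cell_continuous (f : M -> R) : Prop := forall e, 0 < e ->
  exists2 G, cut G & forall w x y, w \in G -> K x -> K y ->
    `|f (word_map F w x) - f (word_map F w y)| <= e.

(** The cells of the cut that miss [x] have a closed union, so points of [K] near [x] share a cell
    with [x]. *)
Lemma cell_continuous_within f : cell_continuous f ->
  {within K, continuous (f : M -> R^o)}.
Proof.
move=> cf; apply/within_continuousP => x e Kx e0.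
have [G cG HG] := cf (e / 2) (divr_gt0 e0 (ltr0Sn _ 1)).
pose C := \big[setU/set0]_(w <- [seq w <- G | ~~ `[< cell w x >]]) cell w.
have closedC : closed C by apply: closed_bigsetU => w _; exact: cell_closed.
have nCx : ~ C x.
  rewrite /C -bigcup_seq => -[w /=]; rewrite mem_filter => /andP[/asboolP nw _].
  exact: nw.
have : nbhs x (~` C) by apply: open_nbhs_nbhs; split=> //; exact: closed_openC.
move=> /metricType_numDomainType.nbhs_mdistP[d /= d0 hd]; exists d => // y Ky xy.
have [w wG cwy] := cut_cover cG Ky.
have cwx : cell w x.
  apply/asboolP/negPn/negP => nw; apply: (hd y xy); rewrite /C -bigcup_seq.
  by exists w => //=; rewrite mem_filter nw.
case: cwx cwy => [x' Kx' <-] [y' Ky' <-].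
by rewrite (le_lt_trans (HG _ _ _ wG Kx' Ky')) // ltr_pdivrMr // ltr_pMr // ltr1n.
Qed.

Lemma F_within_continuous i (f : M -> R) : {within K, continuous (f : M -> R^o)} ->
  {within K, continuous (f \o F i : M -> R^o)}.
Proof.
move=> /within_continuousP cf; apply/within_continuousP => x e Kx e0.
have [d d0 hd] := cf (F i x) e (F_K i Kx) e0.
have [q [/andP[q0 q1] Hq]] := F_lipschitz; exists d => // y Ky xy.
apply: hd; first exact: F_K.
by rewrite (le_lt_trans (Hq i x y)) // (le_lt_trans _ xy) // ler_piMl ?mdist_ge0 // ltW.
Qed.

Lemma word_within_continuous w (f : M -> R) :
  {within K, continuous (f : M -> R^o)} ->
  {within K, continuous (f \o word_map F w : M -> R^o)}.
Proof.
elim: w f => [|i w IH] f cf; first exact: cf.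
rewrite [_ \o _](_ : _ = (f \o F i) \o word_map F w) //.
by apply: IH; exact: F_within_continuous.
Qed.

(** * Harmonic extension *)

(** With at most one letter all codes coincide, so [K] is a point and its diameter would be 0
    instead of 1. *)
Lemma two_letters : exists i j : 'I_N, i != j.
Proof.
apply: contrapT => /forallNP h.
have eqI (i j : 'I_N) : i = j.
  by apply/eqP/negPn/negP => ij; apply: (h i); exists j.
have eqK x y : K x -> K y -> x = y.
  move=> /coded[om <-] /coded[om' <-]; congr pi.
  by apply/funext => n; exact: eqI.
have := diam1; rewrite /resistance_diam (_ : [set _ | _ in _] = [set 0]).
  by rewrite sup1 => /esym/eqP; rewrite oner_eq0.
apply/seteqP; split=> [_ [[x y] [/= Kx Ky] <-]|_ ->].
  by rewrite (eqK x y) // /resistance eqxx.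
have [[x Kx] _ _] := K_self_similar; exists (x, x) => //.
by rewrite /resistance eqxx.
Qed.

(** For a nonpositive exponent every term of [dH_eq] is at least 1, and there are at least two
    terms. *)
Lemma dH_gt0 : 0 < dH.
Proof.
have [i [j ij]] := two_letters; rewrite ltNge; apply/negP => dH0.
have ge1 k : 1 <= r k `^ dH.
  rewrite -(powRr0 (r k)); apply: ger_powR => //.
  by rewrite r_gt0 ltW ?r_lt1.
have := dH_eq; rewrite (bigD1 i) //= (bigD1 j) 1?eq_sym //= addrA => e.
have : 0 <= \sum_(k < N | (k != i) && (k != j)) r k `^ dH.
  by rewrite sumr_ge0 // => k _; rewrite powR_ge0.
by have := ge1 i; have := ge1 j; lra.
Qed.

(** Without vertices the first-level cells would be disjoint closed sets, against connectedness. *)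
Lemma V0_nonempty : exists p, V0 p.
Proof.
apply: contrapT => /forallNP nV0; have [i [j ij]] := two_letters.
have [[x Kx] _ eK] := K_self_similar.
have disj k l y z : k != l -> K y -> K z -> F k y <> F l z.
  by move=> kl Ky Kz /(overlap_V0 kl Ky Kz)/nV0.
have : K `&` (F i @` K) = K.
  apply: K_connected.
  - by exists (F i x); split; [exact: F_K|exists x].
  - exists (~` \bigcup_(k in [set k | k != i]) (F k @` K)).
      apply/closed_openC/closed_bigcup => [|k _]; first exact: finite_finset.
      exact: cell1_closed.
    apply/seteqP; split=> y [Ky].
      move=> [z Kz <-]; split; first exact: F_K.
      by move=> [k ki [t Kt]]; exact: disj.
    move=> ny; split=> //; move: (Ky); rewrite {1}eK => -[k _ yk].
    have [<-//|ki] := eqVneq k i.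
    by case: ny; exists k.
  - by exists (F i @` K) => //; exact: cell1_closed.
move=> eKi; have : K (F j x) by exact: F_K.
by rewrite -eKi => -[_ [y Ky]]; exact: disj.
Qed.

Definition p0 : M := sval (cid V0_nonempty).

Lemma V0_p0 : V0 p0. Proof. exact: svalP (cid V0_nonempty). Qed.

(** Oscillation is controlled by the square root of the energy, and the energy of a cell loses a
    factor of at most [rmax] per letter. *)
Definition rho : R := Num.sqrt rmax.

Lemma rho_bounds : 0 <= rho < 1.
Proof.
by rewrite sqrtr_ge0 /= -sqrtr1 ltr_sqrt ?ltr01 ?rmax_lt1.
Qed.

Lemma sqrt_rmaxX n : Num.sqrt (rmax ^+ n) = rho ^+ n.
Proof.
elim: n => [|n IH]; first by rewrite !expr0 sqrtr1.
by rewrite !exprS sqrtrM ?IH // ltW ?rmax_gt0.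
Qed.

Lemma norm_le_sqrt (a b : R) : a ^+ 2 <= b -> `|a| <= Num.sqrt b.
Proof.
by move=> h; rewrite -sqrtr_sqr ler_sqrt // (le_trans _ h) ?sqr_ge0.
Qed.

(** By [V0_succ] the point [p0] is itself a vertex of level 1, so [E1_bound] compares it with
    [F i p0]. *)
Lemma p0_step_bound : exists2 c : R, 0 < c & forall u i,
  `|u p0 - u (F i p0)| <= c * Num.sqrt (E1 u u).
Proof.
have [C C0 HC] := E1_bound; exists (Num.sqrt C); first by rewrite sqrtr_gt0.
move=> u i; rewrite -sqrtrM ?(ltW C0) //; apply: norm_le_sqrt.
have [j [q [Vq e]]] := V0_succ V0_p0; rewrite {1}e.
by apply: HC => //; exact: V0_p0.
Qed.

Lemma ratio_mkseq om m : ratio (mkseq om m) <= rmax ^+ m.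
Proof. by have := ratio_le (mkseq om m); rewrite size_mkseq. Qed.

Lemma level_cell_E1 u w B : (forall m, EG (level m) u u <= B) ->
  E1 (u \o word_map F w) (u \o word_map F w) <= ratio w * B.
Proof.
move=> hB; rewrite -EG_level1 (le_trans (level_cell_le _ _ _)) //.
by rewrite ler_wpM2l ?ratio_ge0.
Qed.

(* Telescoping along the vertices [word_map F (mkseq om m) p0], which converge
   to [pi om] and whose consecutive differences are [O(rho ^+ m)]. *)
Lemma energy_osc : exists2 A : R, 0 < A & forall u B,
  {within K, continuous (u : M -> R^o)} -> (forall m, EG (level m) u u <= B) ->
  forall x y, K x -> K y -> `|u x - u y| <= A * Num.sqrt B.
Proof.
have [c c0 Hc] := p0_step_bound; have [q0 q1] := andP rho_bounds.
have q1' : 0 < 1 - rho by rewrite subr_gt0.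
pose A := c / (1 - rho); have A0 : 0 < A by rewrite divr_gt0.
exists (2 * A); first by rewrite mulr_gt0.
move=> u B cu hB.
suff toP x : K x -> `|u p0 - u x| <= A * Num.sqrt B.
  move=> x y Kx Ky; rewrite -mulrA (_ : u x - u y = (u p0 - u y) - (u p0 - u x)); last by ring.
  by rewrite mulr_natl mulr2n (le_trans (ler_normB _ _)) // lerD ?toP.
move=> /coded[om <-]; pose a m := u (word_map F (mkseq om m) p0).
have step m : `|a m - a m.+1| <= c * Num.sqrt B * rho ^+ m.
  rewrite /a mkseqS -cats1 word_map_cat.
  rewrite (le_trans (Hc (u \o word_map F (mkseq om m)) (om m))) //.
  rewrite -mulrA ler_wpM2l ?(ltW c0) // -sqrt_rmaxX -sqrtrM; last first.
    by rewrite (le_trans (EG_ge0 _ _) (hB 0%N)).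
  rewrite ler_wsqrtr // (le_trans (level_cell_E1 _ hB)) // mulrC.
  by rewrite ler_wpM2l ?(le_trans (EG_ge0 _ _) (hB 0%N)) // ratio_mkseq.
apply/ler_addgt0Pr => e e0.
have [d d0 hd] := (within_continuousP K u).1 cu _ e (pi_K om) e0.
have [m Hm] := cell_diam_small d0.
have [z Kz piz] := pi_cell om m.
have : `|u (pi om) - a m| < e.
  apply: hd; first exact/word_K/V0_K/V0_p0.
  by rewrite -piz Hm ?size_mkseq //; exact/V0_K/V0_p0.
move=> h1; rewrite (_ : u p0 - u (pi om) = (a 0%N - a m) - (u (pi om) - a m)); last first.
  by rewrite /a /=; ring.
rewrite (le_trans (ler_normB _ _)) // lerD ?(ltW h1) //.
have := geometric_steps rho_bounds _ step 0%N m; rewrite expr0 mulr1 add0n.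
rewrite /A mulrAC; apply.
by rewrite mulr_ge0 ?sqrtr_ge0 ?ltW.
Qed.

Definition hstep (u : M -> R) : M -> R := sval (cid (harmonic_step u)).

Lemma hstep_V0 u : {in V0, hstep u =1 u}.
Proof. by have [] := svalP (cid (harmonic_step u)). Qed.

Lemma E1_hstep u : E1 (hstep u) (hstep u) = E0 u u.
Proof. by have [] := svalP (cid (harmonic_step u)). Qed.

(* Boundary values on the cell [i] of the harmonic extension of [u]; iterated
   along a code, they converge to the value of that extension. *)
Definition descend (u : M -> R) (i : 'I_N) : M -> R := hstep u \o F i.

Lemma E0_descend u w :
  E0 (foldl descend u w) (foldl descend u w) <= ratio w * E0 u u.
Proof.
elim: w u => [|i w IH] u; first by rewrite ratio_nil mul1r.
rewrite /= (le_trans (IH _)) // ratio_cons [r i * _]mulrC -mulrA.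
by rewrite ler_wpM2l ?ratio_ge0 // -(E1_hstep u) E0_cell_le.
Qed.

Definition hvalue (u : M -> R) (om : nat -> 'I_N) : R :=
  limn (fun m => foldl descend u (mkseq om m) p0 : R^o).

Lemma hvalue_props : exists2 A : R, 0 < A &
  (forall u om p, V0 p -> `|hvalue u om - u p| <= A * Num.sqrt (E0 u u)) /\
  (forall u om, hvalue u om = hvalue (descend u (om 0%N)) (word_shift om)).
Proof.
have [c c0 Hc] := p0_step_bound; have [q0 q1] := andP rho_bounds.
have [C C0 HC] := E0_bound.
have q1' : 0 < 1 - rho by rewrite subr_gt0.
pose a u om m := foldl descend u (mkseq om m) p0.
have step u om m : `|a u om m - a u om m.+1| <= c * Num.sqrt (E0 u u) * rho ^+ m.
  rewrite /a mkseqS -cats1 foldl_cat /= /descend /=.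
  set g := foldl _ _ _; rewrite -[in X in X - _](hstep_V0 g) ?inE; last exact: V0_p0.
  rewrite (le_trans (Hc (hstep g) (om m))) // -mulrA ler_wpM2l ?(ltW c0) //.
  rewrite E1_hstep -sqrt_rmaxX -sqrtrM ?E0_ge0 // ler_wsqrtr //.
  rewrite (le_trans (E0_descend _ _)) // mulrC.
  by rewrite ler_wpM2l ?E0_ge0 // ratio_mkseq.
have cs u om := geometric_cvg rho_bounds
  (mulr_ge0 (ltW c0) (sqrtr_ge0 (E0 u u))) (step u om).
exists (c / (1 - rho) + Num.sqrt C).
  by rewrite addr_gt0 ?divr_gt0 // sqrtr_gt0.
split=> [u om p Vp|u om].
  rewrite (_ : hvalue u om - u p = (hvalue u om - u p0) + (u p0 - u p)); last by ring.
  rewrite (le_trans (ler_normD _ _)) // mulrDl lerD //.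
    by have [_ h] := cs u om; rewrite mulrAC; exact: h.
  by rewrite -sqrtrM ?(ltW C0) // norm_le_sqrt // HC //; exact: V0_p0.
apply/cvg_lim => //; have [+ _] := cs (descend u (om 0%N)) (word_shift om).
move=> /cvg_ex[l hl]; rewrite /hvalue (cvg_lim _ hl) //.
have e : (fun m => a u om m.+1) = a (descend u (om 0%N)) (word_shift om).
  by apply/funext => m; rewrite /a -{1}(scons_shift om) mkseq_scons.
by move: hl; rewrite -e => hl'; rewrite -cvg_shiftS.
Qed.

Lemma V0_code p : V0 p -> exists2 om, post_critical_set F K pi om & pi om = p.
Proof. by rewrite V0_def => -[om Com <-]; exists om. Qed.

(** Moving the first letter into the boundary data changes neither side, since the shifted code is
    again critical. The difference is bounded by the root of the energy of the data, which decays
    geometrically under this move. *)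
Lemma hvalue_critical u om : post_critical_set F K pi om ->
  hvalue u om = u (pi om).
Proof.
have [A A0 [HA Hshift]] := hvalue_props; move=> Com.
apply/eqP; rewrite -subr_eq0 -normr_le0.
apply: (@le0_geometric _ _ (A * Num.sqrt (E0 u u)) rho rho_bounds).
  by rewrite mulr_ge0 ?sqrtr_ge0 ?(ltW A0).
move=> n; rewrite -mulrA -sqrt_rmaxX -sqrtrM ?E0_ge0 //.
elim: n u om Com => [|n IH] u om Com.
  by rewrite expr0 mulr1 HA //; exact: V0_pi.
rewrite (Hshift u om) -(hstep_V0 u) ?inE; last exact: V0_pi.
rewrite [in X in _ - X]pi_shift.
have := IH (descend u (om 0%N)) _ (critical_shift Com); rewrite {2}/descend /=.
move=> /le_trans; apply; rewrite ler_wpM2l ?(ltW A0) // ler_wsqrtr //.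
rewrite exprSr mulrA mulrAC ler_wpM2r ?exprn_ge0 ?(ltW rmax_gt0) //.
rewrite (le_trans (E0_descend u [:: om 0%N])) // mulrC ler_wpM2l ?E0_ge0 //.
by rewrite ratio_cons ratio_nil mulr1 r_le_rmax.
Qed.

(** Common first letters are stripped by injectivity. At the first disagreement both tails are
    critical, and [hvalue_critical] reads both values off the boundary data at the same point. *)
Lemma hvalue_pi u om om' : pi om = pi om' -> hvalue u om = hvalue u om'.
Proof.
have [A A0 [_ Hshift]] := hvalue_props.
have [->//|/eqP ne] := pselect (om = om'); move=> epi.
have [n] : exists n, om n != om' n.
  apply: contrapT => /forallNP h; case/eqP: ne; apply/funext => n.
  by apply/eqP/negPn/negP; exact: h.
elim: n u om om' epi {ne} => [|n IH] u om om' epi nn;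
  have [e0|e0] := eqVneq (om 0%N) (om' 0%N).
- by rewrite e0 eqxx in nn.
- rewrite (Hshift u om) (Hshift u om') !hvalue_critical /descend /=; last 2 first.
  + by apply: critical_branch (esym epi) _; rewrite eq_sym.
  + exact: critical_branch epi e0.
  by rewrite -!pi_shift epi.
- rewrite (Hshift u om) (Hshift u om') -e0; apply: IH => //; apply: (F_inj (i := om 0%N)).
  by rewrite -pi_shift e0 -pi_shift.
- rewrite (Hshift u om) (Hshift u om') !hvalue_critical /descend /=; last 2 first.
  + by apply: critical_branch (esym epi) _; rewrite eq_sym.
  + exact: critical_branch epi e0.
  by rewrite -!pi_shift epi.
Qed.

Lemma E1_ext u u' : (forall i p, V0 p -> u (F i p) = u' (F i p)) ->
  E1 u u = E1 u' u'.
Proof.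
move=> h; apply: eq_bigr => i _; congr (_ * _).
by apply: E0_ext => p; rewrite inE => Vp; exact: h.
Qed.

Lemma harm_ext h h' : (forall x, K x -> h x = h' x) -> harm h -> harm h'.
Proof.
move=> e hh w; rewrite -(E0_ext (u := h \o word_map F w) (v := h \o word_map F w)).
- rewrite -hh; apply: E1_ext => i p Vp /=; rewrite e //.
  exact/word_K/F_K/V0_K.
- by move=> p; rewrite inE => Vp /=; rewrite e //; exact/word_K/V0_K.
- by move=> p; rewrite inE => Vp /=; rewrite e //; exact/word_K/V0_K.
Qed.

(** The value at a point is [hvalue] along a chosen code. As the choice is immaterial, restriction
    to a cell is descent of the boundary data, which gives minimality and small oscillation on
    cells. *)
Lemma harmonic_extension u : exists h,
  [/\ {in V0, h =1 u}, harm h & cell_continuous h].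
Proof.
have [A A0 [HA Hshift]] := hvalue_props; have [i0 _] := two_letters.
have codeP x : exists om, K x -> pi om = x.
  have [Kx|nK] := pselect (K x); last by exists (fun=> i0).
  by have [om <-] := coded Kx; exists om.
have [code Hcode] := choice codeP.
pose h u x := hvalue u (code x).
have hpi v om : h v (pi om) = hvalue v om.
  by apply: hvalue_pi; rewrite Hcode //; exact: pi_K.
have hw v w x : K x -> h v (word_map F w x) = h (foldl descend v w) x.
  move=> /coded[om <-]; rewrite -pi_wcat !hpi.
  by elim: w v => //= i w IH v; rewrite (Hshift v (scons i _)) /= -IH.
have hV v p : V0 p -> h v p = v p.
  by move=> /V0_code[om Com <-]; rewrite hpi hvalue_critical.
exists (h u); split.
- by move=> p; rewrite inE; exact: hV.
- move=> w; set g := foldl descend u w.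
  have -> : E1 (h u \o word_map F w) (h u \o word_map F w) = E1 (hstep g) (hstep g).
    apply: E1_ext => i p Vp /=; rewrite hw; last exact/F_K/V0_K.
    by rewrite -/g (hw g [:: i]) ?hV //; exact: V0_K.
  rewrite E1_hstep; apply: E0_ext => p; rewrite inE => Vp /=;
    by rewrite hw ?hV //; exact: V0_K.
- move=> e e0; have [n hn] : exists n, 2 * A * Num.sqrt (E0 u u) * rho ^+ n < e.
    apply/not_existsP => hn; suff : e <= 0 by rewrite leNgt e0.
    apply: (@le0_geometric _ _ (2 * A * Num.sqrt (E0 u u)) rho rho_bounds) => [|n].
      by rewrite !mulr_ge0 ?sqrtr_ge0 ?(ltW A0).
    by have /negP := hn n; rewrite -leNgt.
  exists (level n); first exact: cut_level.
  move=> w x y; rewrite mem_level => /eqP sw Kx Ky; rewrite !hw //.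
  set g := foldl _ _ _; apply: le_trans (ltW hn).
  rewrite (_ : _ - _ = (h g x - g p0) - (h g y - g p0)); last by ring.
  have Eg : Num.sqrt (E0 g g) <= Num.sqrt (E0 u u) * rho ^+ n.
    rewrite -sqrt_rmaxX -sqrtrM ?E0_ge0 // ler_wsqrtr //.
    rewrite (le_trans (E0_descend _ _)) // mulrC ler_wpM2l ?E0_ge0 //.
    by rewrite -sw ratio_le.
  rewrite (le_trans (ler_normB _ _)) // -!mulrA mulr_natl mulr2n.
  by rewrite lerD // (le_trans (HA _ _ _ V0_p0)) // ler_wpM2l ?(ltW A0).
Qed.

Lemma V0_cut G p : cut G -> V0 p ->
  exists w q, [/\ w \in G, V0 q & p = word_map F w q].
Proof.
move=> cG; elim: cG p => [|{}G _ IH] p Vp; first by exists [::], p.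
have [i [q [Vq ->]]] := V0_succ Vp; have [w [t [wG Vt ->]]] := IH i q Vq.
by exists (i :: w), t; rewrite mem_node.
Qed.

(** Induction on the cut, gluing the pieces of the [N] subtrees. Where two first-level cells meet,
    the point is an image of points of [V0], which are vertices of the subcuts by [V0_cut]; both
    pieces therefore take the value of [f] there. *)
Lemma piecewise_harmonic G f : cut G -> exists phi,
  [/\ cell_continuous phi,
      forall w, w \in G -> {in V0, phi \o word_map F w =1 f \o word_map F w} &
      forall w, w \in G -> harm (phi \o word_map F w)].
Proof.
move=> cG; elim: cG f => [|{}G cG IH] f.
  have [h [hV hh hc]] := harmonic_extension f; exists h.
  by split=> // w; rewrite inE => /eqP->.
have [psi Hpsi] := choice (fun i => IH i (f \o F i)).
have psiV i p : V0 p -> psi i p = f (F i p).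
  move=> Vp; have [w [q [wG Vq ->]]] := V0_cut (cG i) Vp.
  by have [_ h _] := Hpsi i; apply: (h w wG q); rewrite inE.
have glue x : exists t : R, forall i y, K y -> F i y = x -> t = psi i y.
  have [[i [y [Ky yx]]]|/forallNP ne] := pselect (exists i y, K y /\ F i y = x).
    exists (psi i y) => j z Kz zx; have e : F i y = F j z by rewrite yx zx.
    have [ij|ij] := eqVneq i j; first by subst j; rewrite (F_inj e).
    rewrite !psiV ?e //; first by apply: overlap_V0 Kz Ky (esym e); rewrite eq_sym.
    exact: overlap_V0 ij Ky Kz e.
  by exists 0 => i y Ky yx; case: (ne i); exists y.
have [phi Hphi] := choice glue.
have phiF i y : K y -> phi (F i y) = psi i y by move=> Ky; exact: Hphi.
exists phi; split=> [e e0|w|w].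
- have gG i : exists G', cut G' /\ (forall w x y, w \in G' -> K x -> K y ->
      `|psi i (word_map F w x) - psi i (word_map F w y)| <= e).
    by have [/(_ e e0)[G' cG' h] _ _] := Hpsi i; exists G'.
  have [G' HG'] := choice gG; exists (node G').
    by constructor=> i; have [] := HG' i.
  move=> w x y /mem_node_cons[i [v [-> vG]]] Kx Ky /=.
  by rewrite !phiF; [have [_ h] := HG' i; exact: h|exact: word_K..].
- move=> /mem_node_cons[i [v [-> vG]]] p Vp /=.
  rewrite phiF; last by move: Vp; rewrite inE => /V0_K; exact: word_K.
  by have [_ h _] := Hpsi i; exact: (h v vG p Vp).
- move=> /mem_node_cons[i [v [-> vG]]].
  have [_ _ h] := Hpsi i; apply: harm_ext (h v vG) => x Kx /=.
  by rewrite phiF //; exact: word_K.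
Qed.

(** * Resistance metric *)

Local Notation dom := (energy_dom F K V0 H r).
Local Notation energy := (energy F V0 H r).

Lemma harm_const g c : harm g -> {within K, continuous (g : M -> R^o)} ->
  (forall p, V0 p -> g p = c) -> forall x, K x -> g x = c.
Proof.
move=> hg cg gc x Kx; have [A _ HA] := energy_osc.
have h0 m : EG (level m) g g <= 0.
  rewrite (EG_harm _ (cut_level m) hg) (@E0_cst g c) // => p.
  by rewrite inE; exact: gc.
have := HA g 0 cg h0 x p0 Kx (V0_K V0_p0).
by rewrite sqrtr0 mulr0 normr_le0 subr_eq0 (gc _ V0_p0) => /eqP.
Qed.

Lemma complex_within_continuous (f : M -> R[i]) :
  {within K, continuous (f : M -> R[i]^o)} ->
  {within K, continuous (Re \o f : M -> R^o)} /\
  {within K, continuous (Im \o f : M -> R^o)}.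
Proof.
move=> /subspace_continuousP cf.
have h x e : K x -> 0 < e -> exists2 d, 0 < d & forall y, K y -> mdist x y < d ->
    Num.sqrt (Re (f x - f y) ^+ 2 + Im (f x - f y) ^+ 2) < e.
  move=> Kx e0; have e0' : 0 < e%:C%C by rewrite ltcR.
  have /cvgrPdist_lt/(_ _ e0') := cf x Kx.
  move=> /metricType_numDomainType.nbhs_mdistP[d /= d0 hd].
  exists d => // y Ky xy; have := hd y xy Ky; by rewrite normc_def ltcR.
split; apply/within_continuousP => x e Kx e0; have [d d0 hd] := h x e Kx e0;
    exists d => // y Ky xy; apply: le_lt_trans (hd y Ky xy).
  rewrite /= (_ : Re _ - Re _ = Re (f x - f y)); last by case: (f x); case: (f y).
  by apply: norm_le_sqrt; rewrite lerDl sqr_ge0.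
rewrite /= (_ : Im _ - Im _ = Im (f x - f y)); last by case: (f x); case: (f y).
by apply: norm_le_sqrt; rewrite lerDr sqr_ge0.
Qed.

Lemma real_complex_within_continuous (u : M -> R) :
  {within K, continuous (u : M -> R^o)} ->
  {within K, continuous ((fun x => (u x)%:C%C) : M -> R[i]^o)}.
Proof.
move=> /within_continuousP cu; apply/subspace_continuousP => x Kx.
apply/cvgrPdist_lt => e; rewrite ltcE => /andP[/= /eqP Ime e0].
have [d d0 hd] := cu x _ Kx e0.
apply/metricType_numDomainType.nbhs_mdistP; exists d => //= y xy Ky.
rewrite normc_def /= oppr0 addr0 expr0n addr0 sqrtr_sqr ltcE /= Ime eqxx /=.
exact: hd.
Qed.

Lemma real_complex_cvg (a : nat -> R) (l : R) : (a @ \oo --> (l : R^o)) ->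
  ((fun n => (a n)%:C%C) : nat -> R[i]^o) @ \oo --> (l%:C%C : R[i]^o).
Proof.
move=> /cvgrPdist_lt al; apply/cvgrPdist_lt => e.
rewrite ltcE => /andP[/= /eqP Ime e0]; apply: filterS (al _ e0) => n.
by rewrite normc_def /= oppr0 addr0 expr0n addr0 sqrtr_sqr ltcE /= Ime eqxx.
Qed.

Lemma level_energy_mono f : {homo level_energy F V0 H r ^~ f : m n / (m <= n)%N >-> m <= n}.
Proof.
apply: homo_leq => [//|x y z|m]; first exact: le_trans.
by rewrite !level_energyE lerD // level_mono.
Qed.

Lemma energy_lim f B : (forall m, level_energy F V0 H r m f <= B) ->
  (forall m, level_energy F V0 H r m f <= energy f) /\ energy f <= B.
Proof.
move=> hB; pose a m := level_energy F V0 H r m f.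
have aub : has_ubound (range a) by exists B => _ [m _ <-]; exact: hB.
have ca := nondecreasing_cvgn (@level_energy_mono f) aub.
have -> : energy f = sup (range a).
  rewrite /Defs.energy /energy_form (_ : (fun m => _) = fun m => (a m)%:C%C).
    by rewrite (cvg_lim _ (real_complex_cvg ca)) //; exact: norm_hausdorff.
  apply/funext => m; apply/eqP; rewrite eq_complex eqxx /=.
  rewrite level_formE /= (_ : Re \o _ = Re \o f); last first.
    by apply/funext => x /=; case: (f x).
  rewrite (_ : Im \o (_ \o _) = fun x => - (Im \o f) x); last first.
    by apply/funext => x /=; case: (f x).
  by rewrite EG_oppr [EG _ (Im \o f) _]EGC addNr.
split=> [m|]; first by apply: ub_le_sup => //; exists m.
by apply: ge_sup => [|_ [m _ <-]]; [exists (a 0%N), 0%N|exact: hB].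
Qed.

Lemma dom_bounded f : dom f -> exists B, forall m, level_energy F V0 H r m f <= B.
Proof.
move=> [_]; set a := fun m => (level_energy F V0 H r m f)%:E.
have amono : {homo a : m n / (m <= n)%N >-> (m <= n)%E}.
  by move=> m n mn; rewrite lee_fin level_energy_mono.
rewrite (cvg_lim _ (ereal_nondecreasing_cvgn amono)) // => hs.
have le m : (a m <= ereal_sup (range a))%E by apply: ereal_sup_ubound; exists m.
exists (fine (ereal_sup (range a))) => m.
rewrite -lee_fin fineK ?le // fin_real // hs andbT.
by rewrite (lt_le_trans _ (le 0%N)) // ltNyr.
Qed.

Lemma dom_level_le f m : dom f ->
  EG (level m) (Re \o f) (Re \o f) + EG (level m) (Im \o f) (Im \o f) <= energy f.
Proof.
move=> df; have [B hB] := dom_bounded df.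
by rewrite -level_energyE; have [h _] := energy_lim hB; exact: h.
Qed.

Lemma real_dom (u : M -> R) B : {within K, continuous (u : M -> R^o)} ->
  (forall m, EG (level m) u u <= B) ->
  dom (fun x => (u x)%:C%C) /\ energy (fun x => (u x)%:C%C) <= B.
Proof.
move=> cu hB.
have hB' m : level_energy F V0 H r m (fun x => (u x)%:C%C) <= B.
  by rewrite level_energy_real.
split; last by have [] := energy_lim hB'.
split; first exact: real_complex_within_continuous.
rewrite (@le_lt_trans _ _ B%:E) ?ltry //; apply: lime_le.
  apply: ereal_nondecreasing_is_cvgn => m n mn.
  by rewrite lee_fin level_energy_mono.
by apply: nearW => m; rewrite lee_fin.
Qed.

(** Refinement inside the cells of [G] adds no energy, and coarser levels have no more. Hence
    continuous piecewise harmonic functions are in the domain of the energy. *)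
Lemma EG_piecewise_le G phi m : cut G ->
  (forall w, w \in G -> harm (phi \o word_map F w)) ->
  EG (level m) phi phi <= EG G phi phi.
Proof.
move=> cG; elim: cG phi m => [|{}G cG IH] phi m hphi.
  by rewrite EG_nil EG_harm //; [exact: cut_level|exact: (hphi [::])].
case: m => [|m]; first by rewrite EG_nil E0_le_EG //; constructor.
rewrite [leRHS]EG_node [leLHS]EG_node ler_sum // => i _.
rewrite ler_wpM2l ?invr_ge0 ?r_ge0 // IH // => w wG.
by apply: (hphi (i :: w)); rewrite mem_node.
Qed.

(** Makes the limit in the energy form stationary against piecewise harmonic functions. *)
Lemma EG_piecewise_level k n u phi :
  (forall w, w \in level k -> harm (phi \o word_map F w)) ->
  EG (level (k + n)) u phi = EG (level k) u phi.
Proof.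
elim: k u phi => [|k IH] u phi hphi.
  rewrite EG_nil EGC EG_harm; [by rewrite E0C|exact: cut_level|].
  exact: (hphi [::]).
rewrite addSn EG_node [RHS]EG_node; apply: eq_bigr => i _.
by rewrite IH // => w wG; apply: (hphi (i :: w)); rewrite mem_node.
Qed.

Lemma EG_ext G u u' v v' :
  (forall w p, w \in G -> V0 p -> u (word_map F w p) = u' (word_map F w p)) ->
  (forall w p, w \in G -> V0 p -> v (word_map F w p) = v' (word_map F w p)) ->
  EG G u v = EG G u' v'.
Proof.
move=> hu hv; apply: eq_big_seq => w wG; congr (_ * _).
by apply: E0_ext => p; rewrite inE => Vp /=; [exact: hu|exact: hv].
Qed.

Lemma complex_integral0 (f : M -> R[i]) :
  complex_integral K mu (fun x => 0 * f x) = 0.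
Proof.
by rewrite /complex_integral; under eq_Rintegral do rewrite mul0r /=;
  under [X in (_ +i* X)%C]eq_Rintegral do rewrite mul0r /=;
  rewrite /Rintegral integral0.
Qed.

Lemma real_harmonic_function (u : M -> R) : harm u -> cell_continuous u ->
  harmonic_functions F K V0 H r mu (fun x => (u x)%:C%C).
Proof.
move=> hu cu; split.
  apply: (proj1 (real_dom (B := E0 u u) (cell_continuous_within cu) _)) => m.
  by rewrite EG_harm //; exact: cut_level.
move=> phi dphi phi0; rewrite complex_integral0 oppr0.
rewrite /energy_form; apply: (@lim_near_cst R[i]^o); first exact: norm_hausdorff.
apply: nearW => m; rewrite level_formE.
rewrite (_ : Re \o _ = u) // (_ : Im \o _ = fun=> 0) //.
rewrite !(EG_harm _ (cut_level m) hu) !(@E0_cst _ 0 u); last 2 first.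
- by move=> p; rewrite inE => Vp /=; rewrite phi0.
- by move=> p; rewrite inE => Vp /=; rewrite phi0.
rewrite !(EGC _ (fun=> 0)) /EG !big1 ?subr0 ?addr0 // => w _;
  by rewrite (@E0_cst _ 0) ?mulr0.
Qed.

(** Uniqueness argument: [v] is harmonic with the boundary values of [u], and [g] is their
    difference. The piecewise harmonic interpolation of [g] at level [k] is orthogonal to both [u]
    and [v], so [g] has zero energy at every level and vanishes on [K]. *)
Lemma harm_of_orth (u : M -> R) : {within K, continuous (u : M -> R^o)} ->
  (forall k phi, cell_continuous phi ->
     (forall w, w \in level k -> harm (phi \o word_map F w)) ->
     (forall p, V0 p -> phi p = 0) -> EG (level k) u phi = 0) ->
  harm u.
Proof.
move=> cu orth; have [v [vu hv cv]] := harmonic_extension u.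
pose g x := u x + (-1) * v x.
have g0 p : V0 p -> g p = 0 by move=> Vp; rewrite /g vu ?inE // mulN1r subrr.
have Eg k : EG (level k) g g <= 0.
  have [phi [cphi phig hphi]] := piecewise_harmonic g (cut_level k).
  have phi0 p : V0 p -> phi p = 0.
    move=> Vp; have [w [q [wG Vq epq]]] := V0_cut (cut_level k) Vp.
    have := phig w wG q; rewrite inE => /(_ Vq) /= ephi.
    by rewrite -(g0 p Vp) epq.
  rewrite (@EG_ext _ g g g phi) //; last first.
    move=> w p wG Vp; have := phig w wG p; rewrite inE => /(_ Vp) /=.
    by move=> ->.
  rewrite EGC EG_linr EGC orth // EGC EG_harm //; last exact: cut_level.
  rewrite (@E0_cst phi 0) ?mulr0 ?addr0 // => p.
  by rewrite inE; exact: phi0.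
have cg : {within K, continuous (g : M -> R^o)}.
  move/within_continuousP: cu => cu; have /within_continuousP cv' := cell_continuous_within cv.
  apply/within_continuousP => x e Kx e0; have e2 : 0 < e / 2 by rewrite divr_gt0.
  have [d d0 hd] := cu x _ Kx e2; have [d' d0' hd'] := cv' x _ Kx e2.
  exists (Num.min d d'); first by rewrite lt_min d0.
  move=> y Ky; rewrite lt_min => /andP[/(hd _ Ky) h1 /(hd' _ Ky) h2].
  rewrite /g (_ : _ - _ = (u x - u y) - (v x - v y)); last by ring.
  by rewrite (le_lt_trans (ler_normB _ _)) // (splitr e) ltrD.
have [A _ HA] := energy_osc; apply: harm_ext hv => x Kx; apply/esym/eqP.
have := HA g 0 cg Eg x p0 Kx (V0_K V0_p0).
rewrite sqrtr0 mulr0 normr_le0 (g0 _ V0_p0) subr0 /g mulN1r subr_eq0.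
by [].
Qed.

(** Testing with real piecewise harmonic functions separates the real and imaginary parts of the
    weak equation and turns it into the hypothesis of [harm_of_orth]. *)
Lemma harmonic_function_harm h : harmonic_functions F K V0 H r mu h ->
  harm (Re \o h) /\ harm (Im \o h).
Proof.
move=> [dh Lh]; have [cRe cIm] := complex_within_continuous (proj1 dh).
suff orth k phi : cell_continuous phi ->
     (forall w, w \in level k -> harm (phi \o word_map F w)) ->
     (forall p, V0 p -> phi p = 0) ->
     EG (level k) (Re \o h) phi = 0 /\ EG (level k) (Im \o h) phi = 0.
  by split; apply: harm_of_orth => // k phi c1 c2 c3; have [] := orth k phi c1 c2 c3.
move=> cphi hphi phi0.
have [dphi _] := real_dom (cell_continuous_within cphi)
  (fun m => EG_piecewise_le m (cut_level k) hphi).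
have := Lh _ dphi (fun x Vx => congr1 (fun t => t%:C%C) (phi0 x Vx)).
rewrite complex_integral0 oppr0.
rewrite /energy_form (@lim_near_cst R[i]^o _ _ _ _
    (EG (level k) (Re \o h) phi +i* EG (level k) (Im \o h) phi)%C).
- by move=> [-> ->].
- exact: norm_hausdorff.
exists k => // m /= km; rewrite level_formE.
rewrite (_ : Re \o (fun x => _%:C%C) = phi) //.
rewrite (_ : Im \o (fun x => _%:C%C) = fun=> 0) //.
have z v : EG (level m) v (fun=> 0) = 0.
  by rewrite /EG big1 // => w _; rewrite (@E0_cst _ 0) ?mulr0.
by rewrite !z subr0 add0r -(subnKC km) !EG_piecewise_level.
Qed.

Local Notation resistance := (resistance F K V0 H r).

Lemma dom_osc : exists2 A : R, 0 < A & forall f w x y, dom f -> K x -> K y ->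
  `|Re (f (word_map F w x)) - Re (f (word_map F w y))| <=
  A * Num.sqrt (ratio w * energy f).
Proof.
have [A A0 HA] := energy_osc; exists A => // f w x y df Kx Ky.
apply: (HA (Re \o f \o word_map F w)) => //.
  by apply: word_within_continuous; have [] := complex_within_continuous (proj1 df).
move=> m; rewrite (le_trans (level_cell_le _ _ _)) // ler_wpM2l ?ratio_ge0 //.
by rewrite (le_trans _ (dom_level_le (size w + m) df)) // lerDl EG_ge0.
Qed.

(* If no function of finite energy separates two points, the infimum is that of
   the empty set, i.e. [0], and the resistance is [0] as well. *)
Lemma resistance_cell : exists2 A : R, 0 < A &
  (forall w x y, K x -> K y ->
    resistance (word_map F w x) (word_map F w y) <= A * ratio w) /\
  (forall x y f, K x -> K y -> dom f -> f x = 0 -> f y = 1 -> A^-1 <= energy f).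
Proof.
have [A A0 HA] := dom_osc; exists (A ^+ 2); first by rewrite exprn_gt0.
have lo w x y f : K x -> K y -> dom f -> f (word_map F w x) = 0 ->
    f (word_map F w y) = 1 -> (A ^+ 2 * ratio w)^-1 <= energy f.
  move=> Kx Ky df fx fy; have := HA f w x y df Kx Ky.
  rewrite fx fy /= sub0r normrN1 => h.
  have E0' : 0 <= ratio w * energy f.
    by rewrite mulr_ge0 ?ratio_ge0 // (le_trans _ (dom_level_le 0 df)) // addr_ge0 ?EG_ge0.
  have : 1 <= A ^+ 2 * (ratio w * energy f).
    rewrite -(sqr_sqrtr E0') -exprMn -(expr1n _ 2).
    by rewrite lerXn2r ?nnegrE // (le_trans _ h).
  rewrite mulrA => h'; rewrite -[leLHS]mulr1 ler_pdivrMl //.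
  by rewrite mulr_gt0 ?exprn_gt0 ?ratio_gt0.
split=> [w x y Kx Ky|x y f Kx Ky df fx fy]; last first.
  by have := lo [::] x y f Kx Ky df fx fy; rewrite ratio_nil mulr1.
rewrite /Defs.resistance; case: eqP => _; first by rewrite mulr_ge0 ?exprn_ge0 ?ratio_ge0 ?ltW.
set S := [set _ | _ in _]; have [/set0P/negP/negPn/eqP->|S0] := pselect (~ (S !=set0)).
  by rewrite inf0 invr0 mulr_ge0 ?exprn_ge0 ?ratio_ge0 ?ltW.
have AW : 0 < A ^+ 2 * ratio w by rewrite mulr_gt0 ?exprn_gt0 ?ratio_gt0.
have : (A ^+ 2 * ratio w)^-1 <= inf S.
  apply: lb_le_inf; first exact: contrapT.
  by move=> _ [f [df fx fy] <-]; exact: (lo w x y).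
move=> h; rewrite -[leRHS]invrK lef_pV2 // posrE ?invr_gt0 //.
by rewrite (lt_le_trans _ h) ?invr_gt0.
Qed.

(* The piecewise harmonic function equal to [1] at the vertices of the cell [w]
   and to [0] at all others has energy [O(s^-1)] and separates the two cells. *)
Lemma resistance_touch : exists2 c : R, 0 < c & forall (s : R) G v w x y,
  0 < s -> scale_cut s G -> v \in G -> w \in G -> cell v x -> cell w y ->
  resistance x y < c * s -> touch v w.
Proof.
have [A A0 HA] := E0_osc; have [B B0 [_ HB]] := resistance_cell.
(* At most [T] cells carry energy of the cut-off; on each its oscillation is at most 1 and the ratio
   is at least [rmin * s]. The successor keeps [D] positive. *)
have [T HT] := touch_number; pose D : R := A * T.+1%:R / rmin.
have D0 : 0 < D by rewrite divr_gt0 ?mulr_gt0 ?rmin_gt0.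
exists D^-1; first by rewrite invr_gt0.
move=> s G v w x y s0 [cG sG] vG wG vx wy Rxy; apply: contrapT => nt.
have Kx : K x by case: vx => z Kz <-; exact: word_K.
have Ky : K y by case: wy => z Kz <-; exact: word_K.
have nxy : x != y by apply/eqP => xy; apply: nt; exists x; rewrite {2}xy.
pose f z : R := (`[< exists2 p, V0 p & word_map F w p = z >])%:R.
have [phi [cphi phif hphi]] := piecewise_harmonic f cG.
have cphi' := cell_continuous_within cphi.
have phiV t p : t \in G -> V0 p -> phi (word_map F t p) = f (word_map F t p).
  by move=> tG Vp; apply: (phif t tG p); rewrite inE.
have phiw : phi y = 1.
  case: wy => z Kz <-; apply: (harm_const (hphi w wG)) => //.
    exact: word_within_continuous.
  by move=> p Vp /=; rewrite phiV // /f asboolT //; exists p.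
have f0 t p : ~ touch t w -> V0 p -> f (word_map F t p) = 0.
  move=> ntw Vp; rewrite /f asboolF // => -[q Vq qp]; apply: ntw.
  exists (word_map F t p); split; first by exists p => //; exact: V0_K.
  by exists q => //; exact: V0_K.
have phiv : phi x = 0.
  case: vx => z Kz <-; apply: (harm_const (hphi v vG)) => //.
    exact: word_within_continuous.
  by move=> p Vp /=; rewrite phiV // f0.
have EGphi : EG G phi phi <= D / s.
  rewrite (@EG_ext G phi f phi f) //; try exact: phiV.
  apply: (@le_trans _ _ (\sum_(t <- G | `[< touch w t >]) A / (rmin * s))).
    rewrite [leRHS]big_mkcond /EG big_seq [leRHS]big_seq ler_sum // => t tG.
    case: asboolP => [_|nwt]; last first.
      rewrite (@E0_cst _ 0) ?mulr0 // => p; rewrite inE => Vp /=.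
      by rewrite f0 // => /touch_sym.
    rewrite mulrC ler_pM ?E0_ge0 ?invr_ge0 ?ratio_ge0 //.
      rewrite -[leRHS]mulr1 -(expr1n _ 2) HA // => p q _ _ /=.
      by rewrite /f; do 2 case: asboolP => _; rewrite ?subrr ?subr0 ?sub0r ?normrN ?normr0 ?normr1.
    by rewrite lef_pV2 ?posrE ?mulr_gt0 ?rmin_gt0 ?ratio_gt0 //; case/andP: (sG t tG).
  rewrite big_const_seq iter_addr_0 -mulr_natr -sum1_count.
  rewrite /D (_ : _ / s = A / (rmin * s) * T.+1%:R); last first.
    by field; rewrite !lt0r_neq0 ?rmin_gt0.
  rewrite ler_wpM2l ?divr_ge0 ?mulr_ge0 ?(ltW A0) ?(ltW rmin_gt0) ?(ltW s0) //.
  by rewrite ler_nat (leq_trans (HT G w cG wG)).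
have [dphi Ephi] := real_dom cphi' (fun m => le_trans (EG_piecewise_le m cG hphi) EGphi).
move: Rxy; rewrite /Defs.resistance (negbTE nxy); apply/negP; rewrite -leNgt.
set S := [set _ | _ in _].
have SE : S (energy (fun z => (phi z)%:C%C)).
  by exists (fun z => (phi z)%:C%C) => //; split; rewrite // ?phiv ?phiw.
have lb : B^-1 <= inf S.
  by apply: lb_le_inf; [eexists; exact: SE|move=> _ [g [dg gx gy] <-]; exact: (HB x y)].
have iS0 : 0 < inf S by rewrite (lt_le_trans _ lb) ?invr_gt0.
clearbody D; rewrite (_ : D^-1 * s = (D / s)^-1); last by rewrite invfM invrK.
rewrite lef_pV2 ?posrE ?divr_gt0 //.
rewrite (le_trans _ Ephi) //; apply: ge_inf => //; exists B^-1.
by move=> _ [g [dg gx gy] <-]; exact: (HB x y).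
Qed.

(** * Mass and energy of cells *)

Local Notation normc := (@ComplexField.Normc.normc R).
Local Notation rball := (resistance_ball F K V0 H r).

Lemma closed_borel (A : set M) : closed A -> measurable (A : set (borel M)).
Proof.
move=> cA; rewrite -[A]setCK; apply: measurableC.
by apply: sub_sigma_algebra; exact: closed_openC.
Qed.

Lemma continuous_borel (f : M -> M) (A : set M) : continuous f ->
  measurable (A : set (borel M)) -> measurable (f @^-1` A : set (borel M)).
Proof.
move=> cf mA.
suff : <<s open >> `<=` [set B : set M | measurable (f @^-1` B : set (borel M))].
  exact.
apply: smallest_sub; last first.
  move=> B oB; apply: sub_sigma_algebra; apply: open_comp => // x _; exact: cf.
split=> [|B mB|B mB] /=.
- by rewrite preimage_set0; exact: (@measurable0 _ (borel M)).
- by rewrite setTD preimage_setC; exact: (@measurableC _ (borel M)).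
- by rewrite preimage_bigcup; exact: (@bigcupT_measurable _ (borel M)).
Qed.

Lemma K_borel : measurable (K : set (borel M)).
Proof. by apply: closed_borel; exact: K_closed. Qed.

Lemma cell_borel w : measurable (cell w : set (borel M)).
Proof. by apply: closed_borel; exact: cell_closed. Qed.

Lemma mu_cut G (A : set (borel M)) : cut G -> measurable A ->
  (mu A = \sum_(w <- G) (ratio w `^ dH)%:E * mu (word_map F w @^-1` A))%E.
Proof.
move=> cG; elim: cG A => [|{}G cG IH] A mA.
  by rewrite big_seq1 ratio_nil powR1 mul1e.
rewrite big_node; have [_ ->//] := mu_self_similar; apply: eq_bigr => i _.
have mFA : measurable (F i @^-1` A : set (borel M)).
  by apply: continuous_borel => //; exact: F_continuous.
rewrite (IH i _ mFA) ge0_sume_distrr; last first.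
  by move=> w _; rewrite mule_ge0 ?lee_fin ?powR_ge0.
apply: eq_bigr => w _; rewrite muleA -EFinM ratio_cons.
by rewrite powRM ?r_ge0 ?ratio_ge0.
Qed.

Lemma mu_notK (A : set (borel M)) : measurable A -> A `&` K = set0 -> mu A = 0%E.
Proof.
move=> mA AK; have [muK _] := mu_self_similar.
have mC : measurable (~` K : set (borel M)) by apply: measurableC; exact: K_borel.
have : (mu (~` K) = 0)%E by rewrite probability_setC ?muK ?subee //; exact: K_borel.
move=> mu0; apply/eqP; rewrite eq_le measure_ge0 andbT -mu0.
apply: le_measure; rewrite ?inE //.
by move=> x Ax Kx; have : (A `&` K) x by []; rewrite AK.
Qed.

Definition mass (A : set M) : R := fine (mu (A : set (borel M))).

Lemma mass_ge0 A : 0 <= mass A. Proof. exact/fine_ge0/measure_ge0. Qed.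

Lemma massE (A : set M) : measurable (A : set (borel M)) -> mu A = (mass A)%:E.
Proof. by move=> mA; rewrite fineK //; exact: fin_num_measure. Qed.

(** In the expansion over words of the same length, the preimage in the term of [w] contains [K] and
    has mass 1. *)
Lemma cell_mass_ge w : ratio w `^ dH <= mass (cell w).
Proof.
have [muK _] := mu_self_similar.
rewrite -lee_fin -massE; last exact: cell_borel.
rewrite (mu_cut (cut_level (size w)) (@cell_borel w)).
have wl : w \in level (size w) by rewrite mem_level.
rewrite (big_rem w) //= -[leLHS]adde0 leeD //; last first.
  by apply: sume_ge0 => v _; rewrite mule_ge0 ?lee_fin ?powR_ge0.
rewrite -[leLHS]mule1 lee_wpmul2l ?lee_fin ?powR_ge0 // -muK.
apply: le_measure; rewrite ?inE; first exact: K_borel.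
  apply: continuous_borel; [exact: word_continuous|exact: cell_borel].
by move=> x Kx; exists x.
Qed.

(** As cells may overlap, the mass is expanded over the whole cut: only words that touch the given
    one contribute, each at most $s^{d_H}$. *)
Lemma cell_mass_le : exists2 T : R, 0 < T & forall (s : R) G w, 0 < s ->
  scale_cut s G -> w \in G -> mass (cell w) <= T * s `^ dH.
Proof.
have [T HT] := touch_number; exists T.+1%:R => // s G v s0 [cG sG] vG.
rewrite -lee_fin -massE; last exact: cell_borel.
rewrite (mu_cut cG (@cell_borel v)).
apply: (@le_trans _ _ (\sum_(w <- G | `[< touch v w >]) (s `^ dH)%:E)%E).
  rewrite [leRHS]big_mkcond big_seq [leRHS]big_seq; apply: lee_sum => w wG.
  have mw : measurable (word_map F w @^-1` (cell v) : set (borel M)).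
    apply: continuous_borel; [exact: word_continuous|exact: cell_borel].
  case: asboolP => [_|nt].
    rewrite -[leRHS]mule1 lee_pmul ?lee_fin ?powR_ge0 ?probability_le1 //.
    rewrite ge0_ler_powR ?nnegrE ?ratio_ge0 ?(ltW s0) ?(ltW dH_gt0) //.
    by case/andP: (sG w wG).
  rewrite mu_notK ?mule0 //; apply/seteqP; split=> // x [/= cx Kx].
  by apply: nt; exists (word_map F w x); split=> //; exists x.
rewrite sumEFin lee_fin big_const_seq iter_addr_0 -[leLHS]mulr_natl -sum1_count.
by rewrite ler_wpM2r ?powR_ge0 // ler_nat (leq_trans (HT G v cG vG)).
Qed.

(** * Harmonic functions on cells *)

Definition tame (h : M -> R[i]) : Prop :=
  [/\ harm (Re \o h), harm (Im \o h),
      {within K, continuous (Re \o h : M -> R^o)} &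
      {within K, continuous (Im \o h : M -> R^o)}].

Lemma harmonic_tame h : harmonic_functions F K V0 H r mu h -> tame h.
Proof.
move=> Hh; have [hr hi] := harmonic_function_harm Hh.
by have [cr ci] := complex_within_continuous (proj1 (proj1 Hh)).
Qed.

Definition sqenergy (h : M -> R[i]) (w : word) : R :=
  E0 (Re \o h \o word_map F w) (Re \o h \o word_map F w) +
  E0 (Im \o h \o word_map F w) (Im \o h \o word_map F w).

(** The $e_w$ of the overview. A harmonic function has the same energy at all levels, so the
    vertices of the cell suffice. *)
Definition cell_energy h w : R := Num.sqrt (sqenergy h w).

Lemma sqenergy_ge0 h w : 0 <= sqenergy h w.
Proof. by rewrite addr_ge0 ?E0_ge0. Qed.

Lemma cell_energy_ge0 h w : 0 <= cell_energy h w.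
Proof. exact: sqrtr_ge0. Qed.

(** The energies of the subcells, divided by their ratios, add up to that of the cell; one summand
    is kept. *)
Lemma cell_energy_cat h v w : tame h ->
  cell_energy h (v ++ w) <= Num.sqrt (ratio w) * cell_energy h v.
Proof.
move=> [hr hi _ _]; rewrite -sqrtrM ?ratio_ge0 // ler_wsqrtr // mulrDr.
suff aux u : harm u -> E0 (u \o word_map F (v ++ w)) (u \o word_map F (v ++ w)) <=
    ratio w * E0 (u \o word_map F v) (u \o word_map F v) by rewrite lerD ?aux.
move=> hu; have := level_cell_le 0 w (u \o word_map F v).
rewrite (EG_harm _ (cut_level _) (harm_word v hu)) EG_nil.
by congr (_ <= _); congr E0; apply/funext => x /=; rewrite word_map_cat.
Qed.

Lemma cell_energy_nil h w : tame h -> cell_energy h w <= cell_energy h [::].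
Proof.
move=> th; rewrite -[w]cat0s (le_trans (cell_energy_cat _ _ th)) //.
rewrite ler_piMl ?cell_energy_ge0 // -sqrtr1 ler_wsqrtr //; exact: ratio_le1.
Qed.

Lemma tame_osc : exists2 A : R, 0 < A & forall h w x y, tame h -> K x -> K y ->
  normc (h (word_map F w x) - h (word_map F w y)) <= A * cell_energy h w.
Proof.
have [A A0 HA] := energy_osc; exists (2 * A); first by rewrite mulr_gt0.
move=> h w x y [hr hi cr ci] Kx Ky; rewrite -mulrA.
have aux (u : M -> R) : harm u -> {within K, continuous (u : M -> R^o)} ->
    E0 (u \o word_map F w) (u \o word_map F w) <= sqenergy h w ->
    `|u (word_map F w x) - u (word_map F w y)| <= A * cell_energy h w.
  move=> hu cu Eu; apply: (HA (u \o word_map F w)) => // [|m].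
    exact: word_within_continuous.
  by rewrite (EG_harm _ (cut_level m) (harm_word w hu)).
apply: normc_le.
  rewrite (_ : Re _ = (Re \o h) (word_map F w x) - (Re \o h) (word_map F w y)).
    by apply: aux => //; rewrite lerDl E0_ge0.
  by rewrite /=; case: (h _); case: (h _).
rewrite (_ : Im _ = (Im \o h) (word_map F w x) - (Im \o h) (word_map F w y)).
  by apply: aux => //; rewrite lerDr E0_ge0.
by rewrite /=; case: (h _); case: (h _).
Qed.

Lemma vertex_osc : exists2 c : R, 0 < c & forall h w, exists p q,
  [/\ V0 p, V0 q & c * cell_energy h w <=
     normc (h (word_map F w p) - h (word_map F w q))].
Proof.
(* Chosen with $2Ac^2 = 1/2$: if all vertex differences were at most [c] times the cell energy, real
   and imaginary parts together would account for only half of its square. *)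
have [A A0 HA] := E0_osc; pose c : R := (2 * Num.sqrt A)^-1.
have c0 : 0 < c by rewrite invr_gt0 mulr_gt0 ?sqrtr_gt0.
have cA : 2 * (A * c ^+ 2) = 2^-1.
  by rewrite /c exprVn exprMn sqr_sqrtr ?(ltW A0) //; field; rewrite lt0r_neq0.
exists c => // h w; have [e0|e0] := eqVneq (cell_energy h w) 0.
  by exists p0, p0; split; [exact: V0_p0|exact: V0_p0|rewrite e0 mulr0 normc_ge0].
have ep : 0 < cell_energy h w by rewrite lt0r e0 cell_energy_ge0.
apply: contrapT => npq.
have small p q : V0 p -> V0 q ->
    normc (h (word_map F w p) - h (word_map F w q)) <= c * cell_energy h w.
  move=> Vp Vq; rewrite leNgt; apply/negP => hpq; apply: npq.
  by exists p, q; split=> //; exact: ltW.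
have Er : E0 (Re \o h \o word_map F w) (Re \o h \o word_map F w) <=
    A * (c * cell_energy h w) ^+ 2.
  apply: HA => p q Vp Vq; apply: le_trans (small p q Vp Vq).
  rewrite /= (_ : _ - _ = Re (h (word_map F w p) - h (word_map F w q))).
    exact: Re_le_normc.
  by case: (h _); case: (h _).
have Ei : E0 (Im \o h \o word_map F w) (Im \o h \o word_map F w) <=
    A * (c * cell_energy h w) ^+ 2.
  apply: HA => p q Vp Vq; apply: le_trans (small p q Vp Vq).
  rewrite /= (_ : _ - _ = Im (h (word_map F w p) - h (word_map F w q))).
    exact: Im_le_normc.
  by case: (h _); case: (h _).
have := lerD Er Ei; rewrite -/(sqenergy h w) -(sqr_sqrtr (sqenergy_ge0 h w)).
rewrite -/(cell_energy h w) exprMn.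
have : 0 < cell_energy h w ^+ 2 by rewrite exprn_gt0.
clearbody c; move: (cell_energy h w ^+ 2) => e e_gt0; nra.
Qed.

(** * Oscillation integrals *)

Definition osc_integral (p : R) (h : M -> R[i]) (t : R) : \bar R :=
  (\int[mu]_(x in (K : set (borel M))) ((t `^ (- dH))%:E *
     \int[mu]_(y in (rball x t : set (borel M))) (normc (h x - h y) `^ p)%:E))%E.

Lemma matching_cut : exists2 C : R, 0 < C & forall t : R, 0 < t <= 1 ->
  exists (s : R) (G : seq word), [/\ 0 < s <= 1, scale_cut s G, s <= C * t &
    forall v w x y, v \in G -> w \in G -> cell v x -> cell w y ->
      resistance x y < t -> touch v w].
Proof.
have [c c0 Hc] := resistance_touch; exists c^-1; first by rewrite invr_gt0.
move=> t /andP[t0 t1]; have [tc|ct] := leP t c.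
  have s01 : 0 < t / c <= 1 by rewrite divr_gt0 //= ler_pdivrMr // mul1r.
  have [s0 s1] := andP s01; have [G sG] := scale_cut_exists s01.
  exists (t / c), G; split=> //; first by rewrite mulrC.
  move=> v w x y vG wG vx wy Rxy; apply: (Hc _ _ _ _ _ _ s0 sG vG wG vx wy).
  by rewrite mulrCA divff ?mulr1 // lt0r_neq0.
exists 1, [:: [::]]; split=> //.
- by rewrite ltr01 lexx.
- split; first by constructor.
  by move=> w; rewrite inE => /eqP->; rewrite ratio_nil mulr1 lexx (ltW rmin_lt1).
- by rewrite ler_pdivlMl // mulr1 ltW.
- move=> v w x y; rewrite !inE => /eqP-> /eqP-> [x' Kx _] _ _.
  by exists x'; split; exists x'.
Qed.

Lemma near_osc : exists2 A : R, 0 < A & forall h v w x y, tame h -> touch v w ->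
  cell v x -> cell w y ->
  normc (h x - h y) <= A * (cell_energy h v + cell_energy h w).
Proof.
have [A A0 HA] := tame_osc; exists A => // h v w x y th [_ [[z Kz <-] [z' Kz' e]]].
move=> [x' Kx' <-] [y' Ky' <-].
rewrite (le_trans (normcB_trans (h (word_map F v z)) _ _)) // mulrDr lerD ?HA //.
by rewrite -e HA.
Qed.

(** The kernel is dominated by rectangles over pairs of touching cells. Each word occurs at most [T]
    times on either side, and of the two masses $O(s^{d_H})$ one is cancelled by $t^{-d_H}$ since $s
    = O(t)$. *)
Lemma osc_integral_le (p : R) : 0 < p -> exists2 C : R, 0 < C & forall h (t : R), tame h ->
  0 < t <= 1 -> exists (s : R) G, [/\ 0 < s <= 1, scale_cut s G, s <= C * t &
    (osc_integral p h t <=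
     (C * s `^ dH * \sum_(w <- G) cell_energy h w `^ p)%:E)%E].
Proof.
move=> p0; have [D D0 HD] := matching_cut; have [A A0 HA] := near_osc.
have [m m0 Hm] := cell_mass_le; have [T HT] := touch_number.
pose B := A `^ p * 2 `^ p; have B0 : 0 <= B by rewrite mulr_ge0 ?powR_ge0.
pose C1 := D `^ dH * (B * m ^+ 2 * (T%:R *+ 2)).
exists (Num.max D C1); first by rewrite lt_max D0.
move=> h t th t01; have [t0 t1] := andP t01.
have [s [G [s01 sG sDt Ht]]] := HD t t01; have [s0 s1] := andP s01.
exists s, G; split=> //; first by rewrite (le_trans sDt) // ler_wpM2r ?(ltW t0) // le_max lexx.
have cG := proj1 sG.
pose J := [seq vw <- [seq (v, w) | v <- G, w <- G] | `[< touch vw.1 vw.2 >]].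
pose e w := cell_energy h w `^ p; have e0 w : 0 <= e w by exact: powR_ge0.
pose S := \sum_(w <- G) e w; have S0 : 0 <= S by rewrite sumr_ge0.
pose c (vw : word * word) := B * (e vw.1 + e vw.2).
have c0 j : 0 <= c j by rewrite mulr_ge0 ?addr_ge0.
apply: (@le_trans _ _ (t `^ (- dH) *
    \sum_(j <- J) c j * mass (cell j.1) * mass (cell j.2))%:E).
  apply: iterated_integral_le => //; try by move=> j; exact: cell_borel.
  - exact: powR_ge0.
  - by move=> x y; exact: powR_ge0.
  - move=> x y Kx [Ky Rxy].
    have [v vG vx] := cut_cover cG Kx; have [w wG wy] := cut_cover cG Ky.
    have tvw := Ht v w x y vG wG vx wy Rxy.
    have vwJ : (v, w) \in J.
      rewrite mem_filter; apply/andP; split; first exact/asboolP.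
      by apply/allpairsP; exists (v, w).
    apply: le_trans (ler_sum_seq_mem (f := fun j => c j * \1_(cell j.1) x *
      \1_(cell j.2) y) _ vwJ); last by move=> j _; apply: mulr_ge0 => //; apply: mulr_ge0.
    rewrite /= !indicE !mem_set // !mulr1 /c /= /B -mulrA.
    rewrite (@le_trans _ _ ((A * (cell_energy h v + cell_energy h w)) `^ p)) //.
      by rewrite ge0_ler_powR ?nnegrE ?normc_ge0 ?mulr_ge0 ?addr_ge0 ?cell_energy_ge0 ?HA ?(ltW p0) ?(ltW A0).
    rewrite powRM ?(ltW A0) ?addr_ge0 ?cell_energy_ge0 // ler_wpM2l ?powR_ge0 //.
    by apply: powRD_le; rewrite ?cell_energy_ge0 ?(ltW p0).
rewrite lee_fin.
have JS : \sum_(j <- J) c j <= B * (T%:R *+ 2) * S.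
  rewrite /c -mulr_sumr -mulrA ler_wpM2l // /J big_filter big_mkcond big_allpairs /=.
  have half : \sum_(v <- G) \sum_(w <- G) (if `[< touch v w >] then e v else 0) <=
      T%:R * S.
    rewrite /S mulr_sumr big_seq [leRHS]big_seq ler_sum // => v vG.
    rewrite -big_mkcond /= big_const_seq iter_addr_0 -sum1_count -[leLHS]mulr_natl.
    by rewrite ler_wpM2r // ler_nat HT.
  have half' : \sum_(v <- G) \sum_(w <- G) (if `[< touch v w >] then e w else 0) <=
      T%:R * S.
    rewrite exchange_big /= (le_trans _ half) //.
    apply: ler_sum => v _; apply: ler_sum => w _.
    by rewrite (asbool_equiv_eq (Q := touch v w)) //; split; exact: touch_sym.
  rewrite mulr2n mulrDl (le_trans _ (lerD half half')) //.
  rewrite -big_split /=; apply: ler_sum => v _; rewrite -big_split /=.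
  by apply: ler_sum => w _; case: ifPn => _; rewrite ?addr0.
have massJ : \sum_(j <- J) c j * mass (cell j.1) * mass (cell j.2) <=
    (m * s `^ dH) ^+ 2 * (B * (T%:R *+ 2) * S).
  apply: (@le_trans _ _ (\sum_(j <- J) c j * (m * s `^ dH) * (m * s `^ dH))).
    rewrite big_seq [leRHS]big_seq ler_sum // => -[v w].
    rewrite mem_filter => /andP[_ /allpairsP[[v' w'] /= [vG wG [-> ->]]]].
    apply: ler_pM; rewrite ?mass_ge0 //=; last exact: (Hm _ _ _ s0 sG wG).
      by apply: mulr_ge0; [exact: c0|exact: mass_ge0].
    by apply: ler_wpM2l; [exact: c0|exact: (Hm _ _ _ s0 sG vG)].
  rewrite -2!mulr_suml -mulrA -expr2 mulrC ler_wpM2l //.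
  by rewrite exprn_ge0 // mulr_ge0 ?powR_ge0 ?(ltW m0).
rewrite (le_trans (ler_wpM2l (powR_ge0 _ _) massJ)) //.
rewrite powRN mulrC ler_pdivrMr ?powR_gt0 //.
have sdH : s `^ dH <= D `^ dH * t `^ dH.
  rewrite -powRM ?(ltW D0) ?(ltW t0) // ge0_ler_powR ?nnegrE ?(ltW dH_gt0) ?(ltW s0) //.
  by rewrite mulr_ge0 ?(ltW D0) ?(ltW t0).
rewrite (@le_trans _ _ (C1 * s `^ dH * S * t `^ dH)) //; last first.
  apply: ler_wpM2r; first exact: powR_ge0.
  apply: ler_wpM2r; first exact: S0.
  by apply: ler_wpM2r; [exact: powR_ge0|rewrite le_max lexx orbT].
rewrite (_ : C1 * _ * _ * _ = (D `^ dH * t `^ dH) *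
    (B * m ^+ 2 * (T%:R *+ 2) * s `^ dH * S)); last by rewrite /C1; ring.
rewrite (_ : (m * _) ^+ 2 * _ = s `^ dH *
    (B * m ^+ 2 * (T%:R *+ 2) * s `^ dH * S)); last by ring.
by rewrite ler_wpM2r // !mulr_ge0 ?powR_ge0 ?exprn_ge0 ?mulrn_wge0 ?(ltW m0).
Qed.

(** Around two vertices with large difference, subcells [n] letters deeper are taken, with [n] so
    large that the oscillation on both together uses up at most half of that difference. *)
Lemma split_cells : exists (n : nat) (c : R), 0 < c /\ forall h w, tame h ->
  exists a b, [/\ size a = n, size b = n & forall x y,
    cell (w ++ a) x -> cell (w ++ b) y ->
    c * cell_energy h w <= normc (h x - h y)].
Proof.
have [c c0 Hc] := vertex_osc; have [A A0 HA] := tame_osc.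
have [n hn] : exists n, 2 * A * rho ^+ n <= c / 2.
  apply: contrapT => /forallNP hn; suff : c / 2 <= 0.
    by rewrite leNgt divr_gt0.
  apply: (@le0_geometric _ _ (2 * A) rho rho_bounds); first by rewrite mulr_ge0 ?(ltW A0).
  by move=> n; have /negP := hn n; rewrite -ltNge => /ltW.
exists n, (c / 2); split; first by rewrite divr_gt0.
move=> h w th; have [p [q [Vp Vq hpq]]] := Hc h w.
have Hcell s : V0 s -> exists2 a, size a = n & cell a s.
  move=> /V0_K Ks; have [a al sa] := cut_cover (cut_level n) Ks.
  by exists a => //; apply/eqP; rewrite -mem_level.
have [a sa pa] := Hcell p Vp; have [b sb qb] := Hcell q Vq.
have near s d z : cell d s -> size d = n -> cell (w ++ d) z ->
    normc (h z - h (word_map F w s)) <= A * rho ^+ n * cell_energy h w.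
  move=> [s' Ks' <-] sd [z' Kz' <-]; rewrite -word_map_cat.
  rewrite (le_trans (HA h (w ++ d) z' s' th Kz' Ks')) // -mulrA ler_wpM2l ?(ltW A0) //.
  rewrite (le_trans (cell_energy_cat _ _ th)) // ler_wpM2r ?cell_energy_ge0 //.
  by rewrite -sqrt_rmaxX ler_wsqrtr // -sd ratio_le.
exists a, b; split=> // x y xa yb.
have hx := near p a x pa sa xa; have hy := near q b y qb sb yb.
have h1 := normcB_trans (h x) (h (word_map F w p)) (h (word_map F w q)).
have h2 := normcB_trans (h y) (h x) (h (word_map F w q)).
rewrite normc_subC in hx.
have e0 := cell_energy_ge0 h w.
have : 2 * A * rho ^+ n * cell_energy h w <= c / 2 * cell_energy h w by rewrite ler_wpM2r.
lra.
Qed.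

Lemma osc_integral_ge (p : R) : 0 < p -> exists C c : R, [/\ 0 < C, 0 < c &
  forall h (s : R) G, tame h -> 0 < s -> scale_cut s G ->
    ((c * s `^ dH * \sum_(w <- G) cell_energy h w `^ p)%:E <=
     osc_integral p h (C * s))%E].
Proof.
move=> p0; have [n [c [c0 Hn]]] := split_cells.
have [A A0 [HA _]] := resistance_cell; have [L HL] := cell_multiplicity.
(* Points of one cell have resistance at most [A * s]; the additional 1 gives the strict inequality
   of the ball. *)
pose C := A + 1; have C0 : 0 < C by rewrite addr_gt0.
(* The subcells lie [n] letters below cells of ratio at least [rmin * s], whence the exponent
   [n.+1]. *)
pose k := (rmin ^+ n.+1) `^ dH.
have k0 : 0 < k by rewrite powR_gt0 // exprn_gt0 // rmin_gt0.
exists C, (C `^ (- dH) * (L.+1%:R^-1 * c `^ p * k ^+ 2)); split=> //.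
  apply: mulr_gt0; first exact: powR_gt0.
  apply: mulr_gt0; last exact: exprn_gt0.
  by apply: mulr_gt0; [rewrite invr_gt0|exact: powR_gt0].
move=> h s G th s0 [cG sG].
have /choice[ab Hab] : forall w, exists ab : word * word,
    [/\ size ab.1 = n, size ab.2 = n & forall x y,
    cell (w ++ ab.1) x -> cell (w ++ ab.2) y ->
    c * cell_energy h w <= normc (h x - h y)].
  by move=> w; have [a [b ?]] := Hn h w th; exists (a, b).
(* At most [L] cells contain [x], so this weight keeps the sum over possibly overlapping rectangles
   below the kernel. *)
pose d w := L.+1%:R^-1 * (c * cell_energy h w) `^ p.
have d0 w : 0 <= d w by rewrite mulr_ge0 ?invr_ge0 ?powR_ge0.
have massw w a : w \in G -> size a = n -> k * s `^ dH <= mass (cell (w ++ a)).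
  move=> wG sa; apply: le_trans (cell_mass_ge _).
  rewrite -powRM ?exprn_ge0 ?(ltW rmin_gt0) ?(ltW s0) //.
  rewrite ge0_ler_powR ?nnegrE ?ratio_ge0 ?(ltW dH_gt0) //.
    by rewrite mulr_ge0 ?exprn_ge0 ?(ltW rmin_gt0) ?(ltW s0).
  rewrite ratio_cat exprSr -mulrA mulrC ler_pM ?exprn_ge0 ?(ltW rmin_gt0) //.
  - by rewrite mulr_ge0 ?(ltW rmin_gt0) ?(ltW s0).
  - by case/andP: (sG w wG).
  - by rewrite -sa ratio_ge.
have cellcat v w : cell (v ++ w) `<=` cell v.
  move=> _ [x Kx <-]; rewrite word_map_cat.
  by exists (word_map F w x) => //; exact: word_K.
apply: (@le_trans _ _ ((C * s) `^ (- dH) * \sum_(w <- G) d w *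
    mass (cell (w ++ (ab w).1)) * mass (cell (w ++ (ab w).2)))%:E); last first.
  apply: iterated_integral_ge => //; try by move=> w; exact: cell_borel.
  - exact: powR_ge0.
  - move=> w x y wG xw yw.
    have [x' Kx' ex] := cellcat _ _ _ xw; have [y' Ky' ey] := cellcat _ _ _ yw.
    rewrite -ex -ey; split; first exact: word_K.
    split; first exact: word_K.
    rewrite (le_lt_trans (HA _ _ _ Kx' Ky')) //.
    apply: (@le_lt_trans _ _ (A * s)); last by rewrite ltr_pM2r // ltrDl.
    by rewrite ler_wpM2l ?(ltW A0) //; case/andP: (sG w wG).
  - move=> x y Kx [Ky _]; set e := normc _ `^ p.
    apply: (@le_trans _ _ (\sum_(w <- G | `[< cell w x >]) L.+1%:R^-1 * e)).
      rewrite [leRHS]big_mkcond; apply: ler_sum => w _; rewrite !indicE.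
      have [/set_mem xw|_] := boolP (x \in _); last first.
        rewrite mulr0 mul0r; case: ifP => // _.
        by rewrite mulr_ge0 ?powR_ge0 ?invr_ge0.
      have [/set_mem yw|_] := boolP (y \in _); last first.
        by rewrite mulr0; case: ifP => // _; rewrite mulr_ge0 ?powR_ge0 ?invr_ge0.
      rewrite asboolT ?mulr1; last exact: cellcat xw.
      rewrite ler_wpM2l ?invr_ge0 // ge0_ler_powR ?nnegrE ?(ltW p0) ?normc_ge0 //.
        by rewrite mulr_ge0 ?cell_energy_ge0 ?(ltW c0).
      by have [_ _ h'] := Hab w; exact: h'.
    rewrite big_const_seq iter_addr_0 -sum1_count -[leLHS]mulr_natl mulrA.
    rewrite -[leRHS]mul1r ler_wpM2r ?powR_ge0 // ler_pdivrMr // mul1r ler_nat.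
    by rewrite (leq_trans (HL G x cG)).
rewrite lee_fin powRM ?(ltW C0) ?(ltW s0) // -!mulrA ler_wpM2l ?powR_ge0 //.
have -> : L.+1%:R^-1 * (c `^ p * (k * (k * (s `^ dH * \sum_(w <- G) cell_energy h w `^ p)))) =
    s `^ (- dH) * \sum_(w <- G) d w * (k * s `^ dH) * (k * s `^ dH).
  have e : s `^ (- dH) * s `^ dH = 1.
    by rewrite powRN mulVf // gt_eqF // powR_gt0.
  rewrite -!mulr_suml -mulr_sumr.
  under [in RHS]eq_bigr do rewrite powRM ?(ltW c0) ?cell_energy_ge0 //.
  rewrite -mulr_sumr -[LHS]mul1r -[X in X * _ = _]e; ring.
rewrite ler_wpM2l ?powR_ge0 // big_seq [leRHS]big_seq ler_sum // => w wG.
have [sa sb _] := Hab w.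
have ks0 : 0 <= k * s `^ dH by rewrite mulr_ge0 ?powR_ge0 ?(ltW k0).
apply: ler_pM => //; [by apply: mulr_ge0|apply: ler_wpM2l => //; exact: massw|exact: massw].
Qed.

Lemma osc_sup_ge : exists C c : R, [/\ 0 < C, 0 < c &
  forall h (s : R) G w, tame h -> 0 < s -> scale_cut s G -> w \in G ->
    exists x y, [/\ K x, K y, resistance x y < C * s &
      c * cell_energy h w <= normc (h x - h y)]].
Proof.
have [c c0 Hc] := vertex_osc; have [A A0 [HA _]] := resistance_cell.
exists (A + 1), c; split=> //; first by rewrite addr_gt0.
move=> h s G w th s0 [cG sG] wG; have [p [q [Vp Vq hpq]]] := Hc h w.
exists (word_map F w p), (word_map F w q); split=> //; try exact/word_K/V0_K.
rewrite (le_lt_trans (HA w p q (V0_K Vp) (V0_K Vq))) //.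
apply: (@le_lt_trans _ _ (A * s)); last by rewrite ltr_pM2r // ltrDl.
by rewrite ler_wpM2l ?(ltW A0) //; case/andP: (sG w wG).
Qed.

(** * Decay of cell energies *)

(* With [b = sigma * walk_dim dH / 2], this is membership of the harmonic
   function [h] in the space of order [sigma], see [besov_decay]; the last
   branch is meant for [p = +oo]. *)
Definition decay (p : \bar R) (b : R) (h : M -> R[i]) : Prop :=
  match p with
  | q%:E => exists C : R, forall (s : R) G, 0 < s <= 1 -> scale_cut s G ->
      \sum_(w <- G) cell_energy h w `^ q <= C * s `^ (q * b - dH)
  | _ => exists C : R, forall (s : R) G w, 0 < s <= 1 -> scale_cut s G -> w \in G ->
      cell_energy h w <= C * s `^ b
  end.

(** The terms in [sum_cut_ratio_dH] add up to 1, and each is at least the power [dH] of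
    [rmin * s]. *)
Lemma scale_cut_size : exists2 C : R, 0 < C & forall (s : R) G, 0 < s ->
  scale_cut s G -> (size G)%:R <= C * s `^ (- dH).
Proof.
exists (rmin `^ (- dH)); first by rewrite powR_gt0 // rmin_gt0.
move=> s G s0 [cG sG]; rewrite -powRM ?(ltW rmin_gt0) ?(ltW s0) //.
have rs0 : 0 < rmin * s by rewrite mulr_gt0 ?rmin_gt0.
rewrite powRN -[leRHS]mul1r ler_pdivlMr ?powR_gt0 //.
rewrite -[leRHS](sum_cut_ratio_dH cG) mulr_natl -iter_addr_0 -count_predT -big_const_seq.
rewrite big_seq [leRHS]big_seq ler_sum // => w wG.
rewrite ge0_ler_powR ?nnegrE ?ratio_ge0 ?(ltW rs0) ?(ltW dH_gt0) //.
by case/andP: (sG w wG).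
Qed.

(* Test [u] against its truncation to the range of values on the cell [w]: all
   cells contribute nonnegatively, and [w] contributes its whole energy. *)
Lemma harm_energy_decay : exists2 C : R, 0 < C & forall u w, harm u ->
  Num.sqrt (E0 (u \o word_map F w) (u \o word_map F w)) <=
  C * Num.sqrt (E0 u u) * ratio w.
Proof.
have [A A0 HA] := E0_osc; have [B B0 HB] := E0_bound.
exists (2 * Num.sqrt (A * B)); first by rewrite mulr_gt0 ?sqrtr_gt0 ?mulr_gt0.
move=> u w hu; set e := E0 (u \o _) _.
have e0 : 0 <= e by exact: E0_ge0.
have [->|en0] := eqVneq e 0.
  by rewrite sqrtr0 !mulr_ge0 ?sqrtr_ge0 ?ratio_ge0.
have ep : 0 < e by rewrite lt0r en0.
(* By [E0_bound] the vertex values on the cell [w] are within [D] of [a], so the truncation to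
   $[a - D, a + D]$ leaves them unchanged. *)
pose D := Num.sqrt (B * e); pose a := u (word_map F w p0).
have D0 : 0 <= D by exact: sqrtr_ge0.
pose clamp z := Num.max (a - D) (Num.min z (a + D)).
have clampE z : `|z - a| <= D -> clamp z = z.
  rewrite ler_distl => /andP[h1 h2]; rewrite /clamp min_l ?max_r //.
  have clamp_mono z z' : z <= z' -> clamp z <= clamp z'.
  move=> zz'; rewrite /clamp ge_max le_max lexx /= le_max; apply/orP; right.
  by rewrite le_min !ge_min zz' lexx orbT.
have clamp_osc z z' : `|clamp z - clamp z'| <= 2 * D.
  have bd t : a - D <= clamp t <= a + D.
    by rewrite /clamp le_max lexx ge_max ge_min lexx orbT andbT /= lerD2l ge0_cp.
  have /andP[? ?] := bd z; have /andP[? ?] := bd z'.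
  by rewrite ler_norml; apply/andP; split; lra.
pose phi := clamp \o u.
(* As [clamp] is monotone, every term of [E0_diff] is nonnegative. *)
have pos v : 0 <= E0 v (clamp \o v).
  rewrite E0_diff mulr_ge0 ?invr_ge0 // big_seq sumr_ge0 // => x /V0seqP Vx.
  rewrite big_seq sumr_ge0 // => y /V0seqP Vy; rewrite -mulrA.
  have [->|xy] := eqVneq x y; first by rewrite subrr mul0r mulr0.
  rewrite mulr_ge0 ?H_ge0 //=; have [vxy|/ltW vxy] := leP (v x) (v y).
    by rewrite -mulrNN !opprB mulr_ge0 ?subr_ge0 ?clamp_mono.
  by rewrite mulr_ge0 ?subr_ge0 ?clamp_mono.
have ew : (ratio w)^-1 * e <= E0 u phi.
  rewrite -(EG_harm phi (cut_level (size w)) hu) /EG.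
  apply: le_trans (ler_sum_seq_mem (x := w) _ _); last by rewrite mem_level.
    rewrite ler_wpM2l ?invr_ge0 ?ratio_ge0 // le_eqVlt; apply/orP; left; apply/eqP.
    apply: E0_ext => // p; rewrite inE => Vp; rewrite /= /phi /= clampE //.
    by apply: norm_le_sqrt; apply: (HB (u \o word_map F w)) => //; exact: V0_p0.
  by move=> v _; rewrite mulr_ge0 ?invr_ge0 ?ratio_ge0 //; exact: pos.
have Ephi : E0 phi phi <= A * (2 * D) ^+ 2 by apply: HA => p q _ _; exact: clamp_osc.
have E0uphi : E0 u phi <= Num.sqrt (E0 u u) * (2 * Num.sqrt (A * B) * Num.sqrt e).
  rewrite (le_trans (ler_norm _)) // (le_trans (norm_le_sqrt (E0_CS u phi))) //.
  rewrite sqrtrM ?E0_ge0 // ler_wpM2l ?sqrtr_ge0 //.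
  rewrite -[leRHS]ger0_norm ?mulr_ge0 ?sqrtr_ge0 // -sqrtr_sqr ler_wsqrtr //.
  rewrite (le_trans Ephi) // /D !exprMn !sqr_sqrtr ?mulr_ge0 ?(ltW A0) ?(ltW B0) //.
  rewrite le_eqVlt; apply/orP; left; apply/eqP; ring.
(* The left side is linear in [e], the right side in its square root; division gains the full factor
   [ratio w], where additivity of energy alone would give its root. *)
have := le_trans ew E0uphi.
rewrite -{1}(sqr_sqrtr e0) expr2 !mulrA ler_pM2r ?sqrtr_gt0 //.
rewrite mulrC ler_pdivrMr ?ratio_gt0 //.
by rewrite -[_ * 2 * _]mulrA [Num.sqrt (E0 u u) * _]mulrC.
Qed.

Lemma decay_infty h : tame h -> decay +oo%E 1 h.
Proof.
move=> [hr hi _ _]; have [C C0 HC] := harm_energy_decay.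
pose B := C * (Num.sqrt (E0 (Re \o h) (Re \o h)) + Num.sqrt (E0 (Im \o h) (Im \o h))).
exists B => s G w /andP[s0 _] [_ sG] wG; rewrite powRr1 ?(ltW s0) //.
have B0 : 0 <= B by rewrite mulr_ge0 ?addr_ge0 ?sqrtr_ge0 ?(ltW C0).
apply: (@le_trans _ _ (B * ratio w)); last first.
  by rewrite ler_wpM2l //; case/andP: (sG w wG).
have hR := HC _ w hr; have hI := HC _ w hi.
rewrite /B mulrDr mulrDl (le_trans _ (lerD hR hI)) // /cell_energy /sqenergy.
set x := E0 _ _; set y := E0 _ _.
have x0 : 0 <= x by exact: E0_ge0. have y0 : 0 <= y by exact: E0_ge0.
have sx := sqrtr_ge0 x; have sy := sqrtr_ge0 y.
rewrite -[leRHS]ger0_norm ?addr_ge0 // -sqrtr_sqr ler_wsqrtr //.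
rewrite sqrrD !sqr_sqrtr // addrAC lerDl mulrn_wge0 // mulr_ge0 //.
Qed.

Lemma sum_sqenergy h G : tame h -> cut G ->
  \sum_(w <- G) (ratio w)^-1 * cell_energy h w ^+ 2 = cell_energy h [::] ^+ 2.
Proof.
move=> [hr hi _ _] cG; rewrite /cell_energy sqr_sqrtr ?sqenergy_ge0 //.
under eq_bigr do rewrite sqr_sqrtr ?sqenergy_ge0 // mulrDr.
rewrite big_split /=; congr (_ + _).
  exact: (EG_harm (Re \o h) cG hr).
exact: (EG_harm (Im \o h) cG hi).
Qed.

Lemma decay_two h : tame h -> decay 2%:E (walk_dim dH / 2) h.
Proof.
move=> th; exists (cell_energy h [::] ^+ 2) => s G /andP[s0 s1] [cG sG].
rewrite mulrCA divff ?pnatr_eq0 // mulr1 /walk_dim addrK powRr1 ?(ltW s0) //.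
rewrite -(sum_sqenergy th cG) mulr_suml big_seq [leRHS]big_seq ler_sum // => w wG.
rewrite powR_mulrn ?cell_energy_ge0 // mulrAC -[leLHS]mul1r ler_wpM2r ?sqr_ge0 //.
rewrite ler_pdivlMl ?ratio_gt0 // mulr1.
by case/andP: (sG w wG).
Qed.

(** The energy identity is two-sided: on a cut of scale [s] all ratios lie between [rmin * s] and
    [s], so the sum of squares is comparable to [s] and the exponent is sharp. *)
Lemma decay_two_ge h b : tame h -> 0 < cell_energy h [::] -> decay 2%:E b h ->
  b <= walk_dim dH / 2.
Proof.
move=> th e0 [C HC].
suff : 2 * b - dH <= 1 by rewrite /walk_dim ler_pdivlMr //; lra.
apply: (@powR_exponent_le _ (rmin * cell_energy h [::] ^+ 2) C).
  by rewrite mulr_gt0 ?rmin_gt0 ?exprn_gt0.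
move=> s s01; have [G sG] := scale_cut_exists s01; have [s0 _] := andP s01.
rewrite powRr1 ?(ltW s0) // (le_trans _ (HC s G s01 sG)) //.
have [cG HG] := sG; rewrite -(sum_sqenergy th cG) mulrAC mulr_sumr.
rewrite big_seq [leRHS]big_seq ler_sum // => w wG.
rewrite powR_mulrn ?cell_energy_ge0 // mulrA -[leRHS]mul1r ler_wpM2r ?sqr_ge0 //.
rewrite ler_pdivrMr ?ratio_gt0 // mul1r.
by case/andP: (HG w wG).
Qed.

(** With a single vertex all level energies vanish and functions in the domain have constant real
    part on [K]. Resistances would be inverses of the infimum 0 of the empty set, hence 0, against
    diameter 1. *)
Lemma V0_nontrivial : exists p q, [/\ V0 p, V0 q & p != q].
Proof.
apply: contrapT => npq.
have V0E p : V0 p -> p = p0.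
  move=> Vp; apply/eqP/negPn/negP => pp0; apply: npq.
  by exists p, p0; split=> //; exact: V0_p0.
have E00 u : E0 u u = 0.
  by apply: (@E0_cst _ (u p0)) => p; rewrite inE => /V0E->.
have [A _ HA] := energy_osc.
have R0 x y : K x -> K y -> resistance x y = 0.
  move=> Kx Ky; rewrite /Defs.resistance; case: eqP => // _.
  rewrite (_ : [set _ | _ in _] = set0) ?inf0 ?invr0 //.
  apply/seteqP; split=> // _ [f [df fx fy] _] /=.
  have [cr _] := complex_within_continuous (proj1 df).
  have Em m : EG (level m) (Re \o f) (Re \o f) <= 0.
    by rewrite /EG big1 // => w _; rewrite E00 mulr0.
  have := HA _ _ cr Em x y Kx Ky; rewrite sqrtr0 mulr0 normr_le0 /= fx fy /=.
  by rewrite sub0r oppr_eq0 oner_eq0.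
have := diam1; rewrite /resistance_diam (_ : [set _ | _ in _] = [set 0]).
  by rewrite sup1 => /esym/eqP; rewrite oner_eq0.
apply/seteqP; split=> [_ [[x y] [/= Kx Ky] <-]|_ ->]; first exact: R0.
have Kp := V0_K V0_p0.
by exists (p0, p0) => //=; rewrite R0.
Qed.

(* The net flux of a nonconstant harmonic function at some vertex [v] is
   nonzero, and at every scale it is carried by a bounded number of cells. *)
Lemma flux_decay : exists h, harmonic_functions F K V0 H r mu h /\
  0 < cell_energy h [::] /\ exists2 c : R, 0 < c & forall (s : R) G,
    0 < s -> scale_cut s G -> exists2 w, w \in G & c * s <= cell_energy h w.
Proof.
have [p [q [Vp Vq pq]]] := V0_nontrivial.
have [u [uV hu cu]] := harmonic_extension (fun x => (x == p)%:R).
have [v Vv Hv] : exists2 v, V0 v & \sum_(y <- V0seq) H v y * u y != 0.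
  apply: contrapT => nv; have [_ _ /(_ u)[+ _] _] := H_laplacian.
  case=> [x Vx|c uc].
    apply: contrapT => /eqP nx; apply: nv; exists x => //.
    by move: nx; rewrite fsbig_V0.
  have := uc p Vp; rewrite -(uc q Vq) !uV ?inE // eqxx eq_sym (negbTE pq) => /eqP.
  by rewrite oner_eq0.
(* Up to sign, [E0 u d] is the net flux of [u] at [v]. As [EG_harm] admits any second argument, it
   is also a sum over any cut, to which only cells containing [v] contribute. *)
pose d x : R := (x == v)%:R.
pose k := `|E0 u d|; have k0 : 0 < k.
  rewrite normr_gt0 E0C /E0 oppr_eq0 (bigD1_seq v) ?V0seq_uniq //=; last exact/V0seqP.
  rewrite [X in _ + X]big1 ?addr0; last first.
    by move=> x /negbTE xv; apply: big1 => y _; rewrite /d xv mulr0 mul0r.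
  by under eq_bigr do rewrite /d eqxx mulr1.
have [A A0 HA] := E0_osc; have [L HL] := cell_multiplicity.
have sq w : cell_energy (fun x => (u x)%:C%C) w =
    Num.sqrt (E0 (u \o word_map F w) (u \o word_map F w)).
  rewrite /cell_energy /sqenergy (_ : Re \o _ = u) // (_ : Im \o _ = fun=> 0) //.
  by rewrite [X in _ + X](@E0_cst _ 0) ?addr0.
have flux (s : R) G : 0 < s -> scale_cut s G -> exists2 w, w \in G &
    k / (L.+1%:R * Num.sqrt A) * rmin * s <= cell_energy (fun x => (u x)%:C%C) w.
  move=> s0 [cG sG]; apply: contrapT => nw.
  have small w : w \in G ->
      `|(ratio w)^-1 * E0 (u \o word_map F w) (d \o word_map F w)| <=
      k / L.+1%:R * (`[< cell w v >])%:R.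
    move=> wG; case: asboolP => [wv|nwv]; last first.
      rewrite (@E0_cst _ 0) ?mulr0 ?normr0 // => y; rewrite inE => Vy.
      rewrite /= /d; case: eqP => // e; case: nwv; exists y => //; exact: V0_K.
    rewrite mulr1 normrM ger0_norm ?invr_ge0 ?ratio_ge0 //.
    rewrite ler_pdivrMl ?ratio_gt0 //.
    have CS := norm_le_sqrt (E0_CS (u \o word_map F w) (d \o word_map F w)).
    rewrite (le_trans CS) // sqrtrM ?E0_ge0 // -sq.
    have dA : Num.sqrt (E0 (d \o word_map F w) (d \o word_map F w)) <= Num.sqrt A.
      rewrite ler_wsqrtr // -[leRHS]mulr1 -(expr1n _ 2); apply: HA => y z _ _ /=.
      by rewrite /d; do 2 case: eqP => _;
        rewrite ?subrr ?subr0 ?sub0r ?normrN ?normr0 ?normr1.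
    have le1 : cell_energy (fun x => (u x)%:C%C) w <=
        k / (L.+1%:R * Num.sqrt A) * rmin * s.
      by rewrite leNgt; apply/negP => lt1; apply: nw; exists w => //; exact: ltW.
    rewrite (le_trans (ler_pM (cell_energy_ge0 _ _) (sqrtr_ge0 _) le1 dA)) //.
    have sA : Num.sqrt A != 0 by rewrite gt_eqF // sqrtr_gt0.
    rewrite (_ : _ * s * Num.sqrt A = rmin * s * (k / L.+1%:R)); last first.
      have : L.+1%:R != 0 :> R by rewrite pnatr_eq0.
      by move: (L.+1%:R : R) => l l0; field; rewrite ?l0 ?sA.
    rewrite ler_wpM2r ?divr_ge0 ?(ltW k0) //.
    by case/andP: (sG w wG).
  have := EG_harm d cG hu => /(congr1 Num.norm); rewrite -/k => ek.
  (* If all cells had small energy, the at most [L] cells through [v] would carry less than the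
     total flux [k]. *)
  have : k <= k / L.+1%:R * L%:R.
    rewrite -[leLHS]ek (le_trans (ler_norm_sum _ _ _)) //.
    apply: (@le_trans _ _ (\sum_(w <- G) k / L.+1%:R * (`[< cell w v >])%:R)).
      by rewrite big_seq [leRHS]big_seq ler_sum.
    rewrite -mulr_sumr ler_wpM2l ?divr_ge0 ?(ltW k0) //.
    rewrite (_ : \sum_(w <- G) _ = (\sum_(w <- G | `[< cell w v >]) 1)%:R).
      by rewrite ler_nat HL.
    by rewrite natr_sum [RHS]big_mkcond; apply: eq_bigr => w _; case: asboolP.
  rewrite -mulrA -[leLHS]mulr1 ler_pM2l // mulrC ler_pdivlMr // mul1r ler_nat.
  by rewrite ltnn.
exists (fun x => (u x)%:C%C); split; first exact: real_harmonic_function.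
split; last first.
  exists (k / (L.+1%:R * Num.sqrt A) * rmin).
    by rewrite mulr_gt0 ?rmin_gt0 // divr_gt0 // mulr_gt0 ?sqrtr_gt0.
  by move=> s G s0 sG; exact: flux.
rewrite sq sqrtr_gt0 lt0r E0_ge0 andbT; apply/eqP => e0.
have := E0_CS u d; rewrite (_ : E0 u u = 0) // mul0r.
rewrite leNgt => /negP; apply; rewrite exprn_even_gt0 //=.
by rewrite -normr_gt0.
Qed.

(** * Besov norms and decay of cell energies *)

Local Notation besov := (besov_space K rball mu dH).
Local Notation seminorm := (besov_seminorm K rball mu dH).
Local Notation osc := (besov_osc K rball mu dH).

Lemma within_continuous_borel (u : M -> R) :
  {within K, continuous (u : M -> R^o)} ->
  measurable_fun (K : set (borel M)) (u : borel M -> R).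
Proof.
move=> /within_continuousP cu.
apply: (measurability _ (RGenOInfty.measurableE R)) => _ [_ [a ->] <-].
(* A union of balls of [M] whose trace on [K] is the set where [u] exceeds [a]. *)
pose V := [set y | exists x d, [/\ K x, a < u x, mdist x y < d &
  forall z, K z -> mdist x z < d -> a < u z]].
have oV : open V.
  rewrite openE => y [x [d [Kx ax xy hd]]].
  apply/metricType_numDomainType.nbhs_mdistP; exists (d - mdist x y).
    by rewrite /= subr_gt0.
  move=> z /= yz; exists x, d; split=> //.
  by rewrite (le_lt_trans (metric_triangle x y z)) // -ltrBrDl.
rewrite (_ : _ `&` _ = (K `&` V : set (borel M))).
  by apply: measurableI; [exact: K_borel|apply: sub_sigma_algebra].
apply/seteqP; split=> y [Ky] /=.
  rewrite in_itv /= andbT => ay; split=> //.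
  have [|d d0 hd] := cu y (u y - a) Ky; first by rewrite subr_gt0.
  exists y, d; split=> //; first by rewrite mdistxx.
  by move=> z Kz /(hd z Kz); rewrite ltr_distlC => /andP[]; lra.
move=> [x [d [Kx ax xy hd]]]; split=> //=.
by rewrite in_itv /= andbT; exact: hd.
Qed.

Lemma tame_bounded h : tame h -> exists2 B : R, 0 <= B &
  forall x, K x -> normc (h x) <= B.
Proof.
move=> th; have [A A0 HA] := tame_osc.
exists (A * cell_energy h [::] + normc (h p0)).
  by rewrite addr_ge0 ?normc_ge0 ?mulr_ge0 ?cell_energy_ge0 ?(ltW A0).
move=> x Kx; have := HA h [::] x p0 th Kx (V0_K V0_p0) => /= h1.
have := normcB_trans (h p0) (h x) 0; rewrite !subr0 => /le_trans; apply.
by rewrite lerD.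
Qed.

Lemma tame_Lp h p : tame h -> (1 <= p)%E -> (Lp_norm K mu p h < +oo)%E.
Proof.
move=> th p1; have [B B0 HB] := tame_bounded th.
have hB (x : borel M) : (`|((fun x : borel M => (normc (h x))%:E) \_ K) x| <= B%:E)%E.
  rewrite patchE; case: ifPn => [/set_mem Kx|_].
    by rewrite lee_fin ger0_norm ?normc_ge0 ?HB.
  by rewrite -[point]/(0%E) abse0 lee_fin.
rewrite /Lp_norm unlock; case: p p1 => [q q1|_|//].
  rewrite lee_fin in q1; have q0 : 0 < q by rewrite (lt_le_trans _ q1).
  set I := (\int[mu]_x _)%E; have I0 : (0 <= I)%E.
    by apply: integral_ge0 => x _; exact: poweR_ge0.
  have : (I <= (B `^ q)%:E)%E.
    apply: (@le_trans _ _ (\int[mu]_(x in [set: borel M]) (B `^ q)%:E)%E).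
      apply: le_ge0_integral => x _; first exact: poweR_ge0.
      rewrite -poweR_EFin gt0_ler_poweR ?(ltW q0) ?in_itv /= ?andbT ?abse_ge0 ?leey ?lee_fin ?B0 //.
    rewrite integral_cst // (_ : _ setT = 1%E) ?mule1 //; exact: probability_setT.
  case: I I0 => [x _ _| |//]; first by rewrite poweR_EFin ltry.
  by rewrite leye_eq.
case: ifP => _; last by rewrite ltry.
rewrite (@le_lt_trans _ _ B%:E) ?ltry //; apply/ess_supP.
by apply: nearW => x; exact: hB.
Qed.

(** Harmonic functions are bounded and measurable on [K], so their $L^p$ norm is finite and only the
    supremum over [t] decides. *)
Lemma harmonic_besov h p sigma : harmonic_functions F K V0 H r mu h ->
  (1 <= p)%E ->
  besov p +oo%E sigma h <-> exists2 B : R, 0 <= B & forall t : R, 0 < t <= 1 ->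
    (osc p h t <= (B * t `^ (sigma * walk_dim dH / 2))%:E)%E.
Proof.
move=> Hh p1; have th := harmonic_tame Hh; have [_ _ cr ci] := th.
set b := sigma * walk_dim dH / 2.
have osc0 t : 0 < t -> (0 <= osc p h t)%E.
  move=> t0; case: p p1 => [q _|_|//]; first exact: poweR_ge0.
  have Kp := V0_K V0_p0; apply: (@le_trans _ _ (normc (h p0 - h p0))%:E).
    by rewrite lee_fin normc_ge0.
  apply: ereal_sup_ubound; exists (p0, p0) => //; split=> //=; split=> //.
  by rewrite /Defs.resistance eqxx.
have tb0 t : 0 < t -> 0 < t `^ b by move=> t0; rewrite powR_gt0.
split=> [[_ fin]|[B B0 HB]].
  have : (seminorm p +oo%E sigma h < +oo)%E.
    rewrite ltNge leye_eq; apply/eqP => e; move: fin; rewrite /besov_norm e.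
    rewrite addey ?ltxx // gt_eqF //.
    by apply: (@lt_le_trans _ _ 0%E); [exact: ltNyr|exact: Lnorm_ge0].
  rewrite /besov_seminorm; set S := [set _ | _ in _] => fS.
  have le t : 0 < t <= 1 -> ((t `^ (- b))%:E * osc p h t <= ereal_sup S)%E.
    by move=> t01; apply: ereal_sup_ubound; exists t => //=; rewrite in_itv.
  have S0 : (0 <= ereal_sup S)%E.
    apply: le_trans (le 1 _); last by rewrite ltr01 lexx.
    by rewrite mule_ge0 ?lee_fin ?powR_ge0 // osc0.
  exists (fine (ereal_sup S)); first exact: fine_ge0.
  move=> t t01; have [t0 _] := andP t01; have := le t t01.
  rewrite -(fineK (x := ereal_sup S)) ?ge0_fin_numE //.
  by rewrite powRN lee_pdivrMl ?tb0 // -EFinM mulrC.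
split; first by split; exact: within_continuous_borel.
apply: lte_add_pinfty; first exact: tame_Lp.
apply: (@le_lt_trans _ _ B%:E); last exact: ltry.
rewrite /besov_seminorm; apply: ge_ereal_sup => y [t /=].
rewrite in_itv /= => t01 <-.
have [t0 _] := andP t01; rewrite powRN lee_pdivrMl ?tb0 //.
by rewrite -EFinM [_ * B]mulrC; exact: HB.
Qed.

Lemma besov_decay h p sigma : harmonic_functions F K V0 H r mu h ->
  (1 <= p)%E -> 0 < sigma ->
  besov p +oo%E sigma h <-> decay p (sigma * walk_dim dH / 2) h.
Proof.
move=> Hh p1 sigma0; have th := harmonic_tame Hh.
rewrite harmonic_besov //; set b := sigma * walk_dim dH / 2.
have b0 : 0 < b by rewrite divr_gt0 // mulr_gt0 // addr_gt0 // dH_gt0.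
have en0 := cell_energy_ge0 h; have E0 : 0 <= cell_energy h [::] := en0 [::].
case: p p1 => [p|_|//].
- rewrite lee_fin => p1; have p0 : 0 < p by rewrite (lt_le_trans _ p1).
  have pb0 : 0 < p * b by rewrite mulr_gt0.
  split=> [[B B0 HB]|[B HB]].
    have [C [c [C0 c0 HC]]] := osc_integral_ge p0.
    have [Z Z0 HZ] := scale_cut_size.
    (* [B1] serves the scales with [C * s <= 1], where the oscillation bound applies. The other
       scales are bounded below, and [B2] comes from the number of cells and the total energy. *)
    pose B1 := c^-1 * (B * C `^ b) `^ p.
    pose B2 := Z * cell_energy h [::] `^ p * C `^ (p * b).
    have B10 : 0 <= B1 by rewrite mulr_ge0 ?powR_ge0 // invr_ge0 ltW.
    have B20 : 0 <= B2.
      by apply: mulr_ge0; rewrite ?powR_ge0 // mulr_ge0 ?powR_ge0 // ltW.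
    exists (B1 + B2) => s G s01 sG; have [s0 s1] := andP s01.
    have [Cs|Cs] := leP (C * s) 1.
      apply: (@le_trans _ _ (B1 * s `^ (p * b - dH))); last first.
        by rewrite ler_wpM2r ?powR_ge0 // lerDl.
      have Cs01 : 0 < C * s <= 1 by rewrite mulr_gt0.
      have I0 : (0 <= osc_integral p h (C * s))%E.
        apply: integral_ge0 => x _; rewrite mule_ge0 ?lee_fin ?powR_ge0 //.
        by apply: integral_ge0 => y _; rewrite lee_fin powR_ge0.
      have := HB _ Cs01; rewrite /besov_osc -/(osc_integral p h (C * s)) => hI.
      have := HC h s G th s0 sG; set S := \sum_(w <- G) _.
      case: (osc_integral p h (C * s)) I0 hI => [I| |//] I0; last first.
        by rewrite /poweR gt_eqF ?invr_gt0.
      rewrite poweR_EFin !lee_fin in I0 * => hI hS.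
      have : I <= (B * (C * s) `^ b) `^ p.
        rewrite -[leLHS](powRr1 I0) -(mulVf (lt0r_neq0 p0)) powRrM.
        by rewrite ge0_ler_powR ?nnegrE ?powR_ge0 ?(ltW p0) // mulr_ge0 ?powR_ge0.
      move=> /(le_trans hS); rewrite [(C * s) `^ b]powRM ?(ltW C0) ?(ltW s0) // mulrA.
      rewrite [((_ * _) * _) `^ p]powRM ?mulr_ge0 ?powR_ge0 // -powRrM [b * p]mulrC.
      have -> : s `^ (p * b) = s `^ (p * b - dH) * s `^ dH.
        by rewrite -powRD ?subrK //; apply/implyP => _; rewrite gt_eqF.
      rewrite mulrAC [leRHS]mulrA ler_pM2r ?powR_gt0 // /B1 -mulrA.
      by rewrite ler_pdivlMl.
    apply: (@le_trans _ _ (B2 * s `^ (p * b - dH))); last first.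
      by rewrite ler_wpM2r ?powR_ge0 // lerDr.
    apply: (@le_trans _ _ ((size G)%:R * cell_energy h [::] `^ p)).
      rewrite mulr_natl -iter_addr_0 -count_predT -big_const_seq ler_sum // => w _.
      by rewrite ge0_ler_powR ?nnegrE ?(ltW p0) // cell_energy_nil.
    rewrite /B2 mulrAC -[leRHS]mulrA mulrAC ler_wpM2r ?powR_ge0 //.
    rewrite (le_trans (HZ s G s0 sG)) // ler_wpM2l ?(ltW Z0) // mulrC.
    rewrite powRD; last by apply/implyP => _; rewrite gt_eqF.
    rewrite mulrA -powRM ?(ltW C0) ?(ltW s0) // -[leLHS]mul1r ler_wpM2r ?powR_ge0 //.
    have : 1 `^ (p * b) <= (C * s) `^ (p * b).
      by rewrite ge0_ler_powR ?nnegrE ?(ltW pb0) ?(ltW Cs) // mulr_ge0 ?(ltW C0) ?(ltW s0).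
    by rewrite powR1.
  have [C C0 HC] := osc_integral_le p0.
  pose B1 := C * `|B| * C `^ (p * b).
  have B10 : 0 <= B1 by rewrite mulr_ge0 ?powR_ge0 // mulr_ge0 // ltW.
  exists (B1 `^ p^-1); first exact: powR_ge0.
  move=> t t01; have [t0 t1] := andP t01.
  have [s [G [s01 sG sCt hI]]] := HC h t th t01; have [s0 s1] := andP s01.
  rewrite /besov_osc -/(osc_integral p h t).
  have I0 : (0 <= osc_integral p h t)%E.
    apply: integral_ge0 => x _; rewrite mule_ge0 ?lee_fin ?powR_ge0 //.
    by apply: integral_ge0 => y _; rewrite lee_fin powR_ge0.
  case: (osc_integral p h t) I0 hI => [I| |//] I0; last by rewrite leye_eq.
  rewrite poweR_EFin !lee_fin in I0 * => hI.
  have : I <= B1 * t `^ (p * b).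
    rewrite (le_trans hI) // (@le_trans _ _ (C * s `^ dH * (`|B| * s `^ (p * b - dH)))) //.
      rewrite ler_wpM2l ?mulr_ge0 ?powR_ge0 ?(ltW C0) // (le_trans (HB s G s01 sG)) //.
      by rewrite ler_wpM2r ?powR_ge0 ?ler_norm.
    rewrite mulrACA -powRD; last by apply/implyP => _; rewrite gt_eqF.
    rewrite addrC subrK /B1 -[leRHS]mulrA ler_wpM2l ?mulr_ge0 ?(ltW C0) //.
    rewrite -powRM ?(ltW C0) ?(ltW t0) // ge0_ler_powR ?nnegrE ?(ltW pb0) ?(ltW s0) //.
    by rewrite mulr_ge0 ?(ltW C0) ?(ltW t0).
  move=> hI2; have -> : B1 `^ p^-1 * t `^ b = (B1 * t `^ (p * b)) `^ p^-1.
    rewrite powRM ?powR_ge0 // -powRrM mulrC [p * b]mulrC mulfK ?gt_eqF //.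
    by rewrite mulrC.
  by rewrite ge0_ler_powR ?nnegrE ?invr_ge0 ?(ltW p0) // mulr_ge0 ?powR_ge0.
- split=> [[B B0 HB]|[B HB]].
    have [C [c [C0 c0 HC]]] := osc_sup_ge.
    pose B1 := c^-1 * (B * C `^ b); pose B2 := cell_energy h [::] * C `^ b.
    have B10 : 0 <= B1 by rewrite mulr_ge0 ?invr_ge0 ?(ltW c0) // mulr_ge0 ?powR_ge0.
    have B20 : 0 <= B2 by rewrite mulr_ge0 ?powR_ge0.
    exists (B1 + B2) => s G w s01 sG wG; have [s0 s1] := andP s01.
    have [Cs|Cs] := leP (C * s) 1.
      apply: (@le_trans _ _ (B1 * s `^ b)); last first.
        by rewrite ler_wpM2r ?powR_ge0 // lerDl.
      have Cs01 : 0 < C * s <= 1 by rewrite mulr_gt0.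
      have [x [y [Kx Ky Rxy hxy]]] := HC h s G w th s0 sG wG.
      rewrite /B1 -mulrA ler_pdivlMl // (le_trans hxy) //.
      rewrite -mulrA -powRM ?(ltW C0) ?(ltW s0) // -lee_fin.
      apply: le_trans (HB _ Cs01); apply: ereal_sup_ubound.
      by exists (x, y).
    apply: (@le_trans _ _ (B2 * s `^ b)); last first.
      by rewrite ler_wpM2r ?powR_ge0 // lerDr.
    rewrite (le_trans (cell_energy_nil w th)) // /B2 -mulrA -powRM ?(ltW C0) ?(ltW s0) //.
    rewrite ler_peMr //; have : 1 `^ b <= (C * s) `^ b.
      by rewrite ge0_ler_powR ?nnegrE ?(ltW b0) ?(ltW Cs) // mulr_ge0 ?(ltW C0) ?(ltW s0).
    by rewrite powR1.
  have [D D0 HD] := matching_cut; have [A A0 HA] := near_osc.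
  pose B1 := A * (`|B| *+ 2 * D `^ b).
  exists B1; first by rewrite mulr_ge0 ?(ltW A0) // mulr_ge0 ?powR_ge0 // mulrn_wge0.
  move=> t t01; have [t0 t1] := andP t01.
  have [s [G [s01 sG sDt Ht]]] := HD t t01; have [s0 s1] := andP s01.
  rewrite /besov_osc; apply: ge_ereal_sup => _ [[x y] /= [Kx Ky [_ Rxy]] <-].
  have [v vG vx] := cut_cover (proj1 sG) Kx; have [w wG wy] := cut_cover (proj1 sG) Ky.
  rewrite lee_fin (le_trans (HA h v w x y th (Ht _ _ _ _ vG wG vx wy Rxy) vx wy)) //.
  rewrite /B1 -mulrA ler_wpM2l ?(ltW A0) // mulr2n -mulrA mulrDl.
  have sb : s `^ b <= D `^ b * t `^ b.
    rewrite -powRM ?(ltW D0) ?(ltW t0) // ge0_ler_powR ?nnegrE ?(ltW b0) ?(ltW s0) //.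
    by rewrite mulr_ge0 ?(ltW D0) ?(ltW t0).
  have hw' u : u \in G -> cell_energy h u <= `|B| * (D `^ b * t `^ b).
    move=> uG; rewrite (le_trans (HB s G u s01 sG uG)) //.
    rewrite (@le_trans _ _ (`|B| * s `^ b)) ?ler_wpM2l //.
    by rewrite ler_wpM2r ?powR_ge0 ?ler_norm.
  by rewrite lerD ?hw'.
Qed.

(** * Critical curve *)

(** For finite exponents each term is compared with the threshold $s^b$ by [powR_le_exponent_mix];
    the thresholds add up to $O(s^{qb - d_H})$ because a cut of scale [s] has $O(s^{-d_H})$
    words. *)
Lemma decay_mono p p' b h : (1 <= p)%E -> (p <= p')%E ->
  decay p' b h -> decay p b h.
Proof.
have [Z Z0 HZ] := scale_cut_size.
case: p => [q|_|//]; last by rewrite leye_eq => /eqP->.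
rewrite lee_fin => q1; have q0 : 0 < q by rewrite (lt_le_trans _ q1).
have en0 := cell_energy_ge0 h.
have sD (s : R) : 0 < s -> s `^ (q * b) * s `^ (- dH) = s `^ (q * b - dH).
  by move=> s0; rewrite -powRD //; apply/implyP => _; rewrite gt_eqF.
have size_sum (s : R) G (C : R) : 0 < s -> scale_cut s G -> 0 <= C ->
    \sum_(w <- G) C * s `^ (q * b) <= C * Z * s `^ (q * b - dH).
  move=> s0 sG C0; rewrite big_const_seq count_predT iter_addr_0 -[leLHS]mulr_natl.
  rewrite -sD // [leLHS]mulrC -!mulrA ler_wpM2l // mulrCA ler_wpM2l ?powR_ge0 //.
  exact: HZ.
case: p' => [q'|_|//].
  rewrite lee_fin => qq' [C HC]; exists (1 * Z + C) => s G s01 sG.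
  have [s0 s1] := andP s01; have q'0 : 0 < q' by rewrite (lt_le_trans q0).
  have e1 : (s `^ b) `^ q = s `^ (q * b) by rewrite -powRrM mulrC.
  have e2 : (s `^ b) `^ q' = s `^ (q' * b) by rewrite -powRrM mulrC.
  have c0 : 0 <= s `^ (q * b) / s `^ (q' * b) by rewrite divr_ge0 ?powR_ge0.
  apply: (@le_trans _ _ (\sum_(w <- G) (1 * s `^ (q * b) +
      s `^ (q * b) / s `^ (q' * b) * cell_energy h w `^ q'))).
    apply: ler_sum => w _; rewrite mul1r -e1 -e2.
    by apply: powR_le_exponent_mix; rewrite ?powR_gt0 ?q0.
  rewrite big_split /= mulrDl lerD ?size_sum // -mulr_sumr.
  rewrite (le_trans (ler_wpM2l c0 (HC s G s01 sG))) //.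
  rewrite -!sD // (_ : s `^ (q' * b - dH) = s `^ (q' * b) * s `^ (- dH)); last first.
    by rewrite -powRD //; apply/implyP => _; rewrite gt_eqF.
  rewrite le_eqVlt; apply/orP; left; apply/eqP.
  by field; rewrite gt_eqF // powR_gt0.
move=> [C HC]; exists (`|C| `^ q * Z) => s G s01 sG; have [s0 s1] := andP s01.
apply: le_trans (size_sum s G _ s0 sG (powR_ge0 _ _)).
rewrite big_seq [leRHS]big_seq; apply: ler_sum => w wG.
rewrite [q * b]mulrC powRrM -powRM ?powR_ge0 //.
rewrite ge0_ler_powR ?nnegrE ?(ltW q0) ?mulr_ge0 ?powR_ge0 //.
by rewrite (le_trans (HC s G w s01 sG wG)) // ler_wpM2r ?powR_ge0 ?ler_norm.
Qed.

Lemma inve_pos (x : R) : 0 < x -> (x%:E)^-1%E = (x^-1)%:E.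
Proof. by move=> x0; rewrite inver gt_eqF. Qed.

Lemma inve_zero : ((0 : R)%:E)^-1%E = +oo%E.
Proof. by rewrite inver eqxx. Qed.

(** Here [x] and [y] are reciprocals of exponents. Word by word, the powers of $e_w$ divided by
    $s^{c/x}$ and $s^{d/y}$ are interpolated with weights [p * (a * x)] and [p * (b * y)], which add
    up to 1 by the choice of [p]. *)
Lemma decay_interp_pos (x y a b c d : R) h : 0 < x -> 0 < y -> 0 < a -> 0 < b ->
  a + b = 1 -> decay (x^-1)%:E c h -> decay (y^-1)%:E d h ->
  decay ((a * x + b * y)^-1)%:E (a * c + b * d) h.
Proof.
move=> x0 y0 a0 b0 ab [C HC] [D HD]; have en0 := cell_energy_ge0 h.
have z0 : 0 < a * x + b * y by rewrite addr_gt0 ?mulr_gt0.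
set p := (a * x + b * y)^-1; have p0 : 0 < p by rewrite invr_gt0.
pose e := a * c + b * d.
exists (C + D) => s G s01 sG; have [s0 s1] := andP s01.
have nz (t : R) : s `^ t != 0 by rewrite gt_eqF // powR_gt0.
have sD (t t' : R) : s `^ (t + t') = s `^ t * s `^ t'.
  by rewrite powRD //; apply/implyP => _; rewrite gt_eqF.
have key w : cell_energy h w `^ p <= s `^ (p * e) *
    (cell_energy h w `^ x^-1 * s `^ (- (x^-1 * c)) +
     cell_energy h w `^ y^-1 * s `^ (- (y^-1 * d))).
  have pe : p * (a * x) + p * (b * y) = 1 by rewrite -mulrDr mulVf // gt_eqF.
  have := powR_interpolation
     (mulr_ge0 (powR_ge0 (cell_energy h w) x^-1) (powR_ge0 s (- (x^-1 * c))))
     (mulr_ge0 (powR_ge0 (cell_energy h w) y^-1) (powR_ge0 s (- (y^-1 * d))))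
     (ltW (mulr_gt0 p0 (mulr_gt0 a0 x0))) (ltW (mulr_gt0 p0 (mulr_gt0 b0 y0))) pe.
  rewrite !powRM ?powR_ge0 // -!powRrM.
  have -> : x^-1 * (p * (a * x)) = p * a by field; rewrite gt_eqF.
  have -> : y^-1 * (p * (b * y)) = p * b by field; rewrite gt_eqF.
  have -> : - (x^-1 * c) * (p * (a * x)) = - (p * (a * c)) by field; rewrite gt_eqF.
  have -> : - (y^-1 * d) * (p * (b * y)) = - (p * (b * d)) by field; rewrite gt_eqF.
  rewrite mulrACA -sD -opprD -mulrDr -powRD; last first.
    by rewrite -mulrDr ab mulr1 gt_eqF.
  rewrite -mulrDr ab mulr1 -/e powRN ler_pdivrMr ?powR_gt0 //.
  by rewrite [leRHS]mulrC.
apply: le_trans (ler_sum _ (fun w _ => key w)) _.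
rewrite -mulr_sumr big_split /= -!mulr_suml.
have bound (q c' C' : R) : \sum_(w <- G) cell_energy h w `^ q <= C' * s `^ (q * c' - dH) ->
    (\sum_(w <- G) cell_energy h w `^ q) * s `^ (- (q * c')) <= C' * s `^ (- dH).
  move=> hq; apply: le_trans (ler_wpM2r (powR_ge0 _ _) hq) _.
  by rewrite -mulrA -sD addrAC subrr add0r.
have := lerD (bound _ _ _ (HC s G s01 sG)) (bound _ _ _ (HD s G s01 sG)).
rewrite -mulrDl => hs; apply: le_trans (ler_wpM2l (powR_ge0 _ _) hs) _.
by rewrite mulrCA -sD.
Qed.

(** The end point [x = 0]: as [p * b] equals [y^-1], the factor $e_w^{pb}$ is summed by the second
    decay hypothesis while $e_w^{pa}$ is bounded by the first. *)
Lemma decay_interp_zero (y a b c d : R) h : 0 < y -> 0 < a -> 0 < b -> a + b = 1 ->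
  decay +oo%E c h -> decay (y^-1)%:E d h ->
  decay ((b * y)^-1)%:E (a * c + b * d) h.
Proof.
move=> y0 a0 b0 ab [C HC] [D HD]; have en0 := cell_energy_ge0 h.
have by0 : 0 < b * y by rewrite mulr_gt0.
set p := (b * y)^-1; have p0 : 0 < p by rewrite invr_gt0.
have py : y^-1 = p * b by rewrite /p; field; rewrite !gt_eqF.
exists (`|C| `^ (p * a) * D) => s G s01 sG; have [s0 s1] := andP s01.
have nz (t : R) : s `^ t != 0 by rewrite gt_eqF // powR_gt0.
have sD (t t' : R) : s `^ (t + t') = s `^ t * s `^ t'.
  by rewrite powRD //; apply/implyP => _; rewrite gt_eqF.
have key w : w \in G -> cell_energy h w `^ p <=
    `|C| `^ (p * a) * s `^ (p * (a * c)) * cell_energy h w `^ y^-1.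
  move=> wG; rewrite py -[X in _ `^ X <= _]mulr1 -ab mulrDr powRD; last first.
    by rewrite -mulrDr ab mulr1 gt_eqF.
  rewrite ler_wpM2r ?powR_ge0 //.
  have -> : s `^ (p * (a * c)) = (s `^ c) `^ (p * a).
    by rewrite -powRrM; congr (_ `^ _); ring.
  rewrite -powRM ?powR_ge0 // ge0_ler_powR ?nnegrE ?mulr_ge0 ?powR_ge0 ?(ltW p0) ?(ltW a0) //.
  by rewrite (le_trans (HC s G w s01 sG wG)) // ler_wpM2r ?powR_ge0 ?ler_norm.
apply: (@le_trans _ _ (\sum_(w <- G) `|C| `^ (p * a) * s `^ (p * (a * c)) *
    cell_energy h w `^ y^-1)).
  by rewrite big_seq [leRHS]big_seq ler_sum.
have k0 : 0 <= `|C| `^ (p * a) * s `^ (p * (a * c)) by rewrite mulr_ge0 ?powR_ge0.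
rewrite -mulr_sumr (le_trans (ler_wpM2l k0 (HD s G s01 sG))) //.
rewrite mulrACA -sD py le_eqVlt; apply/orP; left; apply/eqP; congr (_ * s `^ _); ring.
Qed.

Section CurveEstimates.
Local Notation C := (critical_curve F K V0 H r mu dH).
Local Notation curve theta := (C (theta%:E)^-1%E).
Local Notation dW := (walk_dim dH).
Local Notation dS := (spectral_dim dH).

Definition admissible (p : \bar R) : set R := [set sigma | 0 < sigma /\
  forall h, harmonic_functions F K V0 H r mu h -> decay p (sigma * dW / 2) h].

Lemma dW_gt0 : 0 < dW. Proof. by rewrite addr_gt0 ?dH_gt0. Qed.

Lemma critical_curveE p : (1 <= p)%E -> C p = sup (admissible p).
Proof.
move=> p1; congr sup; apply/seteqP; split=> sigma [s0 hs]; split=> // h Hh.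
  by apply/(besov_decay Hh p1 s0)/hs.
by apply/(besov_decay Hh p1 s0)/hs.
Qed.

Lemma admissible_mono p p' : (1 <= p)%E -> (p <= p')%E ->
  admissible p' `<=` admissible p.
Proof.
by move=> p1 pp' sigma [s0 hs]; split=> // h Hh; exact: decay_mono (hs h Hh).
Qed.

Lemma admissible_infty : admissible +oo%E (2 / dW).
Proof.
split=> [|h Hh]; first by rewrite divr_gt0 ?dW_gt0.
have -> : 2 / dW * dW / 2 = 1 by field; rewrite gt_eqF // dW_gt0.
exact/decay_infty/harmonic_tame.
Qed.

Lemma admissible_le p sigma : (1 <= p)%E -> admissible p sigma ->
  sigma <= 2 / dW + dS * fine p^-1%E.
Proof.
move=> p1 [s0 hs]; have [h [Hh [_ [c c0 Hc]]]] := flux_decay.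
suff : sigma * dW / 2 <= 1 + dH * fine p^-1%E.
  have -> : 2 / dW + dS * fine p^-1%E = (1 + dH * fine p^-1%E) * 2 / dW.
    by rewrite /spectral_dim; ring.
  by rewrite ler_pdivlMr ?dW_gt0 // ler_pdivrMr.
have := hs h Hh; case: p p1 {hs} => [q|_|//].
  rewrite lee_fin => q1; have q0 : 0 < q by rewrite (lt_le_trans _ q1).
  move=> [D HD]; rewrite inve_pos //=.
  have -> : 1 + dH * q^-1 = (dH + q) / q by field; rewrite gt_eqF.
  rewrite ler_pdivlMr // [leLHS]mulrC -lerBlDl; apply: (@powR_exponent_le _ (c `^ q) D).
    by rewrite powR_gt0.
  move=> s s01; have [G sG] := scale_cut_exists s01; have [s0' _] := andP s01.
  apply: le_trans (HD s G s01 sG); have [w wG hw] := Hc s G s0' sG.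
  apply: le_trans (ler_sum_seq_mem (f := fun w => cell_energy h w `^ q) _ wG).
    rewrite -powRM ?(ltW c0) ?(ltW s0') // ge0_ler_powR ?nnegrE ?(ltW q0) ?cell_energy_ge0 //.
    by rewrite mulr_ge0 ?(ltW c0) ?(ltW s0').
  by move=> v _; exact: powR_ge0.
move=> [D HD]; rewrite invey /= mulr0 addr0.
apply: (@powR_exponent_le _ c D) => // s s01.
have [G sG] := scale_cut_exists s01; have [s0' _] := andP s01.
have [w wG hw] := Hc s G s0' sG; rewrite powRr1 ?(ltW s0') //.
exact: le_trans (HD s G w s01 sG wG).
Qed.

(** Excludes the default value 0 of [sup]: the case $p = \infty$ provides an element and the flux
    estimate an upper bound. *)
Lemma admissible_has_sup p : (1 <= p)%E -> has_sup (admissible p).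
Proof.
move=> p1; split.
  exists (2 / dW); apply: (admissible_mono p1 (leey p)).
  exact: admissible_infty.
by exists (2 / dW + dS * fine p^-1%E) => sigma; exact: admissible_le.
Qed.

Lemma admissible_le_curve p sigma : (1 <= p)%E -> admissible p sigma -> sigma <= C p.
Proof.
move=> p1 ps; rewrite critical_curveE //; apply: ub_le_sup => //.
by have [] := admissible_has_sup p1.
Qed.

Lemma curve_le p b : (1 <= p)%E -> (forall sigma, admissible p sigma -> sigma <= b) ->
  C p <= b.
Proof.
move=> p1 h; rewrite critical_curveE //; apply: ge_sup => //.
by have [] := admissible_has_sup p1.
Qed.

Lemma critical_curve_mono p p' : (1 <= p)%E -> (p <= p')%E -> C p' <= C p.
Proof.
move=> p1 pp'; apply: curve_le; first exact: le_trans pp'.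
by move=> sigma /(admissible_mono p1 pp')/(admissible_le_curve p1).
Qed.

Lemma critical_curve_infty : C +oo%E = 2 / dW.
Proof.
apply/eqP; rewrite eq_le; apply/andP; split.
  apply: curve_le; first exact: leey.
  by move=> sigma /admissible_le; rewrite invey mulr0 addr0; apply; exact: leey.
by apply: admissible_le_curve; [exact: leey|exact: admissible_infty].
Qed.

Lemma critical_curve_two : C 2%:E = 1.
Proof.
have p1 : (1 <= 2%:E :> \bar R)%E by rewrite lee_fin ler1n.
apply/eqP; rewrite eq_le; apply/andP; split.
  apply: curve_le => // sigma [s0 hs]; have [h [Hh [e0 _]]] := flux_decay.
  have := decay_two_ge (harmonic_tame Hh) e0 (hs h Hh).
  by rewrite ler_pM2r ?invr_gt0 // -[leRHS]mul1r ler_pM2r ?dW_gt0.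
apply: admissible_le_curve => //; split=> // h Hh; rewrite mul1r.
exact/decay_two/harmonic_tame.
Qed.

Lemma inve_ge1 (x : R) : 0 <= x <= 1 -> (1 <= (x%:E)^-1 :> \bar R)%E.
Proof.
move=> /andP[x0 x1]; have [->|xn0] := eqVneq x 0; first by rewrite inve_zero leey.
have xp : 0 < x by rewrite lt0r xn0.
by rewrite inve_pos // lee_fin invf_ge1.
Qed.

Lemma inve_anti (x y : R) : 0 <= x -> x <= y -> ((y%:E)^-1 <= (x%:E)^-1 :> \bar R)%E.
Proof.
move=> x0 xy; have [->|xn0] := eqVneq x 0; first by rewrite inve_zero leey.
have xp : 0 < x by rewrite lt0r xn0.
by rewrite !inve_pos ?(lt_le_trans xp) // lee_fin lef_pV2 ?posrE // (lt_le_trans xp).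
Qed.

Lemma decay_interp (x y a b c d : R) h : 0 <= x <= 1 -> 0 <= y <= 1 ->
  0 < a -> 0 < b -> a + b = 1 ->
  decay (x%:E)^-1%E c h -> decay (y%:E)^-1%E d h ->
  decay ((a * x + b * y)%:E)^-1%E (a * c + b * d) h.
Proof.
move=> /andP[x0 _] /andP[y0 _] a0 b0 ab.
have [->|xn0] := eqVneq x 0; have [->|yn0] := eqVneq y 0.
- rewrite !mulr0 addr0 inve_zero => -[D HD] [D' HD'].
  exists (`|D| `^ a * `|D'| `^ b) => s G w s01 sG wG; have [s0 _] := andP s01.
  have e0 := cell_energy_ge0 h w.
  rewrite -[leLHS](powRr1 e0) -ab powRD ?ab ?oner_eq0 //.
  have -> : s `^ (a * c + b * d) = (s `^ c) `^ a * (s `^ d) `^ b.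
    rewrite -!powRrM powRD 1?[c * a]mulrC 1?[d * b]mulrC //.
    by apply/implyP => _; rewrite gt_eqF.
  rewrite mulrACA -!powRM ?powR_ge0 //.
  apply: ler_pM; rewrite ?powR_ge0 // ge0_ler_powR ?nnegrE ?mulr_ge0 ?powR_ge0
    ?(ltW a0) ?(ltW b0) //.
    by rewrite (le_trans (HD s G w s01 sG wG)) // ler_wpM2r ?powR_ge0 ?ler_norm.
  by rewrite (le_trans (HD' s G w s01 sG wG)) // ler_wpM2r ?powR_ge0 ?ler_norm.
- have yp : 0 < y by rewrite lt0r yn0.
  rewrite mulr0 add0r inve_zero !inve_pos ?mulr_gt0 //.
  exact: decay_interp_zero.
- have xp : 0 < x by rewrite lt0r xn0.
  rewrite mulr0 addr0 inve_zero !inve_pos ?mulr_gt0 // => hx hy.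
  rewrite addrC; apply: decay_interp_zero hy hx => //; by rewrite addrC.
- have xp : 0 < x by rewrite lt0r xn0.
  have yp : 0 < y by rewrite lt0r yn0.
  rewrite !inve_pos ?addr_gt0 ?mulr_gt0 //.
  exact: decay_interp_pos.
Qed.

Lemma curve_concave (x y a b : R) : 0 <= x <= 1 -> 0 <= y <= 1 ->
  0 <= a -> 0 <= b -> a + b = 1 ->
  a * curve x + b * curve y <= curve (a * x + b * y).
Proof.
move=> x01 y01 a0 b0 ab.
have [a00|an0] := eqVneq a 0.
  by move: ab; rewrite a00 add0r => ->; rewrite !mul0r !mul1r !add0r.
have [b00|bn0] := eqVneq b 0.
  by move: ab; rewrite b00 addr0 => ->; rewrite !mul0r !mul1r !addr0.
have ap : 0 < a by rewrite lt0r an0. have bp : 0 < b by rewrite lt0r bn0.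
have z01 : 0 <= a * x + b * y <= 1.
  have [/andP[x0 x1] /andP[y0 y1]] := (x01, y01); apply/andP; split; nra.
have px := inve_ge1 x01; have py := inve_ge1 y01; have pz := inve_ge1 z01.
(* The two suprema on the left are opened one after the other, each time solving for the curve
   value, until one admissible order per end point is left to interpolate. *)
rewrite -lerBrDr -ler_pdivlMl //; apply: curve_le => // sigma [s0 hs].
rewrite ler_pdivlMl // lerBrDr -lerBrDl -ler_pdivlMl //.
apply: curve_le => // tau [t0 ht]; rewrite ler_pdivlMl // lerBrDl.
apply: admissible_le_curve => //; split=> [|h Hh]; first by rewrite addr_gt0 ?mulr_gt0.
have := decay_interp x01 y01 ap bp ab (hs h Hh) (ht h Hh).
by congr decay; field.
Qed.

(** Concavity between the parameters 0 and 1/2, with weight [2 * x] at 1/2. *)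
Lemma curve_line_ge (x : R) : 0 <= x <= 2^-1 ->
  1 + (2 * x - 1) * (dS - 1) <= curve x.
Proof.
move=> /andP[x0 x1].
have h01 : 0 <= (2^-1 : R) <= 1 by rewrite invr_ge0 ler0n invf_le1 // ler1n.
have := @curve_concave 0 2^-1 (1 - 2 * x) (2 * x).
rewrite lexx ler01 h01 => /(_ isT isT).
rewrite inve_zero critical_curve_infty (@inve_pos 2^-1) ?invr_gt0 // invrK critical_curve_two.
have -> : (1 - 2 * x) * 0 + 2 * x / 2 = x by field.
have := dW_gt0; rewrite /spectral_dim => dW0.
have -> : 1 + (2 * x - 1) * (2 * dH / dW - 1) = (1 - 2 * x) * (2 / dW) + 2 * x * 1.
  by rewrite /walk_dim in dW0 *; field; rewrite gt_eqF.
apply; lra.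
Qed.

(** Concavity between 0 and [x], taken at 1/2, which has weight $(2x)^{-1}$ at [x], and solved for
    the value at [x]. *)
Lemma curve_line_le (x : R) : 2^-1 <= x <= 1 ->
  curve x <= 1 + (2 * x - 1) * (dS - 1).
Proof.
move=> /andP[x0 x1]; have xp : 0 < x by rewrite (lt_le_trans _ x0) // invr_gt0.
have x01 : 0 <= x <= 1 by rewrite (ltW xp).
have := @curve_concave 0 x (1 - (2 * x)^-1) (2 * x)^-1.
rewrite lexx ler01 x01 => /(_ isT isT).
have -> : (1 - (2 * x)^-1) * 0 + (2 * x)^-1 * x = 2^-1 by field; rewrite gt_eqF.
rewrite inve_zero critical_curve_infty (@inve_pos 2^-1) ?invr_gt0 // invrK critical_curve_two.
have x20 : 0 < 2 * x by rewrite mulr_gt0.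
rewrite subr_ge0 invf_le1 // invr_ge0 (ltW x20) subrK => h.
have {}h : (1 - (2 * x)^-1) * (2 / dW) + (2 * x)^-1 * curve x <= 1.
  by apply: h => //; rewrite -ler_pdivrMl // mulr1.
have := dW_gt0; rewrite /spectral_dim => dW0.
have -> : 1 + (2 * x - 1) * (2 * dH / dW - 1) =
    2 * x * (1 - (1 - (2 * x)^-1) * (2 / dW)).
  rewrite /walk_dim in dW0 *; field; by rewrite !gt_eqF.
by rewrite -ler_pdivrMl // lerBrDl.
Qed.

End CurveEstimates.

Lemma critical_curve_spec :
  let dW := walk_dim dH in
  let dS := spectral_dim dH in
  let C := critical_curve F K V0 H r mu dH in
  [/\ [/\ @convex_function R R^o `[0, 1] (fun theta => - C (theta%:E)^-1%E),
          {in `[0, 1] &, {homo (fun theta : R => C (theta%:E)^-1%E) :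
             s t / s <= t}},
          C +oo%E = 2 / dW &
          C 2%:E = 1],
      forall p : R, 1 <= p <= 2 ->
        1 <= C p%:E <= 1 + (2 / p - 1) * (dS - 1) &
      forall p : \bar R, (2%:E <= p)%E ->
        1 + (2 * fine p^-1%E - 1) * (dS - 1) <= C p
          <= Num.min 1 (2 / dW + dS * fine p^-1%E)].
Proof.
move=> dW dS C; split; first split.
- move=> t x y; rewrite !inE /= !in_itv /= => x01 y01.
  change (- C ((t%:num * x + (1 - t%:num) * y)%:E)^-1%E <=
    t%:num * - C (x%:E)^-1%E + (1 - t%:num) * - C (y%:E)^-1%E).
  rewrite !mulrN -opprD lerN2; apply: curve_concave => //.
  by rewrite addrC subrK.
- move=> x y; rewrite !in_itv /= => /andP[x0 x1] /andP[y0 y1] xy.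
  by apply: critical_curve_mono; [apply: inve_ge1; rewrite y0|exact: inve_anti].
- exact: critical_curve_infty.
- exact: critical_curve_two.
- move=> p /andP[p1 p2]; have p0 : 0 < p by rewrite (lt_le_trans _ p1).
  apply/andP; split.
    by rewrite -[leLHS]critical_curve_two; apply: critical_curve_mono; rewrite lee_fin.
  have := @curve_line_le p^-1; rewrite (@inve_pos p^-1) ?invr_gt0 // invrK; apply.
  by rewrite lef_pV2 ?posrE // p2 invf_le1.
- move=> p p2; have p1 : (1 <= p)%E by apply: le_trans p2; rewrite lee_fin ler1n.
  apply/andP; split; last first.
    rewrite le_min; apply/andP; split.
      by rewrite -[leRHS]critical_curve_two critical_curve_mono // lee_fin ler1n.
    by apply: curve_le => // sigma; exact: admissible_le.
  case: p p2 p1 => [q|_ _|//].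
    rewrite lee_fin => q2 _; have q0 : 0 < q by rewrite (lt_le_trans _ q2).
    have := @curve_line_ge q^-1; rewrite (@inve_pos q^-1) ?invr_gt0 // invrK.
    by rewrite inve_pos //=; apply; rewrite invr_ge0 (ltW q0) lef_pV2 ?posrE.
  have := @curve_line_ge 0; rewrite inve_zero invey /=; apply.
  by rewrite lexx /= invr_ge0 ler0n.
Qed.

End HarmonicStructure.

Theorem proposition3p2 (R : realType) (M : completeMetricType R) (N : nat)
    (F : 'I_N -> M -> M) (K : set M) (pi : (nat -> 'I_N) -> M)
    (H : M -> M -> R) (r : 'I_N -> R) (dH : R) (mu : probability (borel M) R)
    (F_inj : forall i, injective (F i))
    (F_contr : forall i, contractive (F i))
    (K_self_similar : self_similar_set F K)
    (K_connected : connected K)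
    (pi_coding : coding_map F K pi)
    (pcf : finite_set (post_critical_set F K pi))
    (V0 : set M) (V0_def : V0 = boundary_set F K pi)
    (H_laplacian : laplacian_matrix V0 H)
    (Hr_regular : regular_harmonic_structure F V0 H r)
    (diam1 : resistance_diam F K V0 H r = 1)
    (dH_eq : \sum_(i < N) r i `^ dH = 1)
    (mu_self_similar : self_similar_measure F K r dH mu) :
  let dW := walk_dim dH in
  let dS := spectral_dim dH in
  let C := critical_curve F K V0 H r mu dH in
  [/\ [/\ @convex_function R R^o `[0, 1] (fun theta => - C (theta%:E)^-1%E),
          {in `[0, 1] &, {homo (fun theta : R => C (theta%:E)^-1%E) :
             s t / s <= t}},
          C +oo%E = 2 / dW &
          C 2%:E = 1],
      forall p : R, 1 <= p <= 2 ->
        1 <= C p%:E <= 1 + (2 / p - 1) * (dS - 1) &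
      forall p : \bar R, (2%:E <= p)%E ->
        1 + (2 * fine p^-1%E - 1) * (dS - 1) <= C p
          <= Num.min 1 (2 / dW + dS * fine p^-1%E)].
Proof.
exact: (critical_curve_spec F_inj F_contr K_self_similar K_connected pi_coding
  pcf V0_def H_laplacian Hr_regular diam1 dH_eq mu_self_similar).
Qed.
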